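(* Let $n\ge 2$, $s\in(0,1)\setminus\{\tfrac12\}$ and let $f=(f_j)_{j=1}^n\in\mathcal{S}(\mathbb{R}^n;S^1(\mathbb{R}^n))$ be a vector field. Then for every $1\le i\le n$, $$f_i(x)=(-\Delta)^s\left[-2s\,\mathbf{R}_i\mathcal{A}^0_{1,s}f(x)-\mathcal{A}^{1,i}_{1,s}f(x)\right].$$
   Context: $\mathcal{S}(\mathbb{R}^n;S^1(\mathbb{R}^n))$ is the space of vector fields on $\mathbb{R}^n$ with complex-valued Schwartz components. Repeated indices are summed from $1$ to $n$. The fractional divergent beam ray transform of $f$ is $(\chi_{s,1}f)(x,\xi)=\int_0^\infty t^{2s-1}f_j(x+t\xi)\xi^j\,dt$ for $x\in\mathbb{R}^n$, $\xi\in\mathbb{S}^{n-1}$. Its averages are $$\mathcal{A}^0_{1,s}f(x)=c^{1,0}_{n,s}\int_{\mathbb{S}^{n-1}}(\chi_{s,1}f)(x,\xi)\,dS_\xi,\qquad \mathcal{A}^{1,i}_{1,s}f(x)=c^{1,1}_{n,s}\int_{\mathbb{S}^{n-1}}\xi^i(\chi_{s,1}f)(x,\xi)\,dS_\xi,$$ with $$c^{1,0}_{n,s}=\frac{-\Gamma\left(\frac{n+1-2s}{2}\right)}{2^{2s}\pi^{n/2}\Gamma\left(s+\frac12\right)},\qquad c^{1,1}_{n,s}=\frac{-\Gamma\left(\frac{n+2-2s}{2}\right)}{2^{2s-1}\pi^{n/2}\Gamma(s)}.$$ The Fourier transform is $\mathscr{F}u(y)=\int_{\mathbb{R}^n}e^{-\mathrm{i}\langle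 x,y\rangle}u(x)\,dx$, extended to tempered distributions. The Riesz transform $\mathbf{R}_i$ is the Fourier multiplier $\mathscr{F}(\mathbf{R}_iu)(y)=-\mathrm{i}\frac{y_i}{|y|}\mathscr{F}u(y)$, and $(-\Delta)^su=\mathscr{F}^{-1}(|y|^{2s}\mathscr{F}u)$ for tempered distributions $u$ whenever the right-hand side is well defined. *)

(* Defs.v *)
From HB Require Import structures.
From mathcomp Require Import all_boot all_order all_algebra.
From mathcomp Require Import all_classical all_reals all_analysis.
From mathcomp Require Import measurable_realfun complex.

Set Implicit Arguments.
Unset Strict Implicit.
Unset Printing Implicit Defensive.
Import Order.TTheory GRing.Theory Num.Theory.
Import numFieldNormedType.Exports.

Local Open Scope classical_set_scope.
Local Open Scope complex_scope.
Local Open Scope ring_scope.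

(* The Borel sigma-algebra of R^n, as the one generated by the coordinates. *)
Definition row_display : measure_display.
Proof. exact: default_measure_display. Qed.

Section row_measurable.
Context {R : realType} (n : nat).

Definition row_coor (i : 'I_n) (x : 'rV[R]_n) : R := x ord0 i.

Let row_set0 : g_sigma_preimage row_coor set0.
Proof. exact: sigma_algebra0. Qed.

Let row_setC A : g_sigma_preimage row_coor A -> g_sigma_preimage row_coor (~` A).
Proof. exact: sigma_algebraC. Qed.

Let row_bigcup (F : (set 'rV[R]_n)^nat) :
  (forall i, g_sigma_preimage row_coor (F i)) ->
  g_sigma_preimage row_coor (\bigcup_i (F i)).
Proof. exact: sigma_algebra_bigcup. Qed.

HB.instance Definition _ := @isMeasurable.Build row_display
  'rV[R]_n (g_sigma_preimage row_coor) row_set0 row_setC row_bigcup.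

End row_measurable.

Lemma measurable_row_coor (R : realType) n (i : 'I_n) :
  measurable_fun [set: 'rV[R]_n] (row_coor i).
Proof.
move=> _ Y mY; rewrite setTI; apply: sub_sigma_algebra => /=.
rewrite -bigcup_seq/=; exists i => /=; first by rewrite mem_index_enum.
by exists Y => //; rewrite setTI.
Qed.

Lemma measurable_fun_rowP (R : realType) d (T : measurableType d) n
    (f : T -> 'rV[R]_n) :
  (forall i, measurable_fun [set: T] (row_coor i \o f)) ->
  measurable_fun [set: T] f.
Proof.
move=> mf.
have H : g_sigma_preimage (fun i => row_coor i \o f) `<=` @measurable _ T.
  apply: smallest_sub; first exact: sigma_algebra_measurable.
  case: n f mf => [|n] f mf; first by rewrite big_ord0.
  rewrite -bigcup_mkord_ord; apply: bigcup_sub => i Ii.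
  by move=> A [B mB <-]; exact: mf.
move=> _ A mA; apply: H; rewrite g_sigma_preimage_comp.
by exists A.
Qed.

Section lebesgue_row.
Context {R : realType}.

Definition row_cons n (p : measurableTypeR R * 'rV[R]_n) : 'rV[R]_n.+1 :=
  row_mx (p.1)%:M p.2 : 'rV[R]_(1 + n).

Lemma row_cons0 n (p : measurableTypeR R * 'rV[R]_n) : row_coor ord0 (row_cons p) = p.1.
Proof.
rewrite /row_coor /row_cons.
have -> : (ord0 : 'I_n.+1) = lshift n (ord0 : 'I_1) by apply/val_inj.
by rewrite (@row_mxEl _ 1 1 n) mxE eqxx.
Qed.

Lemma row_consS n (p : measurableTypeR R * 'rV[R]_n) (i : 'I_n) :
  row_coor (lift ord0 i) (row_cons p) = row_coor i p.2.
Proof.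
rewrite /row_coor /row_cons.
have -> : lift ord0 i = rshift 1 i :> 'I_(1 + n) by apply/val_inj.
by rewrite (@row_mxEr _ 1 1 n).
Qed.

Lemma measurable_row_cons n : measurable_fun [set: measurableTypeR R * 'rV[R]_n] (@row_cons n).
Proof.
apply: measurable_fun_rowP => i.
case: (unliftP ord0 i) => [j ->|->].
  rewrite (_ : _ \o _ = row_coor j \o snd); last first.
    by apply/funext => p /=; rewrite row_consS.
  by apply: measurableT_comp => //; exact: measurable_row_coor.
rewrite (_ : _ \o _ = fst); first exact: measurable_fst.
by apply/funext => p /=; rewrite row_cons0.
Qed.

Definition row_uncons n (x : 'rV[R]_n.+1) : measurableTypeR R * 'rV[R]_n :=
  (row_coor ord0 x, \row_(i < n) row_coor (lift ord0 i) x).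

Lemma row_consK n : cancel (@row_cons n) (@row_uncons n).
Proof.
move=> [a y]; rewrite /row_uncons row_cons0; congr pair.
by apply/rowP => i; rewrite mxE row_consS.
Qed.

Lemma measurable_row_uncons n :
  measurable_fun [set: 'rV[R]_n.+1] (@row_uncons n).
Proof.
apply/measurable_fun_pairP; split; first exact: measurable_row_coor.
apply: measurable_fun_rowP => i.
rewrite (_ : _ \o _ = row_coor (lift ord0 i)); first exact: measurable_row_coor.
by apply/funext => x /=; rewrite {1}/row_coor mxE.
Qed.

HB.instance Definition _ n := @isMeasurableFun.Build _ _
  (measurableTypeR R * 'rV[R]_n)%type 'rV[R]_n.+1 (@row_cons n)
  (@measurable_row_cons n).

Section step.
Context n (mu : {sigma_finite_measure set 'rV[R]_n -> \bar R}).

Definition lebesgue_row_step : set 'rV[R]_n.+1 -> \bar R :=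
  pushforward (@lebesgue_measure R \x mu)%E (@row_cons n).

Let step0 : lebesgue_row_step set0 = 0%E.
Proof. exact: measure0. Qed.

Let step_ge0 A : (0 <= lebesgue_row_step A)%E.
Proof. exact: measure_ge0. Qed.

Let step_sigma_additive : semi_sigma_additive lebesgue_row_step.
Proof. exact: measure_semi_sigma_additive. Qed.

HB.instance Definition _ := isMeasure.Build _ _ _ lebesgue_row_step
  step0 step_ge0 step_sigma_additive.

Let step_sigma_finite : sigma_finite setT lebesgue_row_step.
Proof.
have /sigma_finiteP[F [TF ndF Foo]] := sigma_finiteT (@lebesgue_measure R).
have /sigma_finiteP[G [TG ndG Goo]] := sigma_finiteT mu.
exists (fun k => @row_uncons n @^-1` (F k `*` G k)).
  apply/esym; rewrite -subTset => x _.
  have : [set: _] (row_uncons x).1 by [].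
  have : [set: _] (row_uncons x).2 by [].
  rewrite TF TG => -[k _ Gky] [l _ Fla]; exists (maxn k l) => //; split.
    by move: Fla; apply/subsetPset/ndF/leq_maxr.
  by move: Gky; apply/subsetPset/ndG/leq_maxl.
move=> k; have [mF Fk] := Foo k; have [mG Gk] := Goo k; split.
  rewrite -[X in measurable X]setTI; apply: measurable_row_uncons => //.
  exact: measurableX.
rewrite /lebesgue_row_step /pushforward (_ : _ @^-1` _ = F k `*` G k).
  by rewrite product_measure1E// lte_mul_pinfty// ge0_fin_numE.
by apply/funext => p; rewrite /preimage /mkset row_consK.
Qed.

HB.instance Definition _ := @Measure_isSigmaFinite.Build _ _ _
  lebesgue_row_step step_sigma_finite.

End step.

Fixpoint lebesgue_row n : {sigma_finite_measure set 'rV[R]_n -> \bar R} :=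
  match n with
  | 0 => \d_(0 : 'rV[R]_0)
  | m.+1 => lebesgue_row_step (lebesgue_row m)
  end.
End lebesgue_row.

Section sphere.
Context {R : realType} (n : nat).
Implicit Types x y : 'rV[R]_n.

(* Euclidean norm; the library norm `|x| on 'rV is the sup norm. *)
Definition dotp x y : R := \sum_(i < n) x ord0 i * y ord0 i.
Definition enorm x : R := Num.sqrt (dotp x x).

Definition unit_ball : set 'rV[R]_n := [set x | enorm x <= 1].
Definition unit_sphere : set 'rV[R]_n := [set x | enorm x = 1].

Lemma measurable_enorm : measurable_fun [set: 'rV[R]_n] enorm.
Proof.
apply: (measurableT_comp (continuous_measurable_fun (@sqrt_continuous R))).
apply: measurable_sum => i.
by apply: measurable_funM; exact: measurable_row_coor.
Qed.

Lemma measurable_unit_ball : measurable unit_ball.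
Proof.
rewrite (_ : unit_ball = enorm @^-1` `]-oo, 1]); last first.
  by apply/seteqP; split => x /=; rewrite in_itv.
by rewrite -[X in measurable X]setTI; exact: measurable_enorm.
Qed.

Definition normalize x := (enorm x)^-1 *: x.

Lemma measurable_normalize : measurable_fun [set: 'rV[R]_n] normalize.
Proof.
apply: measurable_fun_rowP => i.
rewrite (_ : _ \o _ = fun x => (enorm x) `^ (-1) * row_coor i x); last first.
  apply/funext => x /=; rewrite /row_coor mxE -powR_inv1//.
  by rewrite /enorm sqrtr_ge0.
apply: measurable_funM; last exact: measurable_row_coor.
by apply: (measurableT_comp (measurable_powR _)); exact: measurable_enorm.
Qed.

HB.instance Definition _ := @isMeasurableFun.Build _ _ _ _ normalize
  measurable_normalize.

(* Surface measure dS as the cone measure n * Leb {x in B | x / |x| in A}.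
   The origin, sent to 0 by [normalize], is not on the sphere. *)
Definition sphere_measure : set 'rV[R]_n -> \bar R :=
  pushforward (mscale n%:R%:nng (mrestr (lebesgue_row n) measurable_unit_ball))
    normalize.

Let sphere0 : sphere_measure set0 = 0%E.
Proof. exact: measure0. Qed.

Let sphere_ge0 A : (0 <= sphere_measure A)%E.
Proof. exact: measure_ge0. Qed.

Let sphere_sigma_additive : semi_sigma_additive sphere_measure.
Proof. exact: measure_semi_sigma_additive. Qed.

HB.instance Definition _ := isMeasure.Build _ _ _ sphere_measure
  sphere0 sphere_ge0 sphere_sigma_additive.

End sphere.

Section complex_integral.
Context d (T : measurableType d) (R : realType)
  (mu : {measure set T -> \bar R}).
Implicit Types (D : set T) (g : T -> R[i]).

Definition cintegral D g : R[i] :=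
  (\int[mu]_(x in D) complex.Re (g x)) +i* (\int[mu]_(x in D) complex.Im (g x)).

Definition cintegrable D g : Prop :=
  mu.-integrable D (EFin \o @complex.Re R \o g) /\
  mu.-integrable D (EFin \o @complex.Im R \o g).

End complex_integral.

Section schwartz.
Context {R : realType} {n : nat}.
Implicit Types (g phi : 'rV[R]_n -> R[i]) (x y : 'rV[R]_n).

Definition cpartial (i : 'I_n) g x : R[i] :=
  ('D_(delta_mx ord0 i) (@complex.Re R \o g) x) +i*
  ('D_(delta_mx ord0 i) (@complex.Im R \o g) x).

Definition cpartials (a : seq 'I_n) g := foldr cpartial g a.

Definition smooth g : Prop := forall (a : seq 'I_n) x,
  differentiable (@complex.Re R \o cpartials a g) x /\
  differentiable (@complex.Im R \o cpartials a g) x.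

Definition schwartz g : Prop := smooth g /\
  forall (k : nat) (a : seq 'I_n), exists M : R, forall x,
    enorm x ^+ k * Normc.normc (cpartials a g x) <= M.

Definition cis (t : R) : R[i] := cos t +i* sin t.

Definition fourier phi y : R[i] :=
  cintegral (lebesgue_row n) setT (fun x => cis (- dotp x y) * phi x).

Definition fourier_inv phi x : R[i] := ((2 * pi) ^- n)%:C *
  cintegral (lebesgue_row n) setT (fun y => cis (dotp x y) * phi y).

(* A distribution is a functional on all functions, of which only the values
   on Schwartz functions are meaningful; [=S] is equality of distributions. *)
Definition dist := ('rV[R]_n -> R[i]) -> R[i].
Implicit Types u v w : dist.

Definition eq_dist u v : Prop := forall phi, schwartz phi -> u phi = v phi.

(* The last clause is continuity: |u phi| <= C * max_(k, |a| <= N) p_(k,a) phi,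
   with p_(k,a) phi the supremum of |x|^k |D^a phi x|. *)
Definition tempered u : Prop :=
  [/\ forall phi psi, schwartz phi -> schwartz psi ->
        u (fun x => phi x + psi x) = u phi + u psi,
      forall c phi, schwartz phi -> u (fun x => c * phi x) = c * u phi &
      exists (N : nat) (C : R), forall phi (M : R), schwartz phi ->
        (forall (k : nat) (a : seq 'I_n) x, (k <= N)%N -> (size a <= N)%N ->
          enorm x ^+ k * Normc.normc (cpartials a phi x) <= M) ->
        Normc.normc (u phi) <= C * M].

(* Functions g defining the tempered distribution phi |-> \int g phi. *)
Definition tempered_fun g : Prop := exists N : nat,
  cintegrable (lebesgue_row n) setT
    (fun x => ((1 + enorm x) ^- N)%:C * g x).

Definition dist_of g : dist := fun phi =>
  cintegral (lebesgue_row n) setT (fun x => g x * phi x).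

Definition fourier_dist u : dist := fun phi => u (fourier phi).
Definition fourier_inv_dist u : dist := fun phi => u (fourier_inv phi).

(* v is the product m * u; m need not be smooth, so this is meaningful only
   when u is a function g such that m * g still defines a distribution. *)
Definition is_mult (m : 'rV[R]_n -> R[i]) u v : Prop := exists g,
  [/\ tempered_fun g, eq_dist u (dist_of g),
      tempered_fun (fun y => m y * g y) &
      eq_dist v (dist_of (fun y => m y * g y))].

(* v = R_i u; the value of the symbol at the origin is irrelevant. *)
Definition is_riesz (i : 'I_n) u v : Prop :=
  [/\ tempered u, tempered v &
      is_mult (fun y => 0 -i* (y ord0 i / enorm y))
        (fourier_dist u) (fourier_dist v)].

(* v = (-Delta)^s u *)
Definition is_fraclap (s : R) u v : Prop := tempered u /\
  exists2 w : dist,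
    is_mult (fun y => (enorm y `^ (2 * s))%:C) (fourier_dist u) w &
    eq_dist v (fourier_inv_dist w).

End schwartz.

Section beam.
Context {R : realType}.

Definition Gamma (z : R) : R :=
  \int[lebesgue_measure]_(t in `]0, +oo[) (t `^ (z - 1) * expR (- t)).

Context {n : nat}.
Variables (s : R) (f : 'I_n -> 'rV[R]_n -> R[i]).
Implicit Types x xi : 'rV[R]_n.

Definition beam x xi : R[i] :=
  cintegral (@lebesgue_measure R) `]0, +oo[
    (fun t => (t `^ (2 * s - 1))%:C *
      \sum_(j < n) f j (x + t *: xi) * (xi ord0 j)%:C).

Definition c10 : R := - Gamma ((n%:R + 1 - 2 * s) / 2) /
  (2 `^ (2 * s) * pi `^ (n%:R / 2) * Gamma (s + 2^-1)).

Definition c11 : R := - Gamma ((n%:R + 2 - 2 * s) / 2) /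
  (2 `^ (2 * s - 1) * pi `^ (n%:R / 2) * Gamma s).

Definition average0 x : R[i] := c10%:C *
  cintegral (@sphere_measure R n) (@unit_sphere R n) (fun xi => beam x xi).

Definition average1 (i : 'I_n) x : R[i] := c11%:C *
  cintegral (@sphere_measure R n) (@unit_sphere R n)
    (fun xi => (xi ord0 i)%:C * beam x xi).

End beam.

(* Main.v *)
(* In polar coordinates A^0 and A^(1,i) are sums of convolutions of the f_j with
   the homogeneous kernels z_j |z|^(2s-n-1) and z_i z_j |z|^(2s-n-2). Such a
   kernel is a Gamma integral over l > 0 of Gaussians times polynomials, whose
   Fourier transforms are explicit and integrate in l to another Gamma integral.
   By Fubini the transforms of A^0 and A^(1,i) are the functions
     sum_j -i y_j |y|^(-2s-1) F f_j  and
     sum_j (2s y_i y_j |y|^(-2s-2) - delta_ij |y|^(-2s)) F f_j,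
   so that -2s R_i A^0 - A^(1,i) has transform |y|^(-2s) F f_i, and the Fourier
   inversion formula, proved by Gaussian regularisation, gives back f_i. *)
From HB Require Import structures.
Require Import Defs.
From mathcomp Require Import all_boot all_order all_algebra.
From mathcomp Require Import all_classical all_reals all_analysis.
From mathcomp Require Import measurable_realfun complex ring lra.

Set Implicit Arguments.
Unset Strict Implicit.
Unset Printing Implicit Defensive.
Import Order.TTheory GRing.Theory Num.Theory.
Import numFieldNormedType.Exports.

Local Open Scope classical_set_scope.
Local Open Scope complex_scope.
Local Open Scope ring_scope.
Local Arguments Normc.normc : simpl never.

(** * Complex-valued functions: modulus and measurability by components *)

Section complex_measurable.
Context {R : realType}.
Local Notation Re := (@complex.Re R).
Local Notation Im := (@complex.Im R).
Local Notation normc := (@Normc.normc R).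

(** The averages need not be integrable, so their transforms are taken by duality: A has transform g
    when A paired with [fourier phi] equals g paired with phi, for all Schwartz phi. Of
    [fourier phi] only measurability and decay to every order are established, not smoothness. Hence
    pairings are studied on a larger class, the measurable functions dominated by a fixed power of
    an integrable weight; it contains the Schwartz functions and their transforms and is visibly
    stable under sums and multiples. The kernels have size |z|^(2s-n) and their transforms
    |y|^(-2s). Both are locally integrable because 0 < 2s < n, which is how n >= 2 and s < 1 enter,
    and every exchange of integrals rests on a bound of the absolute values by such a power times
    the weight. The constants are made for the Gaussian superposition: the numerators of c^{1,0} and
    c^{1,1} are the Gamma values that it attaches to the kernels, while pi^(n/2), the powers of 2
    and the Gamma values in the denominators cancel those that appear on the frequency side. *)

Definition cmeasurable d (T : measurableType d) (g : T -> R[i]) :=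
  measurable_fun setT (Re \o g) /\ measurable_fun setT (Im \o g).

Lemma normc_ReIm (z : R[i]) : normc z = Num.sqrt (Re z ^+ 2 + Im z ^+ 2).
Proof. by case: z. Qed.

Lemma normc_ge0 (z : R[i]) : 0 <= normc z.
Proof. by rewrite normc_ReIm sqrtr_ge0. Qed.

Lemma Re_le_normc (z : R[i]) : `|Re z| <= normc z.
Proof.
by rewrite normc_ReIm -sqrtr_sqr ler_wsqrtr// lerDl sqr_ge0.
Qed.

Lemma Im_le_normc (z : R[i]) : `|Im z| <= normc z.
Proof.
by rewrite normc_ReIm -sqrtr_sqr ler_wsqrtr// lerDr sqr_ge0.
Qed.

Lemma normc_le_ReIm (z : R[i]) : normc z <= `|Re z| + `|Im z|.
Proof.
rewrite normc_ReIm -[leRHS]ger0_norm ?addr_ge0// -sqrtr_sqr ler_wsqrtr//.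
rewrite sqrrD !real_normK ?num_real// -addrA lerD2l.
by rewrite lerDr mulrn_wge0// mulr_ge0.
Qed.

Lemma normc_real (a : R) : normc a%:C = `|a|.
Proof. by rewrite normc_ReIm/= expr0n/= addr0 sqrtr_sqr. Qed.

Lemma normc_cis (t : R) : normc (cis t) = 1.
Proof. by rewrite normc_ReIm/= cos2Dsin2 sqrtr1. Qed.

Lemma cisD (s t : R) : cis (s + t) = cis s * cis t.
Proof. by rewrite /cis cosD sinD; simpc; congr (_ +i* _); rewrite addrC. Qed.

Lemma Re_mul (x y : R[i]) : Re (x * y) = Re x * Re y - Im x * Im y.
Proof. by case: x; case: y. Qed.

Lemma Im_mul (x y : R[i]) : Im (x * y) = Re x * Im y + Im x * Re y.
Proof. by case: x; case: y. Qed.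

Lemma Re_add (x y : R[i]) : Re (x + y) = Re x + Re y.
Proof. by case: x; case: y. Qed.

Lemma Im_add (x y : R[i]) : Im (x + y) = Im x + Im y.
Proof. by case: x; case: y. Qed.

Lemma Re_sum I (r : seq I) (P : pred I) (F : I -> R[i]) :
  Re (\sum_(i <- r | P i) F i) = \sum_(i <- r | P i) Re (F i).
Proof. exact: (big_morph _ Re_add). Qed.

Lemma Im_sum I (r : seq I) (P : pred I) (F : I -> R[i]) :
  Im (\sum_(i <- r | P i) F i) = \sum_(i <- r | P i) Im (F i).
Proof. exact: (big_morph _ Im_add). Qed.

Lemma complex_eq (x y : R[i]) : Re x = Re y -> Im x = Im y -> x = y.
Proof. by case: x y => [a b] [c e] /= -> ->. Qed.

Section closure.
Context d (T : measurableType d).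
Implicit Types g h : T -> R[i].

Lemma cmeasurable_cst (c : R[i]) : cmeasurable (fun _ : T => c).
Proof. by split; exact: measurable_cst. Qed.

Lemma cmeasurable_real (a : T -> R) :
  measurable_fun setT a -> cmeasurable (fun x => (a x)%:C).
Proof. by move=> ma; split=> //; exact: measurable_cst. Qed.

Lemma cmeasurableM g h :
  cmeasurable g -> cmeasurable h -> cmeasurable (fun x => g x * h x).
Proof.
move=> [g1 g2] [h1 h2]; split.
  rewrite (_ : _ \o _ = ((Re \o g) \* (Re \o h)) \- ((Im \o g) \* (Im \o h))).
    by apply: measurable_funB; exact: measurable_funM.
  by apply/funext => x; exact: Re_mul.
rewrite (_ : _ \o _ = ((Re \o g) \* (Im \o h)) \+ ((Im \o g) \* (Re \o h))).
  by apply: measurable_funD; exact: measurable_funM.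
by apply/funext => x; exact: Im_mul.
Qed.

Lemma cmeasurableD g h :
  cmeasurable g -> cmeasurable h -> cmeasurable (fun x => g x + h x).
Proof.
move=> [g1 g2] [h1 h2]; split.
  rewrite (_ : _ \o _ = (Re \o g) \+ (Re \o h)); first exact: measurable_funD.
  by apply/funext => x; exact: Re_add.
rewrite (_ : _ \o _ = (Im \o g) \+ (Im \o h)); first exact: measurable_funD.
by apply/funext => x; exact: Im_add.
Qed.

Lemma cmeasurable_sum I (r : seq I) (F : I -> T -> R[i]) :
  (forall i, cmeasurable (F i)) -> cmeasurable (fun x => \sum_(i <- r) F i x).
Proof.
move=> mF; split.
  rewrite (_ : _ \o _ = fun x => \sum_(i <- r) (Re \o F i) x).
    by apply: measurable_sum => i; exact: (mF i).1.
  by apply/funext => x /=; exact: Re_sum.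
rewrite (_ : _ \o _ = fun x => \sum_(i <- r) (Im \o F i) x).
  by apply: measurable_sum => i; exact: (mF i).2.
by apply/funext => x /=; exact: Im_sum.
Qed.

Lemma cmeasurable_cis (a : T -> R) :
  measurable_fun setT a -> cmeasurable (fun x => cis (a x)).
Proof.
move=> ma; split.
  apply: (measurableT_comp (f := (@cos R))) => //.
  by apply: continuous_measurable_fun; exact: continuous_cos.
apply: (measurableT_comp (f := (@sin R))) => //.
by apply: continuous_measurable_fun; exact: continuous_sin.
Qed.

Lemma measurable_normc g : cmeasurable g -> measurable_fun setT (normc \o g).
Proof.
move=> [g1 g2].
rewrite (_ : _ \o _ = @Num.sqrt R \o ((fun x => (Re \o g) x ^+ 2) \+ (fun x => (Im \o g) x ^+ 2))).
  apply: measurableT_comp.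
    by apply: continuous_measurable_fun; exact: sqrt_continuous.
  by apply: measurable_funD; exact: measurable_funX.
by apply/funext => x /=; rewrite normc_ReIm.
Qed.

End closure.

Lemma cmeasurable_comp d1 d2 (T1 : measurableType d1) (T2 : measurableType d2)
    (g : T2 -> R[i]) (f : T1 -> T2) :
  cmeasurable g -> measurable_fun setT f -> cmeasurable (g \o f).
Proof. by move=> [g1 g2] mf; split;
  [exact: (measurableT_comp g1 mf)|exact: (measurableT_comp g2 mf)]. Qed.

End complex_measurable.

(** * Integrals of complex-valued functions *)

Section complex_integration.
Context {R : realType} d (T : measurableType d).
Variable mu : {measure set T -> \bar R}.
Local Notation Re := (@complex.Re R).
Local Notation Im := (@complex.Im R).
Local Notation normc := (@Normc.normc R).
Implicit Types g h : T -> R[i].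

Local Notation rint a := (mu.-integrable setT (EFin \o a)).

Lemma cintegrable_le g (b : T -> R) : cmeasurable g -> rint b ->
  (forall x, normc (g x) <= b x) -> cintegrable mu setT g.
Proof.
move=> [g1 g2] ib gb; split; apply: (le_integrable measurableT _ _ ib) => /=.
- exact/measurable_EFinP.
- move=> x _ /=; rewrite lee_fin (le_trans (Re_le_normc _))//.
  by rewrite (le_trans (gb x))// ler_norm.
- exact/measurable_EFinP.
- move=> x _ /=; rewrite lee_fin (le_trans (Im_le_normc _))//.
  by rewrite (le_trans (gb x))// ler_norm.
Qed.

Lemma cintegrable_measurable g : cintegrable mu setT g -> cmeasurable g.
Proof.
by move=> [/measurable_int/measurable_EFinP g1 /measurable_int/measurable_EFinP g2].
Qed.

Lemma cintegrable_normc g : cintegrable mu setT g -> rint (normc \o g).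
Proof.
move=> ig; have mg := cintegrable_measurable ig; move: ig => [i1 i2].
have := integrableD measurableT (integrable_norm i1) (integrable_norm i2).
apply: le_integrable => //.
  by apply/measurable_EFinP; exact: measurable_normc.
move=> x _ /=; rewrite lee_fin; apply: le_trans (ler_norm _).
by rewrite ger0_norm ?normc_ge0//; exact: normc_le_ReIm.
Qed.

Lemma eq_cintegral g h : g =1 h -> cintegral mu setT g = cintegral mu setT h.
Proof. by move=> /funext ->. Qed.

Lemma cintegralD g h : cintegrable mu setT g -> cintegrable mu setT h ->
  cintegral mu setT (fun x => g x + h x) =
  cintegral mu setT g + cintegral mu setT h.
Proof.
move=> [g1 g2] [h1 h2]; apply: complex_eq; rewrite ?Re_add ?Im_add/= /cintegral/=.
  rewrite -RintegralD//; apply: eq_Rintegral => x _; exact: Re_add.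
by rewrite -RintegralD//; apply: eq_Rintegral => x _; exact: Im_add.
Qed.

Lemma cintegrableD g h : cintegrable mu setT g -> cintegrable mu setT h ->
  cintegrable mu setT (fun x => g x + h x).
Proof.
move=> ig ih; apply: (@cintegrable_le _ (fun x => normc (g x) + normc (h x))).
- by apply: cmeasurableD; exact: cintegrable_measurable.
- exact: (integrableD measurableT (cintegrable_normc ig) (cintegrable_normc ih)).
- by move=> x; exact: le_normcD.
Qed.

Lemma cintegrableMl (c : R[i]) g : cintegrable mu setT g ->
  cintegrable mu setT (fun x => c * g x).
Proof.
move=> ig; apply: (@cintegrable_le _ (fun x => normc c * normc (g x))).
- by apply: cmeasurableM; [exact: cmeasurable_cst|exact: cintegrable_measurable].
- exact: (integrableZl measurableT _ (cintegrable_normc ig)).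
- by move=> x; rewrite Normc.normcM.
Qed.

Lemma cintegralMl (c : R[i]) g : cintegrable mu setT g ->
  cintegral mu setT (fun x => c * g x) = c * cintegral mu setT g.
Proof.
move=> [g1 g2]; apply: complex_eq.
  rewrite Re_mul /cintegral/= -!RintegralZl//.
  rewrite -RintegralB//.
  - by apply: eq_Rintegral => x _; rewrite Re_mul.
  - exact: (integrableZl measurableT _ g1).
  - exact: (integrableZl measurableT _ g2).
rewrite Im_mul /cintegral/= -!RintegralZl// -RintegralD//.
- by apply: eq_Rintegral => x _; rewrite Im_mul.
- exact: (integrableZl measurableT _ g2).
- exact: (integrableZl measurableT _ g1).
Qed.

Lemma cintegrable_cst0 : cintegrable mu setT (fun _ => 0).
Proof. by split; exact: integrable0. Qed.

Lemma cintegral_cst0 : cintegral mu setT (fun _ => 0) = 0.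
Proof. by rewrite /cintegral /Rintegral integral0. Qed.

Lemma cintegrable_sum I (r : seq I) (F : I -> T -> R[i]) :
  (forall i, cintegrable mu setT (F i)) ->
  cintegrable mu setT (fun x => \sum_(i <- r) F i x).
Proof.
move=> iF; elim: r => [|i r IH].
  by rewrite (_ : (fun _ => _) = fun _ => 0);
    [exact: cintegrable_cst0|apply/funext => x; rewrite big_nil].
rewrite (_ : (fun _ => _) = fun x => F i x + \sum_(j <- r) F j x).
  exact: cintegrableD.
by apply/funext => x; rewrite big_cons.
Qed.

Lemma cintegral_sum I (r : seq I) (F : I -> T -> R[i]) :
  (forall i, cintegrable mu setT (F i)) ->
  cintegral mu setT (fun x => \sum_(i <- r) F i x) =
  \sum_(i <- r) cintegral mu setT (F i).
Proof.
move=> iF; elim: r => [|i r IH].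
  by rewrite big_nil -[RHS]cintegral_cst0; apply: eq_cintegral => x; rewrite big_nil.
rewrite big_cons -IH -cintegralD//; last exact: cintegrable_sum.
by apply: eq_cintegral => x; rewrite big_cons.
Qed.

(* The factor 2 comes from estimating the two components separately. *)
Lemma normc_cintegral_le g (b : T -> R) : cmeasurable g -> rint b ->
  (forall x, normc (g x) <= b x) ->
  normc (cintegral mu setT g) <= 2 * \int[mu]_(x in setT) b x.
Proof.
move=> mg ib gb; have [i1 i2] := cintegrable_le mg ib gb.
rewrite (le_trans (normc_le_ReIm _))// mulr2n mulrDl !mul1r lerD//=.
  apply: le_trans (le_normr_Rintegral measurableT i1) _.
  apply: le_Rintegral => //; first exact: integrable_norm.
  by move=> x _; apply: le_trans (gb x); exact: Re_le_normc.
apply: le_trans (le_normr_Rintegral measurableT i2) _.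
apply: le_Rintegral => //; first exact: integrable_norm.
by move=> x _; apply: le_trans (gb x); exact: Im_le_normc.
Qed.

Lemma ae_eq_cintegral g h : cmeasurable g -> cmeasurable h ->
  (exists N, [/\ measurable N, mu N = 0%E & forall x, ~ N x -> g x = h x]) ->
  cintegral mu setT g = cintegral mu setT h.
Proof.
move=> [g1 g2] [h1 h2] [N [mN N0 gh]].
have E (a b : T -> R) : measurable_fun setT a -> measurable_fun setT b ->
    (forall x, ~ N x -> a x = b x) ->
    \int[mu]_(x in setT) a x = \int[mu]_(x in setT) b x.
  move=> ma mb ab; rewrite /Rintegral; congr fine.
  apply: ae_eq_integral => //; try exact/measurable_EFinP.
  exists N; split => // x /=; apply: contra_notP => Nx _ /=.
  by rewrite ab.
by congr (_ +i* _); apply: E => // x Nx /=; rewrite gh.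
Qed.

(** Limits of complex values are stated on both components, here and later, so that only the real
    dominated convergence theorem and the topology of [R] come in. *)
Lemma cintegral_dominated_cvg (g_ : nat -> T -> R[i]) g (b : T -> R) :
  (forall k, cmeasurable (g_ k)) -> cmeasurable g -> rint b ->
  (forall x, (fun k => Re (g_ k x)) @ \oo --> Re (g x)) ->
  (forall x, (fun k => Im (g_ k x)) @ \oo --> Im (g x)) ->
  (forall k x, normc (g_ k x) <= b x) ->
  (fun k => Re (cintegral mu setT (g_ k))) @ \oo --> Re (cintegral mu setT g) /\
  (fun k => Im (cintegral mu setT (g_ k))) @ \oo --> Im (cintegral mu setT g).
Proof.
move=> mg_ mg ib cR cI gb.
have E (a_ : nat -> T -> R) (a : T -> R) :
    (forall k, measurable_fun setT (a_ k)) -> measurable_fun setT a ->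
    (forall x, (fun k => a_ k x) @ \oo --> a x) ->
    (forall k x, `|a_ k x| <= b x) ->
    (fun k => \int[mu]_(x in setT) a_ k x) @ \oo --> \int[mu]_(x in setT) a x.
  move=> ma_ ma ca ab.
  have [] := @dominated_convergence _ T R mu setT measurableT
    (fun k => EFin \o a_ k) (EFin \o a) (EFin \o b).
  - by move=> k; exact/measurable_EFinP.
  - exact/measurable_EFinP.
  - by apply: aeW => x _ /=; apply: cvg_EFin; [exact: nearW|exact: ca].
  - exact: ib.
  - by apply: aeW => x k _ /=; rewrite lee_fin.
  move=> ia _; rewrite -[X in _ --> X](@fineK R); last exact: integrable_fin_num.
  by move=> /fine_cvg.
split; apply: E => //.
- by move=> k; exact: (mg_ k).1.
- exact: mg.1.
- by move=> k x; apply: le_trans (gb k x); exact: Re_le_normc.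
- by move=> k; exact: (mg_ k).2.
- exact: mg.2.
- by move=> k x; apply: le_trans (gb k x); exact: Im_le_normc.
Qed.

End complex_integration.

(** * Tonelli and Fubini for complex-valued functions *)

Section complex_fubini.
Context {R : realType} d1 d2 (T1 : measurableType d1) (T2 : measurableType d2).
Variables (m1 : {sigma_finite_measure set T1 -> \bar R})
  (m2 : {sigma_finite_measure set T2 -> \bar R}).
Local Notation Re := (@complex.Re R).
Local Notation Im := (@complex.Im R).
Local Notation normc := (@Normc.normc R).
Implicit Types g : T1 * T2 -> R[i].

(** Tonelli makes the integrals of the two parts measurable in all cases, and [fine] is measurable
    at infinite values too. Transforms of measurable functions are thus measurable. *)
Let measurable_Rintegral2 (a : T1 * T2 -> R) : measurable_fun setT a ->
  measurable_fun setT (fun x => \int[m2]_(y in setT) a (x, y)).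
Proof.
move=> ma; apply: (measurableT_comp (f := fine)); first exact: fine_measurable.
have mea : measurable_fun setT (EFin \o a) by exact/measurable_EFinP.
rewrite (_ : (fun x => _) = (fun x => \int[m2]_y (EFin \o a)^\+ (x, y)) \-
    (fun x => \int[m2]_y (EFin \o a)^\- (x, y)))%E; last first.
  by apply/funext => x; rewrite [LHS]integralE; congr (_ - _)%E; apply: eq_integral => y _; rewrite ?funeposE ?funenegE.
apply: emeasurable_funB.
  by apply: measurable_fun_fubini_tonelli_F => //; exact: measurable_funepos.
by apply: measurable_fun_fubini_tonelli_F => //; exact: measurable_funeneg.
Qed.

Lemma cmeasurable_cintegral2 g : cmeasurable g ->
  cmeasurable (fun x => cintegral m2 setT (fun y => g (x, y))).
Proof. by move=> [g1 g2]; split;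
  [exact: (measurable_Rintegral2 (a := Re \o g))|exact: (measurable_Rintegral2 (a := Im \o g))]. Qed.

Let Rfubini_F (a : T1 * T2 -> R) : (m1 \x m2)%E.-integrable setT (EFin \o a) ->
  m1.-integrable setT (EFin \o (fun x => \int[m2]_(y in setT) a (x, y))) /\
  \int[m1]_(x in setT) \int[m2]_(y in setT) a (x, y) =
  \int[(m1 \x m2)%E]_(z in setT) a z.
Proof.
move=> ia; have iF := integrable_fubini_F ia.
have ma : measurable_fun setT a by apply/measurable_EFinP; exact: measurable_int ia.
have mF := measurable_Rintegral2 ma.
split.
  apply: (le_integrable measurableT _ _ iF); first exact/measurable_EFinP.
  move=> x _ /=; rewrite /Rintegral/= /fubini_F/=.
  by case: (\int[m2]_y (a (x, y))%:E)%E => //=; rewrite normr0 leey.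
rewrite /Rintegral -(integral12_prod_meas1 ia); congr fine.
apply: ae_eq_integral => //; [exact/measurable_EFinP|exact: measurable_int iF|].
(* The real-valued inner integral is [fine] of the extended one; they agree off the null set where
   the latter is infinite. *)
have [N [mN N0 hN]] := integrable_ae measurableT iF.
exists N; split => // x /= nx; apply: hN => /= h; apply: nx => _.
by rewrite fineK// h.
Qed.

Let Rfubini_G (a : T1 * T2 -> R) : (m1 \x m2)%E.-integrable setT (EFin \o a) ->
  \int[m2]_(y in setT) \int[m1]_(x in setT) a (x, y) =
  \int[(m1 \x m2)%E]_(z in setT) a z.
Proof.
move=> ia; have mea := measurable_int _ ia.
(* Tonelli bounds the integral over the second variable of each part, so both parts, and then their
   difference, are integrable there. *)
have iG : m2.-integrable setT (fubini_G m1 (EFin \o a)).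
  rewrite (_ : fubini_G _ _ = (fun y => \int[m1]_x (EFin \o a)^\+ (x, y)) \-
    (fun y => \int[m1]_x (EFin \o a)^\- (x, y)))%E; last first.
    by apply/funext => x; rewrite /fubini_G [LHS]integralE; congr (_ - _)%E; apply: eq_integral => y _; rewrite ?funeposE ?funenegE.
  apply: integrableB => //; apply/integrableP; split.
  - by apply: measurable_fun_fubini_tonelli_G => //; exact: measurable_funepos.
  - under eq_integral do rewrite gee0_abs ?integral_ge0//.
    rewrite -fubini_tonelli2//; last exact: measurable_funepos.
    exact: integral_funepos_lt_pinfty ia.
  - by apply: measurable_fun_fubini_tonelli_G => //; exact: measurable_funeneg.
  - under eq_integral do rewrite gee0_abs ?integral_ge0//.
    rewrite -fubini_tonelli2//; last exact: measurable_funeneg.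
    exact: integral_funeneg_lt_pinfty ia.
rewrite /Rintegral -(integral21_prod_meas1 ia); congr fine.
have mG : measurable_fun setT
    (EFin \o (fun y => \int[m1]_(x in setT) a (x, y))).
  apply/measurable_EFinP; apply: (measurableT_comp (f := fine)).
    exact: fine_measurable.
  exact: measurable_int iG.
apply: ae_eq_integral => //; first exact: measurable_int iG.
have [N [mN N0 hN]] := integrable_ae measurableT iG.
exists N; split => // x /= nx; apply: hN => /= h; apply: nx => _.
by rewrite fineK// h.
Qed.

Lemma cintegrable_cintegral2 g : cintegrable (m1 \x m2)%E setT g ->
  cintegrable m1 setT (fun x => cintegral m2 setT (fun y => g (x, y))).
Proof. by move=> [g1 g2]; split; [apply: (Rfubini_F (a := Re \o g) g1).1|apply: (Rfubini_F (a := Im \o g) g2).1]. Qed.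

Lemma cintegral_fubini g : cintegrable (m1 \x m2)%E setT g ->
  cintegral m1 setT (fun x => cintegral m2 setT (fun y => g (x, y))) =
  cintegral m2 setT (fun y => cintegral m1 setT (fun x => g (x, y))).
Proof.
move=> [g1 g2]; apply: complex_eq; rewrite /cintegral /=.
  by rewrite (Rfubini_F (a := Re \o g) g1).2 (Rfubini_G (a := Re \o g) g1).
by rewrite (Rfubini_F (a := Im \o g) g2).2 (Rfubini_G (a := Im \o g) g2).
Qed.

(** Tonelli's criterion with an exceptional null set, meant for the origin, where singular kernels
    have no slice bound. *)
Lemma cintegrable_prod_iter g (b : T1 -> R) : cmeasurable g ->
  m1.-integrable setT (EFin \o b) ->
  (exists N, [/\ measurable N, m1 N = 0%E & forall x, ~ N x ->
    (\int[m2]_y (normc (g (x, y)))%:E <= (b x)%:E)%E]) ->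
  cintegrable (m1 \x m2)%E setT g.
Proof.
move=> mg ib [N [mN N0 Nb]].
have mng : measurable_fun setT (fun z => (normc (g z))%:E).
  by apply/measurable_EFinP; exact: measurable_normc.
apply: (@cintegrable_le _ _ _ _ _ (normc \o g)) => //.
apply/(integrable12ltyP m1 m2) => //.
apply: (@le_lt_trans _ _ (\int[m1]_x `|(b x)%:E|)%E); last first.
  by have /integrableP[] := ib.
apply: ae_ge0_le_integral => //.
- by move=> x _; exact: integral_ge0.
- apply: (measurable_fun_fubini_tonelli_F (fun z => `|(normc (g z))%:E|)%E) => //.
  exact: measurableT_comp.
- by apply: measurableT_comp => //; exact: measurable_int ib.
exists N; split => // x /= nx; apply: contrapT => Nx; apply: nx => _.
rewrite [leLHS](_ : _ = \int[m2]_y (normc (g (x, y)))%:E)%E; last first.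
  by apply: eq_integral => y _ /=; rewrite ger0_norm ?normc_ge0.
by apply: le_trans (Nb _ Nx) _; rewrite lee_fin ler_norm.
Qed.

Lemma cintegrable_prod g (a : T1 -> R) (b : T2 -> R) : cmeasurable g ->
  m1.-integrable setT (EFin \o a) -> m2.-integrable setT (EFin \o b) ->
  (forall x y, normc (g (x, y)) <= a x * b y) ->
  cintegrable (m1 \x m2)%E setT g.
Proof.
move=> mg ia ib gab.
have mb : measurable_fun setT b by apply/measurable_EFinP; exact: measurable_int ib.
apply: (@cintegrable_prod_iter _ (fun x => (\int[m2]_(y in setT) `|b y|) * `|a x|)) => //.
  exact: (integrableZl measurableT _ (integrable_norm ia)).
exists set0; split => // x _.
have inb := integrable_norm ib.
apply: (@le_trans _ _ (\int[m2]_y (`|a x| * `|b y|)%:E)%E).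
  apply: ge0_le_integral => //.
  - by move=> y _; rewrite lee_fin normc_ge0.
  - apply/measurable_EFinP; apply: (measurableT_comp (measurable_normc mg)).
    exact: pair1_measurable.
  - apply/measurable_EFinP; apply: measurable_funM => //.
    exact: measurableT_comp.
  - move=> y _; rewrite lee_fin -normrM; apply: le_trans (gab x y) _.
    exact: ler_norm.
under eq_integral do rewrite EFinM.
rewrite integralZl// mulrC EFinM /Rintegral fineK//.
exact: integrable_fin_num.
Qed.

End complex_fubini.

(** * From nonnegative to complex changes of variables *)

Section complex_pushforward.
Context {R : realType} d1 d2 (T1 : measurableType d1) (T2 : measurableType d2).
Variables (m1 : {measure set T1 -> \bar R}) (m2 : {measure set T2 -> \bar R}).
Variables (p : T1 -> T2) (k : R).
Local Notation Re := (@complex.Re R).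
Local Notation Im := (@complex.Im R).
Hypotheses (mp : measurable_fun setT p) (k0 : 0 <= k).
Hypothesis change : forall F : T2 -> \bar R, measurable_fun setT F ->
  (forall x, 0 <= F x)%E -> (\int[m1]_x F (p x) = k%:E * \int[m2]_x F x)%E.

(** The formula for nonnegative functions yields integrability when applied to the absolute value,
    then equality when applied to the positive and negative parts, whose integrals are finite. *)
Let Rchange (a : T2 -> R) : m2.-integrable setT (EFin \o a) ->
  m1.-integrable setT (EFin \o (a \o p)) /\
  \int[m1]_(x in setT) a (p x) = k * \int[m2]_(x in setT) a x.
Proof.
move=> ia; have mea := measurable_int _ ia.
have iap : m1.-integrable setT (EFin \o (a \o p)).
  apply/integrableP; split; first exact: (measurableT_comp mea mp).
  rewrite (change (F := fun x => `|(a x)%:E|%E))//; last exact: measurableT_comp.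
  by rewrite lte_mul_pinfty//; have /integrableP[] := ia.
split => //; apply: EFin_inj; rewrite EFinM /Rintegral !fineK//;
  [|exact: integrable_fin_num..].
rewrite integralE [in RHS]integralE.
rewrite muleBr//; last first.
  by apply: fin_num_adde_defr; exact: integrable_pos_fin_num.
rewrite -!change//; [|exact: measurable_funeneg|exact: measurable_funepos].
by congr (_ - _)%E; apply: eq_integral => x _; rewrite ?funeposE ?funenegE.
Qed.

Lemma cintegrable_change (g : T2 -> R[i]) : cintegrable m2 setT g ->
  cintegrable m1 setT (g \o p).
Proof.
by move=> [g1 g2]; split; [exact: (Rchange (a := Re \o g) g1).1|exact: (Rchange (a := Im \o g) g2).1].
Qed.

Lemma cintegral_change (g : T2 -> R[i]) : cintegrable m2 setT g ->
  cintegral m1 setT (fun x => g (p x)) = k%:C * cintegral m2 setT g.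
Proof.
move=> [g1 g2]; apply: complex_eq; rewrite ?Re_mul ?Im_mul/= mul0r ?subr0 ?addr0 /cintegral/=.
  by rewrite (Rchange (a := Re \o g) g1).2.
by rewrite (Rchange (a := Im \o g) g2).2.
Qed.

End complex_pushforward.

(** * Euclidean and sup norms, measurability on row vectors *)

Section euclidean.
Context {R : realType} {n : nat}.
Implicit Types x y : 'rV[R]_n.

Lemma dotp_ge0 x : 0 <= dotp x x.
Proof. by apply: sumr_ge0 => i _; rewrite -expr2 sqr_ge0. Qed.

Lemma enorm_ge0 x : 0 <= enorm x.
Proof. exact: sqrtr_ge0. Qed.

Lemma sqr_enorm x : enorm x ^+ 2 = dotp x x.
Proof. by rewrite sqr_sqrtr// dotp_ge0. Qed.

Lemma dotpZl (r : R) x y : dotp (r *: x) y = r * dotp x y.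
Proof.
by rewrite /dotp mulr_sumr; apply: eq_bigr => i _; rewrite mxE mulrA.
Qed.

Lemma dotpC x y : dotp x y = dotp y x.
Proof. by apply: eq_bigr => i _; rewrite mulrC. Qed.

Lemma dotpDl x y z : dotp (x + y) z = dotp x z + dotp y z.
Proof.
by rewrite /dotp -big_split; apply: eq_bigr => i _; rewrite mxE mulrDl.
Qed.

Lemma dotp_delta (i : 'I_n) x : dotp (delta_mx ord0 i) x = x ord0 i.
Proof.
rewrite /dotp (bigD1 i)//= mxE !eqxx mul1r big1 ?addr0// => j ji.
by rewrite mxE (negPf ji) andbF mul0r.
Qed.

Lemma enormZ (r : R) x : enorm (r *: x) = `|r| * enorm x.
Proof.
rewrite /enorm dotpZl dotpC dotpZl mulrA -expr2 sqrtrM ?sqr_ge0//.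
by rewrite sqrtr_sqr.
Qed.

Lemma coor_le_enorm x (i : 'I_n) : `|x ord0 i| <= enorm x.
Proof.
rewrite /enorm -sqrtr_sqr ler_wsqrtr// /dotp (bigD1 i)//= expr2 lerDl.
by apply: sumr_ge0 => j _; rewrite -expr2 sqr_ge0.
Qed.

Lemma coor_le_norm x (i : 'I_n) : `|x ord0 i| <= `|x|.
Proof.
have := @mx_normrE R 1 n x; rewrite /Num.norm/= => ->.
exact: (le_bigmax _ (fun ij : 'I_1 * 'I_n => `|x ij.1 ij.2|) (ord0, i)).
Qed.

Lemma norm_leP x (e : R) : 0 <= e -> (forall i, `|x ord0 i| <= e) -> `|x| <= e.
Proof.
move=> e0 xe; have := @mx_normrE R 1 n x; rewrite {2}/Num.norm/= => ->.
by apply: bigmax_le => // -[i j] _ /=; rewrite (ord1 i).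
Qed.

Lemma norm_le_enorm x : `|x| <= enorm x.
Proof. by apply: norm_leP => [|i]; [exact: enorm_ge0|exact: coor_le_enorm]. Qed.

Lemma enorm_eq0 x : (enorm x == 0) = (x == 0).
Proof.
apply/eqP/eqP => [x0|->]; last first.
  by rewrite /enorm /dotp big1 ?sqrtr0// => i _; rewrite mxE mul0r.
apply/rowP => i; rewrite mxE; apply/eqP; rewrite -normr_le0 -x0.
exact: coor_le_enorm.
Qed.

Lemma enorm_gt0 x : (0 < enorm x) = (x != 0).
Proof. by rewrite lt_neqAle eq_sym enorm_ge0 andbT enorm_eq0. Qed.

Lemma measurable_dotp2 d (T : measurableType d) (f g : T -> 'rV[R]_n) :
  measurable_fun setT f -> measurable_fun setT g ->
  measurable_fun setT (fun t => dotp (f t) (g t)).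
Proof.
move=> mf mg; apply: measurable_sum => i; apply: measurable_funM.
  exact: (measurableT_comp (@measurable_row_coor R n i) mf).
exact: (measurableT_comp (@measurable_row_coor R n i) mg).
Qed.

Lemma measurable_row_add d (T : measurableType d) (f g : T -> 'rV[R]_n) :
  measurable_fun setT f -> measurable_fun setT g ->
  measurable_fun setT (fun t => f t + g t).
Proof.
move=> mf mg; apply: measurable_fun_rowP => i.
rewrite (_ : _ \o _ = fun t => row_coor i (f t) + row_coor i (g t)).
  apply: measurable_funD.
    exact: (measurableT_comp (@measurable_row_coor R n i) mf).
  exact: (measurableT_comp (@measurable_row_coor R n i) mg).
by apply/funext => t; rewrite /row_coor /= mxE.
Qed.

Lemma measurable_row_scale d (T : measurableType d) (a : T -> R)
    (f : T -> 'rV[R]_n) :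
  measurable_fun setT a -> measurable_fun setT f ->
  measurable_fun setT (fun t => a t *: f t).
Proof.
move=> ma mf; apply: measurable_fun_rowP => i.
rewrite (_ : _ \o _ = fun t => a t * row_coor i (f t)).
  apply: measurable_funM => //.
  exact: (measurableT_comp (@measurable_row_coor R n i) mf).
by apply/funext => t; rewrite /row_coor /= mxE.
Qed.

Lemma measurable_row_zero : measurable [set (0 : 'rV[R]_n)].
Proof.
rewrite (_ : [set 0] = @enorm R n @^-1` [set 0]).
  by rewrite -[X in measurable X]setTI; exact: measurable_enorm.
apply/seteqP; split => x /=; first by move=> ->; apply/eqP; rewrite enorm_eq0.
by move=> /eqP; rewrite enorm_eq0 => /eqP.
Qed.

(* Rounding down to the lattice of mesh 1/m factors through a countable set,
   so it makes every function measurable; then let m tend to infinity. *)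
Lemma continuous_measurable_row (a : 'rV[R]_n -> R) :
  continuous a -> measurable_fun setT a.
Proof.
move=> ca.
pose v2r m (v : 'rV[int]_n) : 'rV[R]_n := \row_i ((v ord0 i)%:~R / m.+1%:R).
pose q m (x : 'rV[R]_n) : 'rV[int]_n := \row_i Num.floor (m.+1%:R * x ord0 i).
apply: (measurable_fun_cvg (h := fun m => a \o v2r m \o q m)).
  move=> m _ Y mY; rewrite setTI.
  rewrite (_ : _ @^-1` _ =
      \bigcup_v ([set x | Y (a (v2r m v))] `&` (q m @^-1` [set v]))); last first.
    by apply/seteqP; split => x /=; [move=> Yx; exists (q m x)|move=> [v _ [/[swap] <-]]].
  apply: countable_bigcupT_measurable; first exact: countableP.
  move=> v; have [Yv|nYv] := pselect (Y (a (v2r m v))); last first.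
    by rewrite (_ : [set _ | _] = set0) ?set0I//; apply/seteqP; split.
  rewrite (_ : [set _ | _] = setT) ?setTI; last by apply/seteqP; split.
  rewrite (_ : _ @^-1` _ = \bigcap_(i in [set: 'I_n])
     (row_coor i @^-1` `[(v ord0 i)%:~R / m.+1%:R, (v ord0 i + 1)%:~R / m.+1%:R[)).
    apply: fin_bigcap_measurable => // i _.
    by rewrite -[X in measurable X]setTI; exact: measurable_row_coor.
  apply/seteqP; split => x /=.
    move=> <- i _ /=; rewrite in_itv/= /row_coor mxE.
    rewrite ler_pdivrMr ?ltr0n// ltr_pdivlMr ?ltr0n// mulrC.
    exact: floor_itv.
  move=> vx; apply/rowP => i; rewrite mxE.
  have := vx i I; rewrite /= in_itv/= /row_coor.
  rewrite ler_pdivrMr ?ltr0n// ltr_pdivlMr ?ltr0n// mulrC.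
  exact: floor_def.
move=> x _; apply: (@continuous_cvg _ _ _ _ _ _ a); first exact: ca.
apply/cvgrPdist_le => e e0; near=> m.
apply: norm_leP; first exact: ltW.
move=> i; rewrite !mxE.
have /andP[f1 f2] := floor_itv (m.+1%:R * x ord0 i).
have m0 : (0 : R) < m.+1%:R by [].
rewrite -(ler_pM2l m0) -[X in X * _ <= _]ger0_norm// -normrM mulrBr.
rewrite [X in _ - X]mulrC divfK ?gt_eqF// ger0_norm ?subr_ge0//.
rewrite (@le_trans _ _ 1)//; first by move: f2; rewrite intrD/=; lra.
rewrite -ler_pdivrMr// div1r; near: m.
have := near_infty_natSinv_lt (PosNum e0).
apply: filterS => m /= me; rewrite -[leRHS]invrK lef_pV2 ?posrE ?invr_gt0//.
exact: ltW.
Unshelve. all: by end_near. Qed.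

End euclidean.

(** * Affine changes of variables for Lebesgue measure *)

Section change_of_variables.
Context {R : realType}.

(** Lebesgue measure is determined by its values on the intervals []u, v]], and [|r|] times its
    image under the affine map takes the same values there. *)
Lemma ge0_integral_affine1 (r a : R) (F : R -> \bar R) : r != 0 ->
  measurable_fun setT F -> (forall x, 0 <= F x)%E ->
  (\int[@lebesgue_measure R]_x F (r * x + a)%R =
   (`|r|^-1)%:E * \int[@lebesgue_measure R]_x F x)%E.
Proof.
move=> r0 mF F0.
pose p : measurableTypeR R -> measurableTypeR R := fun x => r * x + a.
have mp : measurable_fun setT p.
  by apply: measurable_funD => //; exact: measurable_funM.
have rV : 0 <= `|r| by [].
have [mu' mu'E] : exists mu' : {measure set (measurableTypeR R) -> \bar R},
    mu' = mscale (NngNum rV) (pushforward (@lebesgue_measure R) p) :> (set _ -> _).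
  by unshelve eexists (mscale (NngNum rV) (pushforward (@lebesgue_measure R) p)).
have r_gt0 : 0 < `|r| by rewrite normr_gt0.
have muE A : measurable A -> lebesgue_measure A = mu' A.
  apply: lebesgue_measure_unique => _ [[u v] _ <-] /=.
  rewrite mu'E /mscale/= /pushforward lebesgue_measure_itv/=.
  have [rp|rn] := ltP 0 r.
    rewrite (_ : p @^-1` _ = `](u - a) / r, (v - a) / r]%classic); last first.
      apply/seteqP; split => x /=; rewrite !in_itv/= /p;
      by rewrite ltr_pdivrMr// ler_pdivlMr// ltrBlDr lerBrDr mulrC.
    rewrite lebesgue_measure_itv/= !lte_fin ltr_pM2r ?invr_gt0// ltrD2r.
    case: ifP => _; last by rewrite mule0.
    rewrite -!EFinD -EFinM gtr0_norm//; congr EFin; field.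
    by rewrite gt_eqF.
  have {}rn : r < 0 by rewrite lt_neqAle r0.
  (* A decreasing map pulls []u, v]] back to an interval closed on the left; only its length
     counts. *)
  rewrite (_ : p @^-1` _ = `[(v - a) / r, (u - a) / r[%classic); last first.
    apply/seteqP; split => x /=; rewrite !in_itv/= /p;
    by rewrite ler_ndivrMr// ltr_ndivlMr// ltrBlDr lerBrDr mulrC andbC.
  rewrite lebesgue_measure_itv/= !lte_fin ltr_nM2r ?invr_lt0// ltrD2r.
  case: ifP => _; last by rewrite mule0.
  rewrite -!EFinD -EFinM ltr0_norm//; congr EFin; field.
  by rewrite lt_eqF.
rewrite [in RHS](eq_measure_integral mu'); last by move=> A mA _; exact: muE.
rewrite (_ : \int[mu']_x F x =
    \int[mscale (NngNum rV) (pushforward (@lebesgue_measure R) p)]_x F x)%E; last first.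
  by apply: eq_measure_integral => A mA _; rewrite mu'E.
rewrite ge0_integral_mscale//= ge0_integral_pushforward//.
by rewrite muleA -EFinM mulVf ?gt_eqF// mul1e.
Qed.

Lemma ge0_integral_row_cons n (F : 'rV[R]_n.+1 -> \bar R) :
  measurable_fun setT F -> (forall x, 0 <= F x)%E ->
  (\int[lebesgue_row n.+1]_x F x =
   \int[@lebesgue_measure R]_a \int[lebesgue_row n]_y F (row_cons (a, y)))%E.
Proof.
move=> mF F0 /=; rewrite ge0_integral_pushforward//.
rewrite fubini_tonelli1//=.
exact: (measurableT_comp mF (@measurable_row_cons R n)).
Qed.

Lemma measurable_row_affine n (r : R) (a : 'rV[R]_n) :
  measurable_fun setT (fun x : 'rV[R]_n => r *: x + a).
Proof. by apply: measurable_row_add => //; exact: measurable_row_scale. Qed.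

Lemma ge0_integral_affine n (r : R) (a : 'rV[R]_n) (F : 'rV[R]_n -> \bar R) :
  r != 0 -> measurable_fun setT F -> (forall x, 0 <= F x)%E ->
  (\int[lebesgue_row n]_x F (r *: x + a)%R =
   ((`|r| ^- n)%R)%:E * \int[lebesgue_row n]_x F x)%E.
Proof.
elim: n a F => [|n IH] a F r0 mF F0.
  rewrite expr0 invr1 mul1e; apply: eq_integral => x _.
  by congr F; rewrite [RHS]thinmx0 [LHS]thinmx0.
have mFa := measurableT_comp mF (measurable_row_affine r a).
have mFc := measurableT_comp mF (@measurable_row_cons R n).
rewrite !ge0_integral_row_cons//.
set G := fun t => (\int[lebesgue_row n]_y F (row_cons (t, y)))%E.
have mG : measurable_fun setT G.
  apply: (measurable_fun_fubini_tonelli_F (F \o @row_cons R n)) => //.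
  by move=> x; exact: F0.
have -> : ((`|r| ^- n.+1)%R)%:E = ((`|r|^-1)%:E * (`|r| ^- n)%:E)%E.
  by rewrite -EFinM -exprVn exprS exprVn.
transitivity (\int[@lebesgue_measure R]_t
    ((`|r| ^- n)%:E * G (r * t + a ord0 ord0)%R))%E.
  apply: eq_integral => t _.
  rewrite /G -(IH (\row_i a ord0 (lift ord0 i)))//.
    apply: eq_integral => y _; congr F; apply/rowP => i.
    rewrite [LHS]mxE [X in X + _ = _]mxE -!/(row_coor _ _).
    case: (unliftP ord0 i) => [j ->|->].
      by rewrite !row_consS/= /row_coor !mxE.
    by rewrite !row_cons0.
  apply: (measurableT_comp mFc).
  exact: pair1_measurable.
have mGa : measurable_fun setT (fun t : measurableTypeR R => G (r * t + a ord0 ord0)).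
  by apply: (measurableT_comp mG); apply: measurable_funD => //; exact: measurable_funM.
have G0 t : (0 <= G t)%E by apply: integral_ge0.
have rn0 : 0 <= `|r| ^- n by rewrite invr_ge0 exprn_ge0.
rewrite (ge0_integralZl_EFin _ measurableT (fun t _ => G0 _) mGa rn0).
by rewrite ge0_integral_affine1// muleCA muleA.
Qed.

(** The origin lies in a slab [{0} x R^n], which is null even when its second factor has infinite
    measure, since [0 * +oo = 0]. *)
Lemma lebesgue_row_zero n : lebesgue_row n.+1 [set (0 : 'rV[R]_n.+1)] = 0%E.
Proof.
apply/eqP; rewrite eq_le measure_ge0 andbT /=.
apply: (@le_trans _ _ ((@lebesgue_measure R \x lebesgue_row n)%E ([set 0] `*` setT))).
  rewrite /lebesgue_row_step /pushforward.
  apply: le_measure; rewrite ?inE.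
  - rewrite -[X in measurable X]setTI; apply: measurable_row_cons => //.
    exact: measurable_row_zero.
  - by apply: measurableX.
  move=> [t y] /= ty0; split => //=.
  by have := row_cons0 (t, y); rewrite ty0 /row_coor mxE.
by rewrite product_measure1E//= lebesgue_measure_set1 mul0e.
Qed.

(** Formulas with negative powers of [enorm] break at the origin, where such a power is 0 by
    convention; in positive dimension this is a null set. *)
Lemma eq_cintegral_neq0 n (g h : 'rV[R]_n -> R[i]) : (0 < n)%N ->
  cmeasurable g -> cmeasurable h -> (forall x, x != 0 -> g x = h x) ->
  cintegral (lebesgue_row n) setT g = cintegral (lebesgue_row n) setT h.
Proof.
case: n g h => // n g h _ mg mh gh; apply: ae_eq_cintegral => //.
exists [set 0]; split; [exact: measurable_row_zero|exact: lebesgue_row_zero|].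
by move=> x /eqP; exact: gh.
Qed.

End change_of_variables.

(** * Elementary integrals over half-lines *)

Section one_dimensional_integrals.
Context {R : realType}.
Local Notation mu := (@lebesgue_measure R).
Implicit Types a b c r t x : R.

Lemma measurable_gt (c : R) :
  measurable_fun [set: measurableTypeR R] (fun t : R => (c < t)%R%:R : R).
Proof.
rewrite (_ : (fun _ => _) = \1_(`]c, +oo[%classic)).
  exact: measurable_indic.
by apply/funext => t; rewrite indicE mem_setE in_itv/= andbT.
Qed.

(** Half-lines are encoded by an indicator factor, so that Tonelli and affine substitutions apply on
    the whole line. *)
Lemma integral_gt_indic (c : R) (f : R -> R) :
  (\int[mu]_(t in `]c, +oo[) (f t)%:E = \int[mu]_t ((c < t)%R%:R * f t)%:E)%E.
Proof.
rewrite integral_mkcond; apply: eq_integral => t _.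
rewrite patchE mem_setE in_itv/= andbT.
by case: ltP; rewrite ?mul1r ?mul0r.
Qed.

Lemma Rintegral_gt_indic (c : R) (f : R -> R) :
  \int[mu]_(t in `]c, +oo[) f t = \int[mu]_(t in setT) ((c < t)%R%:R * f t).
Proof. by rewrite /Rintegral integral_gt_indic. Qed.

Lemma integral_expR_tail c :
  (\int[mu]_t ((c < t)%R%:R * expR (- t))%:E = (expR (- c))%:E)%E.
Proof.
have cE : continuous (fun t : R => expR (- t)).
  move=> x; apply: (@continuous_comp _ _ _ (-%R) expR); last exact: continuous_expR.
  exact: opp_continuous.
rewrite -integral_gt_indic integral_itv_obnd_cbnd; last first.
  by apply/measurable_EFinP/measurable_funTS; exact: continuous_measurable_fun.
pose F : R -> R := - (expR \o -%R).
have dF x : is_derive x 1 F (expR (- x)).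
  by apply: is_derive_eq; rewrite mulrN1 opprK.
rewrite (@ge0_continuous_FTC2y _ _ F _ 0).
- by rewrite sub0e -EFinN opprK.
- by move=> x _; exact: expR_ge0.
- exact: continuous_subspaceT.
- rewrite -[X in _ --> X]oppr0; apply: cvgN.
  exact: cvgr_expR.
- by move=> x _; have [] := dF x.
- apply: cvg_at_right_filter; apply: differentiable_continuous.
  by apply/derivable1_diffP; have [] := dF c.
- by move=> x _; rewrite derive1E; have [] := dF x.
Qed.

Lemma cvg_powRN_y b : 0 < b -> x `^ (- b) @[x --> +oo] --> (0 : R).
Proof.
move=> b0; apply/cvgrPdist_le => e e0; near=> x.
have x0 : 0 < x by near: x; exact: nbhs_pinfty_gt.
rewrite sub0r normrN ger0_norm ?powR_ge0// powRN.
rewrite -[leRHS]invrK lef_pV2 ?posrE ?powR_gt0 ?invr_gt0//.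
rewrite -(powR_inv1 (ltW e0)).
have -> : e `^ (-1) = (e `^ (- b^-1)) `^ b by rewrite -powRrM mulNr mulVf ?gt_eqF.
apply: (ge0_ler_powR (ltW b0)); rewrite ?nnegrE ?powR_ge0 ?(ltW x0)//.
Unshelve. all: by end_near. Qed.

Lemma integral_powR_tail_itv b c : 0 < b -> 0 < c ->
  (\int[mu]_(t in `[c, +oo[) (t `^ (- b - 1))%:E = (c `^ (- b) / b)%:E)%E.
Proof.
move=> b0 c0.
pose F : R -> R := (- b^-1) \*: (fun x => x `^ (- b)).
have dF x : 0 < x -> is_derive x 1 F (x `^ (- b - 1)).
  move=> x0; have ? := is_derive1_powR (- b) x0.
  apply: is_derive_eq; rewrite /GRing.scale/= mulrA mulrNN mulVf ?mul1r//.
  by rewrite gt_eqF.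
have cp x y : 0 < x -> {for x, continuous (fun t => t `^ y)}.
  move=> x0; apply: differentiable_continuous; apply/derivable1_diffP.
  by apply: derivable_powR; rewrite in_itv/= x0.
rewrite (@ge0_continuous_FTC2y _ _ F _ 0).
- by rewrite sub0e -EFinN -[F c]/(- b^-1 * c `^ (- b)) mulNr opprK mulrC.
- by move=> x _; exact: powR_ge0.
- apply/continuous_within_itvcyP; split.
    by move=> x; rewrite in_itv/= andbT => cx; apply: cp; exact: lt_trans cx.
  by apply: cvg_at_right_filter; exact: cp.
- rewrite -[X in _ --> X](mulr0 (- b^-1)); 
  exact: (cvgM (cvg_cst (- b^-1)) (cvg_powRN_y b0)).
- by move=> x cx; have [] := dF x (lt_trans c0 cx).
- apply: cvg_at_right_filter; apply: differentiable_continuous.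
  by apply/derivable1_diffP; have [] := dF c c0.
- move=> x; rewrite in_itv/= andbT => cx.
  by rewrite derive1E; have [] := dF x (lt_trans c0 cx).
Qed.

Lemma integral_powR_tail b c : 0 < b -> 0 < c ->
  (\int[mu]_t ((c < t)%R%:R * t `^ (- b - 1))%:E = (c `^ (- b) / b)%:E)%E.
Proof.
move=> b0 c0; rewrite -integral_gt_indic integral_itv_obnd_cbnd; last first.
  by apply/measurable_EFinP/measurable_funTS; exact: measurable_powR.
exact: integral_powR_tail_itv.
Qed.

Lemma integral_powR_tail_le b c : 0 < b -> 0 < c ->
  (\int[mu]_t ((c <= t)%R%:R * t `^ (- b - 1))%:E = (c `^ (- b) / b)%:E)%E.
Proof.
move=> b0 c0; rewrite -integral_powR_tail_itv// [RHS]integral_mkcond.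
apply: eq_integral => t _; rewrite patchE mem_setE in_itv/= andbT.
by case: leP; rewrite ?mul1r ?mul0r.
Qed.

Lemma measurable_expRMN (r : R) :
  measurable_fun [set: measurableTypeR R] (fun t : R => expR (- (r * t))).
Proof.
have mM : measurable_fun [set: measurableTypeR R] (fun t : R => - (r * t)).
  by apply: (measurableT_comp (@oppr_measurable R setT)); exact: measurable_funM.
exact: (measurableT_comp (@measurable_expR R) mM).
Qed.

End one_dimensional_integrals.

(** * The Gamma integral *)

Section gamma_function.
Context {R : realType}.
Local Notation mu := (@lebesgue_measure R).
Implicit Types a b c r t x : R.

Let mell a r t : R := (0 < t)%R%:R * (t `^ (a - 1) * expR (- (r * t))).

Let mell_ge0 a r t : 0 <= mell a r t.
Proof. by rewrite !mulr_ge0 ?powR_ge0 ?expR_ge0. Qed.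

Let mmell a r : measurable_fun setT (mell a r : measurableTypeR R -> R).
Proof.
apply: measurable_funM; first exact: measurable_gt.
apply: measurable_funM; [exact: measurable_powR|exact: measurable_expRMN].
Qed.

(** Kept in [\bar R]: scaling, recursion and inversion then follow from substitution and Tonelli
    alone, and finiteness is deduced afterwards with the help of the recursion. *)
Let emell a r := (\int[mu]_t (mell a r t)%:E)%E.

Let emell_ge0 a r : (0 <= emell a r)%E.
Proof. by apply: integral_ge0 => t _; rewrite lee_fin. Qed.

Lemma powRD_gt0 x r t : 0 < x -> x `^ (r + t) = x `^ r * x `^ t.
Proof. by move=> x0; rewrite powRD// [x == 0]gt_eqF ?implybT. Qed.

Let emell_scale a r : 0 < r -> emell a r = ((r `^ (- a))%:E * emell a 1)%E.
Proof.
move=> r0.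
have r00 : r != 0 by rewrite gt_eqF.
have := @ge0_integral_affine1 R r 0 (fun t => (mell a 1 t)%:E) r00.
move=> /(_ _ _)/wrap[|t|]; [|by rewrite lee_fin|].
  by apply/measurable_EFinP; exact: mmell.
rewrite (_ : (fun t => _) = fun t => ((r `^ (a - 1))%:E * (mell a r t)%:E)%E).
  rewrite (ge0_integralZl_EFin _ measurableT) ?powR_ge0//; last 2 first.
  - by move=> t _; rewrite lee_fin.
  - by apply/measurable_EFinP; exact: mmell.
  rewrite -/(emell a r) -/(emell a 1) (gtr0_norm r0) => E.
  have -> : emell a r = ((r `^ (1 - a))%:E * ((r `^ (a - 1))%:E * emell a r))%E.
    rewrite muleA -EFinM -powRD_gt0//.
    by rewrite addrA subrK subrr powRr0 mul1e.
  rewrite E muleA -EFinM -powR_inv1 ?ltW// -powRD_gt0//.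
  by congr ((r `^ _)%:E * _)%E; ring.
apply/funext => t; rewrite -EFinM /mell addr0 pmulr_rgt0// mul1r.
case: ltP => [t0|_]; last by rewrite !mul0r mulr0.
by rewrite !mul1r powRM ?ltW// mulrA.
Qed.

(* Tonelli for t^a e^(-r t) over r > 1, instead of an integration by parts. *)
Let emell_rec a : 0 < a -> (a%:E * emell a 1 = emell (a + 1) 1)%E.
Proof.
move=> a0.
pose f (z : measurableTypeR R * measurableTypeR R) : R :=
  (1 < z.2)%R%:R * ((0 < z.1)%R%:R * (z.1 `^ (a + 1 - 1) * expR (- (z.2 * z.1)))).
have f0 z : 0 <= f z by rewrite !mulr_ge0 ?powR_ge0 ?expR_ge0.
have mf : measurable_fun setT f.
  apply: measurable_funM; first exact: (measurableT_comp (measurable_gt 1) measurable_snd).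
  apply: measurable_funM; first exact: (measurableT_comp (measurable_gt 0) measurable_fst).
  apply: measurable_funM.
    exact: (measurableT_comp (@measurable_powR R (a + 1 - 1)) measurable_fst).
  apply: (measurableT_comp (@measurable_expR R)).
  apply: (measurableT_comp (@oppr_measurable R setT)).
  by apply: measurable_funM; [exact: measurable_snd|exact: measurable_fst].
have := @fubini_tonelli _ _ _ _ R mu mu (EFin \o f).
move=> /(_ _ _)/wrap[|z|]; [exact/measurable_EFinP|by rewrite lee_fin|].
(* Integrating over r first leaves t^(a-1) e^(-t). The other order gives the value at a + 1 times
   r^(-a-1), whose integral over r > 1 is 1/a. *)
have -> : (\int[mu]_x \int[mu]_y (EFin \o f) (x, y) = emell a 1)%E.
  apply: eq_integral => t _; rewrite /f/= /mell.
  case: (ltP 0 t) => [t0|_]; last first.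
    by rewrite mul0r; apply: integral0_eq => r _; rewrite mul0r mulr0.
  have t00 : t != 0 by rewrite gt_eqF.
  have := @ge0_integral_affine1 R t 0 (fun v => ((t < v)%R%:R * expR (- v))%:E) t00.
  move=> /(_ _ _)/wrap[|v|]; [|by rewrite lee_fin mulr_ge0 ?expR_ge0|].
    apply/measurable_EFinP; apply: measurable_funM; first exact: measurable_gt.
    exact: (measurableT_comp (@measurable_expR R) (@oppr_measurable R setT)).
  rewrite integral_expR_tail (gtr0_norm t0) => E.
  transitivity (\int[mu]_r ((t `^ a)%:E * ((t < t * r + 0)%R%:R * expR (- (t * r + 0)))%:E))%E.
    apply: eq_integral => r _; rewrite addr0 -EFinM mul1r addrK.
    have -> : (t < t * r) = (1 < r) by rewrite -[X in (X < _)%R]mulr1 ltr_pM2l.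
    by rewrite mulrCA (mulrC r).
  rewrite (ge0_integralZl_EFin _ measurableT) ?powR_ge0//; last first.
    apply/measurable_EFinP; apply: measurable_funM.
      rewrite (_ : (fun _ => _) = fun r : measurableTypeR R => (1 < r)%R%:R).
        exact: measurable_gt.
      by apply/funext => r; rewrite addr0 -[X in (X < _)%R]mulr1 ltr_pM2l.
    rewrite (_ : (fun _ => _) = fun r => expR (- (t * r))).
      exact: measurable_expRMN.
    by apply/funext => r; rewrite addr0.
  rewrite E -!EFinM !mul1r mulrA; congr (_ * _)%:E.
  by rewrite -powR_inv1 ?ltW// -powRD_gt0.
have -> : (\int[mu]_y \int[mu]_x (EFin \o f) (x, y) =
    \int[mu]_r (emell (a + 1) 1 * ((1 < r)%R%:R * r `^ (- a - 1))%:E))%E.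
  apply: eq_integral => r _; rewrite /f/=.
  case: (ltP 1 r) => [r1|_]; last first.
    by rewrite mul0r mule0; apply: integral0_eq => t _; rewrite mul0r.
  rewrite mul1r muleC -[(- a - 1)%R]opprD -emell_scale ?(lt_trans _ r1)//.
  by apply: eq_integral => t _; rewrite mul1r.
rewrite ge0_integralZl//; last 2 first.
- apply/measurable_EFinP; apply: measurable_funM; first exact: measurable_gt.
  exact: measurable_powR.
- by move=> r _; rewrite lee_fin mulr_ge0 ?powR_ge0.
rewrite integral_powR_tail// powR1 div1r => ->.
by rewrite muleC -muleA -EFinM mulVf ?gt_eqF// mule1.
Qed.

(* Tonelli for l^(-b-1) e^(-v) over v > r / l, instead of substituting 1 / l. *)
Let emell_inv b r : 0 < b -> 0 < r ->
  (\int[mu]_l ((0 < l)%R%:R * (l `^ (- b - 1) * expR (- (r / l))))%:E =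
   (r `^ (- b))%:E * emell b 1)%E.
Proof.
move=> b0 r0.
(* The constraint v > r / l is written with the power -1 of l, for the sake of [measurable_powR].
   Integrating over l first leaves r^(-b) v^b e^(-v) / b, and the recursion absorbs the division by
   b. *)
pose f (z : measurableTypeR R * measurableTypeR R) : R :=
  (0 < z.1)%R%:R * ((0 < z.2)%R%:R *
    ((0 < z.2 - r * z.1 `^ (-1))%R%:R * (z.1 `^ (- b - 1) * expR (- z.2)))).
have f0 z : 0 <= f z by rewrite !mulr_ge0 ?powR_ge0 ?expR_ge0.
have mf : measurable_fun setT f.
  apply: measurable_funM; first exact: (measurableT_comp (measurable_gt 0) measurable_fst).
  apply: measurable_funM; first exact: (measurableT_comp (measurable_gt 0) measurable_snd).
  apply: measurable_funM.
    apply: (measurableT_comp (measurable_gt 0)).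
    apply: measurable_funB; first exact: measurable_snd.
    apply: measurable_funM => //.
    exact: (measurableT_comp (@measurable_powR R (-1)) measurable_fst).
  apply: measurable_funM.
    exact: (measurableT_comp (@measurable_powR R (- b - 1)) measurable_fst).
  apply: (measurableT_comp (@measurable_expR R)).
  by apply: (measurableT_comp (@oppr_measurable R setT)); exact: measurable_snd.
have := @fubini_tonelli _ _ _ _ R mu mu (EFin \o f).
move=> /(_ _ _)/wrap[|z|]; [exact/measurable_EFinP|by rewrite lee_fin|].
have -> : (\int[mu]_x \int[mu]_y (EFin \o f) (x, y) =
    \int[mu]_l ((0 < l)%R%:R * (l `^ (- b - 1) * expR (- (r / l))))%:E)%E.
  apply: eq_integral => l _; rewrite /f/=.
  case: (ltP 0 l) => [l0|_]; last first.
    by rewrite mul0r; apply: integral0_eq => v _; rewrite mul0r.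
  transitivity (\int[mu]_v ((l `^ (- b - 1))%:E * ((r / l < v)%R%:R * expR (- v))%:E))%E.
    apply: eq_integral => v _; rewrite -EFinM mul1r (powR_inv1 (ltW l0)) subr_gt0.
    congr EFin; have [rv|_] := ltP (r / l) v; last by rewrite !(mul0r, mulr0).
    by rewrite (lt_trans _ rv) ?divr_gt0// !mul1r.
  rewrite (ge0_integralZl_EFin _ measurableT) ?powR_ge0//; last first.
    apply/measurable_EFinP; apply: measurable_funM; first exact: measurable_gt.
    exact: (measurableT_comp (@measurable_expR R) (@oppr_measurable R setT)).
  by rewrite integral_expR_tail mul1r.
have -> : (\int[mu]_y \int[mu]_x (EFin \o f) (x, y) =
    \int[mu]_v ((r `^ (- b) / b)%:E * (mell (b + 1) 1 v)%:E))%E.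
  apply: eq_integral => v _; rewrite /f/= /mell.
  have [v0|_] := ltP 0 v; last first.
    by rewrite mul0r mule0; apply: integral0_eq => l _; rewrite mul0r mulr0.
  transitivity (\int[mu]_l ((expR (- v))%:E * ((r / v < l)%R%:R * l `^ (- b - 1))%:E))%E.
    apply: eq_integral => l _; rewrite -EFinM mul1r; congr EFin.
    have [l0|l0] := ltP 0 l.
      rewrite (powR_inv1 (ltW l0)) subr_gt0.
      have -> : (r / l < v) = (r / v < l) by rewrite !ltr_pdivrMr// mulrC.
      by rewrite mul1r mulrA mulrC.
    by rewrite mul0r [r / v < l]ltNge (le_trans l0) ?divr_ge0 ?ltW// mul0r mulr0.
  rewrite (ge0_integralZl_EFin _ measurableT) ?expR_ge0//; last 2 first.
  - by move=> l _; rewrite lee_fin mulr_ge0 ?powR_ge0.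
  - apply/measurable_EFinP; apply: measurable_funM; first exact: measurable_gt.
    exact: measurable_powR.
  rewrite integral_powR_tail ?divr_gt0// -!EFinM !mul1r addrK; congr EFin.
  rewrite powRM ?invr_ge0 ?ltW// -(powR_inv1 (ltW v0)) -powRrM mulN1r opprK.
  by ring.
rewrite (ge0_integralZl_EFin _ measurableT); last 3 first.
- by move=> v _; rewrite lee_fin.
- exact/measurable_EFinP.
- by rewrite divr_ge0 ?powR_ge0 ?ltW.
rewrite -/(emell (b + 1) 1) -emell_rec// => ->.
by rewrite muleA -EFinM divfK ?gt_eqF.
Qed.

(** For [1 <= a] the power t^(a-1) is bounded near 0 and, further out, by a multiple of e^(t/2); the
    other half of the exponential is integrable. *)
Let emell_lty_ge1 a : 1 <= a -> (emell a 1 < +oo)%E.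
Proof.
move=> a1; have [k ak] : exists k : nat, a - 1 <= k.+1%:R.
  exists (Num.bound (a - 1)); apply/ltW.
  have a10 : 0 <= a - 1 by rewrite subr_ge0.
  by apply: lt_le_trans (archi_boundP a10) _; rewrite ler_nat.
(* The 1 serves t <= 1. For t >= 1, t^(a-1) <= t^(k+1), and (t/2)^(k+1) / (k+1)! <= e^(t/2) by the
   exponential series. *)
pose C : R := 1 + 2 ^+ k.+1 * (k.+1)`!%:R.
have C0 : 0 <= C by rewrite addr_ge0// mulr_ge0// exprn_ge0.
have h2 : (2^-1 : R) != 0 by rewrite invr_eq0.
have := @ge0_integral_affine1 R 2^-1 0 (fun v => ((0 < v)%R%:R * expR (- v))%:E) h2.
move=> /(_ _ _)/wrap[|v|]; [|by rewrite lee_fin mulr_ge0 ?expR_ge0|].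
  apply/measurable_EFinP; apply: measurable_funM; first exact: measurable_gt.
  exact: (measurableT_comp (@measurable_expR R) (@oppr_measurable R setT)).
rewrite integral_expR_tail => E.
have mE : measurable_fun setT (fun x : measurableTypeR R =>
    ((0 < 2^-1 * x + 0)%R%:R * expR (- (2^-1 * x + 0)))%:E).
  apply/measurable_EFinP; apply: measurable_funM.
    rewrite (_ : (fun _ => _) = fun r : measurableTypeR R => (0 < r)%R%:R).
      exact: measurable_gt.
    by apply/funext => r; rewrite addr0 pmulr_rgt0.
  rewrite (_ : (fun _ => _) = fun r => expR (- (2^-1 * r))).
    exact: measurable_expRMN.
  by apply/funext => r; rewrite addr0.
apply: (@le_lt_trans _ _ (\int[mu]_t (C%:E *
    ((0 < 2^-1 * t + 0)%R%:R * expR (- (2^-1 * t + 0)))%:E))%E).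
  apply: ge0_le_integral => //.
  - by move=> t _; rewrite lee_fin.
  - by apply/measurable_EFinP; exact: mmell.
  - by apply: emeasurable_funM => //; exact: measurable_cst.
  move=> t _; rewrite -EFinM lee_fin addr0 pmulr_rgt0// /mell mul1r.
  have [t0|_] := ltP 0 t; last by rewrite !mul0r mulr0.
  rewrite !mul1r.
  have -> : expR (- t) = expR (- (2^-1 * t)) * expR (- (2^-1 * t)).
    by rewrite -expRD; congr expR; field.
  rewrite mulrA ler_pM2r ?expR_gt0// expRN ler_pdivrMr ?expR_gt0//.
  have t2 : 0 <= 2^-1 * t by rewrite mulr_ge0// ltW.
  have e1 : 1 <= expR (2^-1 * t) by rewrite -[X in X <= _]expR0 ler_expR.
  have [t1|/ltW t1] := leP 1 t.
    apply: (@le_trans _ _ (t ^+ k.+1)).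
      by rewrite -(powR_mulrn _ (ltW t0)); exact: ler_powR.
    have := expR_ge1Dxn k t2.
    set X := expR _ => hX.
    have : (2^-1 * t) ^+ k.+1 <= (k.+1)`!%:R * X.
      rewrite -ler_pdivrMl ?ltr0n ?fact_gt0// mulrC.
      by apply: le_trans hX; rewrite lerDr.
    rewrite exprMn exprVn mulrC ler_pdivrMr ?exprn_gt0// => h.
    apply: le_trans h _; rewrite /C mulrDl mul1r mulrC mulrA lerDr.
    exact: le_trans e1.
  apply: (@le_trans _ _ 1); last first.
    by apply: le_trans e1 _; rewrite /C mulrDl mul1r lerDl mulr_ge0 ?expR_ge0// mulr_ge0// exprn_ge0.
  have a10 : 0 <= a - 1 by rewrite subr_ge0.
  have := @ge0_ler_powR R _ a10 t 1; rewrite !nnegrE powR1 => -> //.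
  exact: ltW.
rewrite (ge0_integralZl_EFin _ measurableT)//.
by rewrite E -!EFinM ltry.
Qed.

Let emell_gt0_ge1 a : 1 <= a -> (0 < emell a 1)%E.
Proof.
move=> a1; apply: (@lt_le_trans _ _ (expR (-1))%:E); first by rewrite lte_fin expR_gt0.
rewrite -(integral_expR_tail (1 : R)); apply: ge0_le_integral => //.
- apply/measurable_EFinP; apply: measurable_funM; first exact: measurable_gt.
  exact: (measurableT_comp (@measurable_expR R) (@oppr_measurable R setT)).
- by apply/measurable_EFinP; exact: mmell.
move=> t _; rewrite lee_fin /mell mul1r.
have [t1|_] := ltP 1 t; last by rewrite mul0r mulr_ge0 ?mulr_ge0 ?powR_ge0 ?expR_ge0.
rewrite (lt_trans _ t1)// !mul1r ler_peMl ?expR_ge0//.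
by rewrite -[X in X <= _](powRr0 t) ler_powR ?subr_ge0// ltW.
Qed.

(** For a < 1 the integrand is unbounded at 0; the recursion pulls finiteness and positivity back
    from [a + 1]. *)
Let emell_bounds a : 0 < a -> (0 < emell a 1 < +oo)%E.
Proof.
move=> a0; have a1 : 1 <= a + 1 by rewrite lerDr ltW.
have := emell_gt0_ge1 a1; have := emell_lty_ge1 a1; rewrite -(emell_rec a0).
case: (emell a 1) (emell_ge0 a 1) => [x| |]//.
  by move=> _ _; rewrite -EFinM !lte_fin ltry andbT pmulr_rgt0.
by rewrite gt0_muley ?lte_fin.
Qed.

Let GammaE a : Gamma a = fine (emell a 1).
Proof.
rewrite /Gamma Rintegral_gt_indic /Rintegral; congr fine.
by apply: eq_integral => t _; rewrite /mell mul1r.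
Qed.

Let emellE a : 0 < a -> emell a 1 = (Gamma a)%:E.
Proof.
move=> a0; have /andP[m0 moo] := emell_bounds a0.
by rewrite GammaE fineK// ge0_fin_numE.
Qed.

Lemma Gamma_gt0 a : 0 < a -> 0 < Gamma a.
Proof.
by move=> a0; rewrite -lte_fin -emellE//; have /andP[] := emell_bounds a0.
Qed.

Lemma GammaS a : 0 < a -> Gamma (a + 1) = a * Gamma a.
Proof.
move=> a0; apply: EFin_inj.
by rewrite EFinM -!emellE ?addr_gt0// emell_rec.
Qed.

Lemma integral_Gamma a r : 0 < a -> 0 < r ->
  (\int[mu]_t ((0 < t)%R%:R * (t `^ (a - 1) * expR (- (r * t))))%:E =
   (Gamma a * r `^ (- a))%:E)%E.
Proof. by move=> a0 r0; rewrite -/(emell a r) emell_scale// emellE// muleC EFinM. Qed.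

(** This form serves the frequency side, where a Gaussian of parameter l has become e^(-|y|^2 / (4
    l)). *)
Lemma integral_Gamma_inv a r : 0 < a -> 0 < r ->
  (\int[mu]_l ((0 < l)%R%:R * (l `^ (- a - 1) * expR (- (r / l))))%:E =
   (Gamma a * r `^ (- a))%:E)%E.
Proof. by move=> a0 r0; rewrite emell_inv// emellE// muleC EFinM. Qed.

End gamma_function.

(** * An integrable weight of polynomial decay *)

Section polynomial_weight.
Context {R : realType}.

Lemma integral_row_prod n (g : R -> R) (c : R) :
  measurable_fun setT (g : measurableTypeR R -> R) -> (forall t, 0 <= g t) ->
  (\int[@lebesgue_measure R]_t (g t)%:E = c%:E)%E ->
  (\int[lebesgue_row n]_x (\prod_(k < n) g (x ord0 k))%:E = (c ^+ n)%:E)%E.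
Proof.
move=> mg g0 gc.
have mprod m : measurable_fun setT (fun x : 'rV[R]_m => \prod_(k < m) g (x ord0 k)).
  apply: measurable_prod => k _.
  exact: (measurableT_comp mg (@measurable_row_coor R m k)).
have prod_ge0 m (x : 'rV[R]_m) : 0 <= \prod_(k < m) g (x ord0 k).
  by apply: prodr_ge0.
elim: n => [|n IH].
  rewrite expr0 /= integral_dirac//= ?diracT ?mul1e ?big_ord0//.
  by apply/measurable_EFinP; exact: mprod.
rewrite ge0_integral_row_cons//; last 2 first.
- by apply/measurable_EFinP; exact: mprod.
- by move=> x; rewrite lee_fin.
transitivity (\int[@lebesgue_measure R]_t ((c ^+ n)%:E * (g t)%:E))%E.
  apply: eq_integral => t _; rewrite -IH muleC -ge0_integralZl_EFin//.
    apply: eq_integral => y _; rewrite -EFinM big_ord_recl.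
    rewrite -[row_cons _ _ _]/(row_coor _ _) row_cons0; congr (_ * _)%:E.
    by apply: eq_bigr => k _; rewrite -[row_cons _ _ _]/(row_coor _ _) row_consS.
  - by move=> x _; rewrite lee_fin.
  - by apply/measurable_EFinP; exact: mprod.
have c0 : 0 <= c by rewrite -lee_fin -gc; apply: integral_ge0 => t _; rewrite lee_fin.
rewrite ge0_integralZl_EFin//; last 3 first.
- by move=> t _; rewrite lee_fin.
- exact/measurable_EFinP.
- exact: exprn_ge0.
by rewrite gc -EFinM -exprSr.
Qed.

(** The exponent 2n allots (1 + |x|)^(-2) to each coordinate, and with the sup norm this is at most
    1 / (1 + x_k^2): the weight is dominated by a product of Cauchy densities, of integral pi^n.
    Decay is measured below in powers of it. *)
Definition weight {n} (x : 'rV[R]_n) : R := (1 + `|x|) ^- n.*2.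

Section weight_theory.
Context {n : nat}.
Implicit Types x y z : 'rV[R]_n.

Lemma weight_gt0 x : 0 < weight x.
Proof. by rewrite invr_gt0 exprn_gt0// ltr_pwDl. Qed.

Lemma weight_ge0 x : 0 <= weight x.
Proof. exact/ltW/weight_gt0. Qed.

Lemma weight_le1 x : weight x <= 1.
Proof. by rewrite invf_le1 ?exprn_gt0 ?ltr_pwDl// exprn_ege1// lerDl. Qed.

(** A Peetre inequality: 1 + |z| <= (1 + |x|) (1 + |x + z|) by the triangle inequality. It trades
    decay in x for decay in z. *)
Lemma weightM_le x z : weight x * weight (x + z) <= weight z.
Proof.
rewrite /weight -invfM -exprMn lef_pV2 ?posrE ?exprn_gt0 ?mulr_gt0 ?ltr_pwDl//.
apply: lerXn2r; rewrite ?nnegrE ?mulr_ge0 ?addr_ge0//.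
have : `|z| <= `|x| + `|x + z|.
  by rewrite -[X in `|X| <= _](addKr x) (le_trans (ler_normD _ _))// normrN.
move=> h; rewrite mulrDl mul1r mulrDr mulr1 -addrA lerD2l.
apply: (le_trans h); rewrite addrCA lerD2l lerDl.
by rewrite mulr_ge0.
Qed.

(** From 1 + |x| <= 2 (1 + |x + y|), raised to the power 2n. Translates by at most 1 are thus
    dominated by one integrable function. *)
Lemma weight_shift x y : `|y| <= 1 -> weight (x + y) <= 4 ^+ n * weight x.
Proof.
move=> y1; have -> : (4 : R) ^+ n = 2 ^+ n.*2.
  by rewrite -mul2n exprM expr2 -natrM.
rewrite /weight -[X in _ <= _ * X]exprVn -exprMn -[X in X <= _]exprVn.
have p (z : 'rV[R]_n) : 0 < 1 + `|z| by rewrite ltr_pwDl.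
apply: lerXn2r; rewrite ?nnegrE ?mulr_ge0 ?invr_ge0 ?addr_ge0//.
rewrite -ler_pdivrMr ?invr_gt0// invrK mulrC ler_pdivrMr//.
have : `|x| <= `|x + y| + `|y|.
  by rewrite -[X in `|X| <= _](addrK y) (le_trans (ler_normD _ _))// normrN.
have := normr_ge0 (x + y); lra.
Qed.

Lemma measurable_weight : measurable_fun setT (@weight n).
Proof.
have m1 : measurable_fun setT (fun x : 'rV[R]_n => 1 + `|x|).
  apply: measurable_funD => //; apply: continuous_measurable_row.
  exact: norm_continuous.
rewrite (_ : weight = (fun x : 'rV[R]_n => (1 + `|x|) `^ (- n.*2%:R))).
  exact: (measurableT_comp (@measurable_powR R _) m1).
by apply/funext => x; rewrite powR_invn// addr_ge0.
Qed.

Lemma integrable_weight : (lebesgue_row n).-integrable setT (EFin \o @weight n).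
Proof.
have mW := measurable_weight.
apply/integrableP; split; first exact/measurable_EFinP.
have c2 : (\int[@lebesgue_measure R]_t ((oneDsqr t)^-1)%:E = pi%:E)%E.
  rewrite (@ge0_symfun_integralT R (fun t => (oneDsqr t)^-1)).
  - rewrite (_ : [set x | _] = `[0, +oo[%classic); last first.
      by apply/seteqP; split => x/=; rewrite in_itv/= andbT.
    by rewrite integral0y_oneDsqr -EFinM mulrC divfK.
  - by move=> t; rewrite invr_ge0.
  - exact: continuous_oneDsqrV.
  - by move=> t/=; rewrite /oneDsqr sqrrN.
have mo : measurable_fun setT ((fun t => (oneDsqr t)^-1) : measurableTypeR R -> R).
  by apply: continuous_measurable_fun; exact: continuous_oneDsqrV.
have o0 t : 0 <= (oneDsqr t : R)^-1 by rewrite invr_ge0.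
have := integral_row_prod n mo o0 c2 => E.
apply: (@le_lt_trans _ _ (pi ^+ n)%:E); last by rewrite ltry.
rewrite -E; apply: ge0_le_integral => //.
- by apply: measurableT_comp => //; exact/measurable_EFinP.
- apply/measurable_EFinP; apply: measurable_prod => k _.
  exact: (measurableT_comp mo (@measurable_row_coor R n k)).
move=> x _; rewrite /= lee_fin ger0_norm ?weight_ge0// /weight -exprVn.
rewrite -[X in _ ^+ X]muln2 mulnC exprM.
have -> : ((1 + `|x|)^-1 ^+ 2) ^+ n = \prod_(k < n) ((1 + `|x|)^-1 ^+ 2).
  by rewrite prodr_const card_ord.
apply: ler_prod => k _; rewrite exprn_ge0 ?invr_ge0 ?addr_ge0//=.
rewrite exprVn lef_pV2 ?posrE ?oneDsqr_gt0 ?exprn_gt0 ?ltr_pwDl ?sqr_ge0//.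
rewrite /oneDsqr -real_normK ?num_real// sqrrD expr1n mul1r.
have h := coor_le_norm x k.
have : `|x ord0 k| ^+ 2 <= `|x| ^+ 2 by apply: lerXn2r; rewrite ?nnegrE.
have := normr_ge0 x; lra.
Qed.

End weight_theory.
End polynomial_weight.

(** * Polar coordinates for the cone measure *)

Lemma ge0_integral_mrestr (R : realType) d (T : measurableType d)
    (mu : {measure set T -> \bar R}) (B D : set T) (mB : measurable B)
    (f : T -> \bar R) : measurable D -> measurable_fun D f ->
  (forall x, 0 <= f x)%E ->
  (\int[mrestr mu mB]_(x in D) f x = \int[mu]_(x in D `&` B) f x)%E.
Proof.
move=> mD mf f0.
rewrite (ge0_negligible_integral (measurableC mB) mD mf (fun x _ => f0 x)); last first.
  by rewrite /= /mrestr setICl measure0.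
rewrite setDE setCK; apply: eq_measure_integral => A mA AB.
by rewrite /= /mrestr; congr (mu _); apply/setIidPl => x /AB[].
Qed.

Section polar_coordinates.
Context {R : realType} (m : nat).
Local Notation n := m.+1.
Local Notation mu := (@lebesgue_measure R).
Local Notation leb := (@lebesgue_row R n).
Local Notation sph := (@sphere_measure R n).
Local Notation sphere := (@unit_sphere R n).
Implicit Types (xi x u : 'rV[R]_n) (r t : R).

Lemma measurable_unit_sphere : measurable sphere.
Proof.
rewrite (_ : sphere = @enorm R n @^-1` [set 1]) //.
by rewrite -[X in measurable X]setTI; exact: measurable_enorm.
Qed.

Lemma unit_sphere_normalize x : x != 0 -> sphere (normalize x).
Proof.
move=> x0; rewrite /unit_sphere /= /normalize enormZ ger0_norm.
  by rewrite mulVf// enorm_eq0.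
by rewrite invr_ge0 enorm_ge0.
Qed.

Lemma preimage_normalize_sphere : @normalize R n @^-1` sphere = [set~ 0].
Proof.
apply/seteqP; split => x /=; last by move=> /eqP; exact: unit_sphere_normalize.
move=> S x0; move: S; rewrite x0 /unit_sphere /= /normalize scaler0.
by move/eqP; rewrite -[_ == 1]negbK; apply/negP/negPn;
  rewrite (eqP (_ : enorm 0 == 0 :> R)) ?enorm_eq0// eq_sym oner_eq0.
Qed.

(** The ball loses its origin because [normalize] sends it to 0, off the sphere; the remaining
    points satisfy [x != 0], as rescaling rays requires. *)
Lemma ge0_integral_sphere (Phi : 'rV[R]_n -> \bar R) :
  measurable_fun setT Phi -> (forall x, 0 <= Phi x)%E ->
  (\int[sph]_(xi in sphere) Phi xi =
   n%:R%:E * \int[leb]_(x in @unit_ball R n `\ 0%R) Phi (normalize x))%E.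
Proof.
move=> mPhi Phi0; have mB := @measurable_unit_ball R n.
have m0 : measurable [set~ (0 : 'rV[R]_n)].
  by apply: measurableC; exact: measurable_row_zero.
have mPn := measurableT_comp mPhi (@measurable_normalize R n).
rewrite ge0_integral_pushforward//; last 2 first.
- exact: measurable_unit_sphere.
- exact: measurable_funTS.
rewrite preimage_normalize_sphere.
rewrite (ge0_integral_mscale (mrestr leb (@measurable_unit_ball R n)) m0 n%:R%:nng
  (measurable_funTS mPn)) => [|x _]; last exact: Phi0.
rewrite (ge0_integral_mrestr _ mB m0 (measurable_funTS mPn)) => [|x]; last exact: Phi0.
by rewrite setIC.
Qed.

Lemma measurable_gt2 d (T : measurableType d) (f g : T -> R) :
  measurable_fun setT f -> measurable_fun setT g ->
  measurable_fun setT (fun t : T => (f t < g t)%R%:R : R).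
Proof.
move=> mf mg.
rewrite (_ : (fun _ => _) = (fun t : measurableTypeR R => (0 < t)%R%:R : R) \o (g \- f)).
  by apply: (measurableT_comp (measurable_gt 0)); exact: measurable_funB.
by apply/funext => x /=; rewrite subr_gt0.
Qed.

Lemma measurable_ge2 d (T : measurableType d) (f g : T -> R) :
  measurable_fun setT f -> measurable_fun setT g ->
  measurable_fun setT (fun t : T => (f t <= g t)%R%:R : R).
Proof.
move=> mf mg; rewrite (_ : (fun _ => _) = fun t : T => 1 - (g t < f t)%R%:R).
  by apply: measurable_funB => //; exact: measurable_gt2.
by apply/funext => x; rewrite leNgt; case: (g x < f x); rewrite ?subrr ?subr0.
Qed.

Let mscale_row : measurable_fun setT
  (fun z : 'rV[R]_n * measurableTypeR R => z.2 *: z.1).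
Proof.
by apply: measurable_row_scale; [exact: measurable_snd|exact: measurable_fst].
Qed.

Let radial (F : 'rV[R]_n -> \bar R) xi :=
  (\int[mu]_t (((0 < t)%R%:R * t ^+ m)%:E * F (t *: xi)))%E.

Let dens_ge0 t : 0 <= (0 < t)%R%:R * t ^+ m.
Proof. by case: ltP => [t0|_]; rewrite ?mul0r// mul1r exprn_ge0// ltW. Qed.

Let mdens : measurable_fun setT
  (fun t : measurableTypeR R => ((0 < t)%R%:R * t ^+ m)%:E).
Proof.
apply/measurable_EFinP; apply: measurable_funM; first exact: measurable_gt.
exact: measurable_funX.
Qed.

Let radial_ge0 F xi : (forall x, 0 <= F x)%E -> (0 <= radial F xi)%E.
Proof. by move=> F0; apply: integral_ge0 => t _; rewrite mule_ge0// lee_fin. Qed.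

Let measurable_radial F : measurable_fun setT F -> (forall x, 0 <= F x)%E ->
  measurable_fun setT (radial F).
Proof.
move=> mF F0; apply: (measurable_fun_fubini_tonelli_F
  (fun z : 'rV[R]_n * measurableTypeR R =>
     ((0 < z.2)%R%:R * z.2 ^+ m)%:E * F (z.2 *: z.1))%E).
  apply: emeasurable_funM; first exact: (measurableT_comp mdens measurable_snd).
  exact: (measurableT_comp mF mscale_row).
by move=> z; rewrite mule_ge0// lee_fin.
Qed.

Let radial_normalize F x : x != 0 ->
  measurable_fun setT F -> (forall x, 0 <= F x)%E ->
  radial F (normalize x) = ((enorm x ^+ n)%:E * radial F x)%E.
Proof.
move=> x0 mF F0.
have e0 : 0 < enorm x by rewrite enorm_gt0.
pose G t := (((0 < t)%R%:R * t ^+ m)%:E * F (t *: normalize x))%E.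
have mG : measurable_fun setT (G : measurableTypeR R -> _).
  apply: emeasurable_funM => //; apply: (measurableT_comp mF).
  exact: measurable_row_scale.
have G0 t : (0 <= G t)%E by rewrite mule_ge0// lee_fin.
have := ge0_integral_affine1 0 (lt0r_neq0 e0) mG G0.
rewrite -/(radial F (normalize x)) => E.
have -> : radial F (normalize x) =
    ((enorm x)%:E * ((`|enorm x|^-1)%:E * radial F (normalize x)))%E.
  by rewrite muleA -EFinM gtr0_norm// divff ?gt_eqF// mul1e.
rewrite -E.
have -> : (\int[mu]_t G (enorm x * t + 0)%R = (enorm x ^+ m)%:E * radial F x)%E.
  rewrite -ge0_integralZl_EFin//; last 3 first.
  - by move=> t _; rewrite mule_ge0// lee_fin.
  - apply: emeasurable_funM => //; apply: (measurableT_comp mF).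
    exact: measurable_row_scale.
  - by rewrite exprn_ge0// enorm_ge0.
  apply: eq_integral => t _; rewrite /G addr0 pmulr_rgt0// muleA -EFinM.
  rewrite /normalize scalerA mulrAC divff ?gt_eqF// mul1r.
  by congr (_%:E * _)%E; rewrite exprMn mulrCA.
by rewrite muleA -EFinM -exprS.
Qed.

(** The cone measure turns the left side into n times the integral of F(r x) |x|^n r^m over |x| <= 1
    and r > 0. Exchanging the integrals and putting u = r x gives the density |u|^n r^(-n-1) on r >=
    |u|. After a second exchange, n |u|^n times the integral of r^(-n-1) over r >= |u| equals 1 for
    u != 0. *)
Theorem ge0_integral_polar (F : 'rV[R]_n -> \bar R) :
  measurable_fun setT F -> (forall x, 0 <= F x)%E ->
  (\int[sph]_(xi in sphere)
     \int[mu]_t (((0 < t)%R%:R * t ^+ m)%:E * F (t *: xi)) =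
   \int[leb]_x F x)%E.
Proof.
move=> mF F0.
rewrite -[LHS]/(\int[sph]_(xi in sphere) radial F xi)%E.
rewrite ge0_integral_sphere; last 2 first.
- exact: measurable_radial.
- by move=> x; exact: radial_ge0.
pose b x r : R := ((enorm x <= 1)%R%:R * enorm x ^+ n) * ((0 < r)%R%:R * r ^+ m).
have b0 x r : 0 <= b x r.
  by rewrite mulr_ge0 ?dens_ge0// mulr_ge0// exprn_ge0// enorm_ge0.
have mb : measurable_fun setT (fun z : 'rV[R]_n * measurableTypeR R => b z.1 z.2).
  have me := measurableT_comp (@measurable_enorm R n)
    (@measurable_fst _ _ 'rV[R]_n (measurableTypeR R)).
  apply: measurable_funM; apply: measurable_funM.
  - exact: measurable_ge2.
  - exact: measurable_funX.
  - exact: (measurableT_comp (measurable_gt 0) measurable_snd).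
  - by apply: measurable_funX; exact: measurable_snd.
have -> : (\int[leb]_(x in @unit_ball R n `\ 0%R) radial F (normalize x) =
    \int[leb]_x \int[mu]_r ((b x r)%:E * F (r *: x)))%E.
  rewrite integral_mkcond; apply: eq_integral => x _; rewrite patchE.
  transitivity (((enorm x <= 1)%R%:R * enorm x ^+ n)%:E * radial F x)%E; last first.
    rewrite -ge0_integralZl_EFin//; last 3 first.
    - by move=> t _; rewrite mule_ge0// lee_fin.
    - apply: emeasurable_funM => //; apply: (measurableT_comp mF).
      exact: measurable_row_scale.
    - by rewrite mulr_ge0// exprn_ge0// enorm_ge0.
    by apply: eq_integral => r _; rewrite muleA -EFinM.
  case: ifPn => [|nx].
    rewrite inE => -[Bx /eqP x0]; rewrite radial_normalize// Bx mul1r//.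
  have [x1|_] := leP (enorm x) 1; last by rewrite mul0r mul0e.
  have /eqP -> : x == 0.
    by apply: contraNT nx => x0; rewrite inE; split => //=; exact/eqP.
  by rewrite (eqP (_ : enorm 0 == 0 :> R)) ?enorm_eq0// expr0n mulr0 mul0e.
rewrite (fubini_tonelli (fun z : 'rV[R]_n * measurableTypeR R =>
    (b z.1 z.2)%:E * F (z.2 *: z.1))%E); last 2 first.
- apply: emeasurable_funM; first exact/measurable_EFinP.
  exact: (measurableT_comp mF mscale_row).
- by move=> z; rewrite mule_ge0// lee_fin.
pose c u r : R := (0 < r)%R%:R * ((enorm u <= r)%R%:R * enorm u ^+ n * r `^ (- n%:R - 1)).
have c0 u r : 0 <= c u r by rewrite !mulr_ge0 ?exprn_ge0 ?enorm_ge0 ?powR_ge0.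
have mc : measurable_fun setT (fun z : 'rV[R]_n * measurableTypeR R => c z.1 z.2).
  have me := measurableT_comp (@measurable_enorm R n)
    (@measurable_fst _ _ 'rV[R]_n (measurableTypeR R)).
  apply: measurable_funM; first exact: (measurableT_comp (measurable_gt 0) measurable_snd).
  apply: measurable_funM; first apply: measurable_funM.
  - by apply: measurable_ge2 => //; exact: measurable_snd.
  - exact: measurable_funX.
  - exact: (measurableT_comp (@measurable_powR R (- n%:R - 1)) measurable_snd).
have -> : (\int[mu]_r \int[leb]_x ((b x r)%:E * F (r *: x)) =
    \int[mu]_r \int[leb]_u ((c u r)%:E * F u))%E.
  apply: eq_integral => r _.
  have [r0|r0] := ltP 0 r; last first.
    transitivity (0%E : \bar R).
      by apply: integral0_eq => x _; rewrite /b ltNge r0 mul0r mulr0 mul0e.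
    by apply/esym; apply: integral0_eq => x _; rewrite /c ltNge r0 mul0r mul0e.
  have r00 : r != 0 by rewrite gt_eqF.
  pose G u := (((enorm u <= r)%R%:R * enorm u ^+ n * r^-1)%:E * F u)%E.
  have mG : measurable_fun setT G.
    apply: emeasurable_funM => //; apply/measurable_EFinP.
    apply: measurable_funM => //; apply: measurable_funM.
      by apply: measurable_ge2 => //; exact: measurable_enorm.
    by apply: measurable_funX; exact: measurable_enorm.
  have G0 u : (0 <= G u)%E.
    by rewrite mule_ge0// lee_fin !mulr_ge0 ?exprn_ge0 ?enorm_ge0 ?invr_ge0 ?(ltW r0).
  have E := ge0_integral_affine 0 r00 mG G0.
  transitivity (\int[leb]_x G (r *: x + 0)%R)%E.
    apply: eq_integral => x _; rewrite /G addr0 enormZ (gtr0_norm r0).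
    have -> : (r * enorm x <= r) = (enorm x <= 1) by rewrite ger_pMr.
    congr (_%:E * _)%E; rewrite /b r0 mul1r.
    rewrite exprMn (exprSr r) -!mulrA; congr (_ * _).
    by rewrite [LHS]mulrC; congr (_ * _); rewrite mulrCA divff// mulr1.
  rewrite E -ge0_integralZl_EFin//.
  apply: eq_integral => u _; rewrite muleA -EFinM; congr (_%:E * _)%E.
  rewrite /c r0 mul1r mulrC -[LHS]mulrA; congr (_ * _).
  by rewrite (gtr0_norm r0) powRD_gt0// powR_invn ?(ltW r0)// powR_inv1 ?(ltW r0)// mulrC.
rewrite -(fubini_tonelli (fun z : 'rV[R]_n * measurableTypeR R =>
    (c z.1 z.2)%:E * F z.1)%E); last 2 first.
- apply: emeasurable_funM; first exact/measurable_EFinP.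
  exact: (measurableT_comp mF measurable_fst).
- by move=> z; rewrite mule_ge0// lee_fin.
have mI : measurable_fun setT (fun u => \int[mu]_r ((c u r)%:E * F u))%E.
  apply: (measurable_fun_fubini_tonelli_F (fun z : 'rV[R]_n * measurableTypeR R =>
    (c z.1 z.2)%:E * F z.1)%E).
    apply: emeasurable_funM; first exact/measurable_EFinP.
    exact: (measurableT_comp mF measurable_fst).
  by move=> z; rewrite mule_ge0// lee_fin.
have I0 u : (0 <= \int[mu]_r ((c u r)%:E * F u))%E.
  by apply: integral_ge0 => r _; rewrite mule_ge0// lee_fin.
rewrite -(ge0_integralZl_EFin leb measurableT (fun u _ => I0 u) mI (ler0n R n)).
apply: ae_eq_integral => //; first exact: measurable_funeM.
exists [set 0]; split; [exact: measurable_row_zero|exact: lebesgue_row_zero|].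
move=> u /= nu; apply: contrapT => u0; apply: nu => _.
have e0 : 0 < enorm u by rewrite enorm_gt0; exact/eqP.
have mcu : measurable_fun setT (fun r : measurableTypeR R => (c u r)%:E).
  apply/measurable_EFinP.
  exact: (measurableT_comp mc (pair1_measurable u)).
under eq_integral do rewrite muleC.
rewrite ge0_integralZl//; last by move=> r _; rewrite lee_fin.
rewrite muleCA -[RHS]mule1; congr (_ * _)%E.
have -> : (\int[mu]_r (c u r)%:E = (enorm u ^+ n)%:E *
    \int[mu]_r ((enorm u <= r)%R%:R * r `^ (- n%:R - 1))%:E)%E.
  rewrite -ge0_integralZl_EFin//; last 3 first.
  - by move=> r _; rewrite lee_fin mulr_ge0 ?powR_ge0.
  - apply/measurable_EFinP; apply: measurable_funM; last exact: measurable_powR.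
    by apply: measurable_ge2 => //; exact: measurable_cst.
  - by rewrite exprn_ge0// enorm_ge0.
  apply: eq_integral => r _; rewrite /c -EFinM; congr EFin.
  have [er|er] := leP (enorm u) r; last by rewrite !mul0r !mulr0.
  by rewrite (lt_le_trans e0 er) !mul1r.
rewrite integral_powR_tail_le// ?ltr0n// -!EFinM; congr EFin.
rewrite powR_invn ?enorm_ge0//; field.
by rewrite expf_neq0 ?(lt0r_neq0 e0)// andbT addrC natr1 pnatr_eq0.
Qed.

Lemma Rintegral_polar (a : 'rV[R]_n -> R) : leb.-integrable setT (EFin \o a) ->
  \int[sph]_(xi in sphere)
    \int[mu]_(t in setT) ((0 < t)%R%:R * t ^+ m * a (t *: xi)) =
  \int[leb]_(x in setT) a x.
Proof.
move=> ia; have mA := measurable_int _ ia.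
set A := EFin \o a in ia mA.
have mP : measurable_fun setT (A^\+)%E by exact: measurable_funepos.
have mN : measurable_fun setT (A^\-)%E by exact: measurable_funeneg.
have P0 x : (0 <= A^\+ x)%E by exact: funepos_ge0.
have N0 x : (0 <= A^\- x)%E by exact: funeneg_ge0.
have mS := measurable_unit_sphere.
have irad F : measurable_fun setT F -> (forall x, 0 <= F x)%E ->
    (\int[leb]_x F x < +oo)%E -> sph.-integrable sphere (radial F).
  move=> mF F0 Foo; apply/integrableP; split.
    exact: (measurable_funTS (measurable_radial mF F0)).
  under eq_integral do rewrite gee0_abs ?radial_ge0//.
  by rewrite /radial ge0_integral_polar.
have iP := irad _ mP P0 (integral_funepos_lt_pinfty measurableT ia).
have iN := irad _ mN N0 (integral_funeneg_lt_pinfty measurableT ia).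
have E xi : (\int[mu]_t ((0 < t)%R%:R * t ^+ m * a (t *: xi))%:E =
    radial (A^\+)%E xi - radial (A^\-)%E xi)%E.
  rewrite integralE; congr (_ - _)%E; apply: eq_integral => t _.
    by rewrite !funeposE maxe_pMr ?lee_fin// mule0 EFinM.
  by rewrite !funenegE maxe_pMr ?lee_fin// mule0 EFinM muleN.
rewrite [RHS]/Rintegral integralE -(ge0_integral_polar mP P0).
rewrite -(ge0_integral_polar mN N0) -(integralB mS iP iN) /Rintegral.
have iB := integrableB mS iP iN.
congr fine; apply: ae_eq_integral => //.
- apply/measurable_EFinP; apply: (measurableT_comp (f := fine)).
    exact: fine_measurable.
  under eq_fun do rewrite E.
  exact: (measurable_int _ iB).
- exact: (measurable_int _ iB).
(* In a direction where the extended radial integral is infinite, the real-valued one is 0 by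
   default; integrability makes these directions null. *)
have [M [mM M0 hM]] := integrable_ae mS iB.
exists M; split => // xi /= nxi; apply: hM => /= h; apply: nxi => Sxi.
by rewrite E fineK// h.
Qed.

(** The integrand h is compared for unit xi and positive t only, so |xi| = 1 can be used to read a
    beam integrand as t^m times a function of t xi. *)
Lemma cintegral_polar (g : 'rV[R]_n -> R[i]) (h : 'rV[R]_n -> R -> R[i]) :
  cintegrable leb setT g ->
  (forall xi t, sphere xi -> 0 < t -> h xi t = (t ^+ m)%:C * g (t *: xi)) ->
  cintegral sph sphere (fun xi => cintegral mu `]0, +oo[ (h xi)) =
  cintegral leb setT g.
Proof.
move=> [g1 g2] hE; apply: complex_eq; rewrite /cintegral /=.
  rewrite -(Rintegral_polar (a := @complex.Re R \o g) g1); apply: eq_Rintegral => xi.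
  rewrite inE => Sxi; rewrite Rintegral_gt_indic; apply: eq_Rintegral => t _ /=.
  have [t0|_] := ltP 0 t; last by rewrite !mul0r.
  by rewrite !mul1r hE// Re_mul/= mul0r subr0.
rewrite -(Rintegral_polar (a := @complex.Im R \o g) g2); apply: eq_Rintegral => xi.
rewrite inE => Sxi; rewrite Rintegral_gt_indic; apply: eq_Rintegral => t _ /=.
have [t0|_] := ltP 0 t; last by rewrite !mul0r.
by rewrite !mul1r hE// Im_mul/= mul0r addr0.
Qed.

Lemma sphere_measure_lty : (sph sphere < +oo)%E.
Proof.
rewrite -[X in (X < _)%E]mul1e -(integral_cst sph measurable_unit_sphere 1).
rewrite ge0_integral_sphere//; apply: lte_mul_pinfty => //.
have mB := @measurable_unit_ball R n.
have m0 : measurable (@unit_ball R n `\ 0).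
  by apply: measurableD => //; exact: measurable_row_zero.
rewrite integral_cst// mul1e.
(* On the unit ball 1 + |x| <= 2, so the weight is at least [4 ^- n]. *)
apply: (@le_lt_trans _ _ (\int[leb]_x ((4 ^+ n)%:E * (weight x)%:E))%E).
  rewrite -[X in (X <= _)%E]mul1e -(integral_cst leb m0 1) integral_mkcond.
  apply: ge0_le_integral => //.
  - by move=> x _; rewrite patchE; case: ifP.
  - by apply/(measurable_restrictT _ _).1 => //.
  - by apply: measurable_funeM; apply/measurable_EFinP; exact: measurable_weight.
  move=> x _; rewrite patchE; case: ifPn => [|_]; last first.
    by rewrite mule_ge0// lee_fin ?exprn_ge0// weight_ge0.
  rewrite inE => -[Bx _]; rewrite -EFinM lee_fin /weight.
  rewrite -mul2n exprM -exprVn -exprMn exprn_ege1//.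
  have p : 0 < (1 + `|x|) ^+ 2 by rewrite exprn_gt0// ltr_pwDl.
  rewrite ler_pdivlMr// mul1r.
  have : `|x| <= 1 by apply: le_trans Bx; exact: norm_le_enorm.
  have := normr_ge0 x; nra.
have := integrable_weight => /(_ R n) iW.
have := integrable_lty measurableT (integrableZl measurableT (4 ^+ n) iW).
by [].
Qed.

(** In the unit ball the weight is at most e^(1-|z|), and |z|^(a-n) e^(-|z|) has radial integral
    [Gamma a] in polar coordinates. Outside, the power is at most 1 since [a <= n], and the weight
    is integrable. *)
Lemma integrable_enorm_powR (a : R) : 0 < a -> a <= n%:R ->
  leb.-integrable setT (fun z => (enorm z `^ (a - n%:R) * weight z)%:E).
Proof.
move=> a0 an.
have mp : measurable_fun setT (fun z : 'rV[R]_n => enorm z `^ (a - n%:R)).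
  exact: (measurableT_comp (@measurable_powR R _) (@measurable_enorm R n)).
have me : measurable_fun setT (fun z : 'rV[R]_n => expR (- enorm z)).
  apply: (measurableT_comp (@measurable_expR R)).
  exact: (measurableT_comp (@oppr_measurable R setT) (@measurable_enorm R n)).
have mpe : measurable_fun setT
    (fun z : 'rV[R]_n => (enorm z `^ (a - n%:R) * expR (- enorm z))%:E).
  by apply/measurable_EFinP; exact: measurable_funM.
have pe0 (z : 'rV[R]_n) : 0 <= enorm z `^ (a - n%:R) * expR (- enorm z).
  by rewrite mulr_ge0 ?powR_ge0 ?expR_ge0.
have i1 : leb.-integrable setT
    (fun z => (enorm z `^ (a - n%:R) * expR (- enorm z))%:E).
  apply/integrableP; split => //.
  under eq_integral do rewrite gee0_abs ?lee_fin//.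
  rewrite -ge0_integral_polar//.
  rewrite (eq_integral (fun=> (Gamma a)%:E)).
    rewrite integral_cst; last exact: measurable_unit_sphere.
    apply: lte_mul_pinfty; rewrite ?lee_fin ?ltW ?Gamma_gt0//.
    exact: sphere_measure_lty.
  move=> xi; rewrite inE => Sxi.
  transitivity (\int[mu]_t ((0 < t)%R%:R * (t `^ (a - 1) * expR (- (1 * t))))%:E)%E.
    apply: eq_integral => t _; rewrite -EFinM enormZ Sxi mulr1 mul1r.
    have [t0|_] := ltP 0 t; last by rewrite !mul0r.
    rewrite !mul1r gtr0_norm// mulrA; congr (_ * _)%:E.
    rewrite -powR_mulrn ?(ltW t0)// -powRD_gt0//; congr (_ `^ _).
    by rewrite -natr1; ring.
  by rewrite integral_Gamma// powR1 mulr1.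
have iW := @integrable_weight R n.
have i2 := integrableD measurableT (integrableZl measurableT (expR 1) i1) iW.
apply: (le_integrable measurableT _ _ i2).
  by apply/measurable_EFinP; apply: measurable_funM => //; exact: measurable_weight.
move=> z _ /=; rewrite lee_fin; apply: le_trans (ler_norm _).
rewrite ger0_norm ?mulr_ge0 ?powR_ge0 ?weight_ge0//.
have [z1|/ltW z1] := leP (enorm z) 1.
  apply: ler_wpDr; first exact: weight_ge0.
  rewrite mulrCA ler_wpM2l ?powR_ge0//.
  apply: le_trans (weight_le1 z) _.
  by rewrite -expRD -[X in X <= _]expR0 ler_expR subr_ge0.
apply: ler_wpDl; first by rewrite mulr_ge0 ?expR_ge0.
rewrite ler_piMl ?weight_ge0// -[X in _ <= X](powRr0 (enorm z)) ler_powR//.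
by rewrite subr_le0.
Qed.

End polar_coordinates.

(** * Affine substitutions in complex integrals *)

Section affine_cintegral.
Context {R : realType} {n : nat}.
Local Notation leb := (@lebesgue_row R n).

Lemma cintegral_affine (r : R) (a : 'rV[R]_n) (g : 'rV[R]_n -> R[i]) : r != 0 ->
  cintegrable leb setT g ->
  cintegral leb setT (fun x => g (r *: x + a)) = (`|r| ^- n)%:C * cintegral leb setT g.
Proof.
move=> r0 ig; apply: (@cintegral_change R _ _ _ _ leb leb (fun x => r *: x + a)) => //.
- exact: measurable_row_affine.
- by move=> F mF F0; exact: ge0_integral_affine.
Qed.

Lemma cintegrable_affine (r : R) (a : 'rV[R]_n) (g : 'rV[R]_n -> R[i]) : r != 0 ->
  cintegrable leb setT g -> cintegrable leb setT (fun x => g (r *: x + a)).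
Proof.
move=> r0 ig; apply: (@cintegrable_change R _ _ _ _ leb leb (fun x => r *: x + a) (`|r| ^- n)) => //.
- exact: measurable_row_affine.
- by move=> F mF F0; exact: ge0_integral_affine.
Qed.

Lemma cintegral_translate (a : 'rV[R]_n) (g : 'rV[R]_n -> R[i]) :
  cintegrable leb setT g ->
  cintegral leb setT (fun x => g (x + a)) = cintegral leb setT g.
Proof.
move=> ig; have := cintegral_affine a (oner_neq0 R) ig.
rewrite normr1 expr1n invr1 mul1r => <-.
by apply: eq_cintegral => x; rewrite scale1r.
Qed.

End affine_cintegral.

(** * Decay measured in powers of the weight *)

Section weighted_decay.
Context {R : realType} {n : nat}.
Local Notation leb := (@lebesgue_row R n).
Local Notation Re := (@complex.Re R).
Local Notation Im := (@complex.Im R).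
Local Notation normc := (@Normc.normc R).
Implicit Types (g h phi : 'rV[R]_n -> R[i]) (x y : 'rV[R]_n).

(** Size without smoothness: orders add up in products, order 1 gives integrability, and transforms
    of Schwartz functions qualify for every k. *)
Definition wdecay (k : nat) g := cmeasurable g /\
  exists2 C : R, 0 <= C & forall x, normc (g x) <= C * weight x ^+ k.

Lemma wdecayW k l g : (k <= l)%N -> wdecay l g -> wdecay k g.
Proof.
move=> kl [mg [C C0 gC]]; split => //; exists C => // x.
apply: le_trans (gC x) _; rewrite ler_wpM2l//.
by apply: ler_wiXn2l => //; [exact: weight_ge0|exact: weight_le1].
Qed.

Lemma wdecayM k l g h : wdecay k g -> wdecay l h ->
  wdecay (k + l) (fun x => g x * h x).
Proof.
move=> [mg [C C0 gC]] [mh [D D0 hD]]; split; first exact: cmeasurableM.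
exists (C * D); first exact: mulr_ge0.
move=> x; rewrite Normc.normcM exprD mulrACA.
by apply: ler_pM; rewrite ?normc_ge0.
Qed.

Lemma wdecayMl k (B : R) g h : cmeasurable g -> (forall x, normc (g x) <= B) ->
  wdecay k h -> wdecay k (fun x => g x * h x).
Proof.
move=> mg gB wh; rewrite -[k]add0n; apply: wdecayM => //; split => //.
exists B; first by apply: le_trans (gB 0); exact: normc_ge0.
by move=> x; rewrite expr0 mulr1.
Qed.

Lemma wdecayD k g h : wdecay k g -> wdecay k h -> wdecay k (fun x => g x + h x).
Proof.
move=> [mg [C C0 gC]] [mh [D D0 hD]]; split; first exact: cmeasurableD.
exists (C + D); first exact: addr_ge0.
by move=> x; rewrite (le_trans (le_normcD _ _))// mulrDl lerD.
Qed.

Lemma wdecay_integrable k g : (0 < k)%N -> wdecay k g -> cintegrable leb setT g.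
Proof.
move=> k0 /(wdecayW k0)[mg [C C0 gC]].
apply: (@cintegrable_le _ _ _ _ _ (fun x => C * weight x)) => //.
  exact: (integrableZl measurableT _ (@integrable_weight R n)).
Qed.

Lemma oneD_exprn_le (r : R) N : 0 <= r -> (1 + r) ^+ N <= 2 ^+ N * (1 + r ^+ N).
Proof.
move=> r0; have [r1|/ltW r1] := leP r 1.
  apply: (@le_trans _ _ (2 ^+ N)).
    by apply: lerXn2r; rewrite ?nnegrE ?addr_ge0//; lra.
  by rewrite ler_peMr ?exprn_ge0// lerDl exprn_ge0.
apply: (@le_trans _ _ ((2 * r) ^+ N)).
  by apply: lerXn2r; rewrite ?nnegrE ?addr_ge0 ?mulr_ge0//; lra.
by rewrite exprMn ler_wpM2l ?exprn_ge0// lerDr.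
Qed.

(** As [weight x ^+ k] is (1 + |x|)^(-2nk), it is enough to bound a and |x|^(2nk) a, by (1 + r)^N <=
    2^N (1 + r^N). *)
Lemma weightX_bound k (x : 'rV[R]_n) (a M0 M1 : R) : 0 <= a ->
  a <= M0 -> `|x| ^+ (n.*2 * k) * a <= M1 ->
  a <= 2 ^+ (n.*2 * k) * (M0 + M1) * weight x ^+ k.
Proof.
move=> a0 aM0 aM1; rewrite /weight -exprVn -exprM exprVn.
rewrite ler_pdivlMr ?exprn_gt0 ?ltr_pwDl// mulrC.
apply: (@le_trans _ _ (2 ^+ (n.*2 * k) * (1 + `|x| ^+ (n.*2 * k)) * a)).
  by rewrite ler_wpM2r// oneD_exprn_le.
by rewrite -mulrA ler_wpM2l ?exprn_ge0// mulrDl mul1r lerD.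
Qed.

Lemma schwartz_wdecay k phi : schwartz phi -> wdecay k phi.
Proof.
move=> [sphi bphi]; split.
  by split; apply: continuous_measurable_row => x; apply: differentiable_continuous;
    have [] := sphi [::] x.
have [M0 hM0] := bphi 0%N [::]; have [M1 hM1] := bphi (n.*2 * k)%N [::].
have M0x x : normc (phi x) <= M0 by have := hM0 x; rewrite expr0 mul1r.
have M1x x : `|x| ^+ (n.*2 * k) * normc (phi x) <= M1.
  apply: le_trans (hM1 x); rewrite ler_wpM2r ?normc_ge0//.
  by apply: lerXn2r; rewrite ?nnegrE ?enorm_ge0// norm_le_enorm.
exists (2 ^+ (n.*2 * k) * (M0 + M1)).
  rewrite mulr_ge0 ?exprn_ge0// addr_ge0//.
    by apply: le_trans (M0x 0); exact: normc_ge0.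
  by apply: le_trans (M1x 0); rewrite mulr_ge0 ?normc_ge0 ?exprn_ge0.
by move=> x; apply: weightX_bound; rewrite ?normc_ge0.
Qed.

Lemma schwartz_cpartial (i : 'I_n) phi : schwartz phi -> schwartz (cpartial i phi).
Proof.
move=> [sphi bphi]; split.
  by move=> a x; have := sphi (rcons a i) x; rewrite /cpartials foldr_rcons.
move=> k a; have [M hM] := bphi k (rcons a i); exists M => x.
by have := hM x; rewrite /cpartials foldr_rcons.
Qed.

End weighted_decay.

(** * Directional derivatives and difference quotients *)

Section difference_quotients.
Context {R : realType} {V : normedModType R}.
Implicit Types (f : V -> R) (x v : V).

(** A derivative is a limit along a filter, while dominated convergence is about sequences: the
    steps 1 / (j + 1) link them. *)
Lemma is_derive_seq f x v (d : R) : is_derive x v f d ->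
  (fun j : nat => j.+1%:R * (f (x + j.+1%:R^-1 *: v) - f x)) @ \oo --> d.
Proof.
move=> [dfx <-].
have := dfx; rewrite /derivable -/(derive f x v) => /cvgr_dnbhsP H.
have h0 : (forall j : nat, (j.+1%:R^-1 : R) != 0) /\ (fun j : nat => (j.+1%:R^-1 : R)) @ \oo --> (0 : R).
  by split; [move=> j; rewrite invr_eq0|exact: (@cvg_harmonic R)].
have {H} := H _ h0; apply: cvg_trans; apply: near_eq_cvg; near=> j.
by rewrite /= invrK [_ *: v + x]addrC.
Unshelve. all: by end_near. Qed.

Lemma is_derive_line f x v (t d : R) : is_derive (x + t *: v) v f d ->
  is_derive t (1 : R) (fun s : R => f (x + s *: v)) d.
Proof.
have E : (fun h : R => h^-1 *: (((fun s : R => f (x + s *: v)) \o shift t) (h *: (1 : R)) - f (x + t *: v))) =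
    (fun h : R => h^-1 *: ((f \o shift (x + t *: v)) (h *: v) - f (x + t *: v))).
  apply/funext => h /=; congr (_ *: (f _ - _)).
  by rewrite /shift/= addrCA scalerDl [h *: 1]mulr1.
move=> [dfx dE]; split.
  by rewrite /derivable E.
by rewrite -dE /derive E.
Qed.

Lemma difference_bound f (df : V -> R) x v (r B : R) : 0 < r ->
  (forall z, is_derive z v f (df z)) ->
  (forall t, 0 <= t <= r -> `|df (x + t *: v)| <= B) ->
  `|f (x + r *: v) - f x| <= B * r.
Proof.
move=> r0 fdf dB; pose F (s : R) := f (x + s *: v).
have dF (s : R) : is_derive s (1 : R) F (df (x + s *: v)) by exact: is_derive_line.
have cF : {within `[0, r], continuous F}.
  apply: derivable_within_continuous => s _; have := dF s; by case.
have [c c0r E] := MVT r0 (fun s _ => dF s) cF.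
move: E; rewrite /F scale0r addr0 subr0 => ->.
rewrite normrM (gtr0_norm r0) ler_wpM2r ?(ltW r0)//; apply: dB.
by move: c0r; rewrite in_itv/= => /andP[/ltW -> /ltW ->].
Qed.

End difference_quotients.

(** * The Fourier transform of decaying functions *)

Section fourier_transform.
Context {R : realType} {n : nat}.
Local Notation leb := (@lebesgue_row R n).
Local Notation Re := (@complex.Re R).
Local Notation Im := (@complex.Im R).
Local Notation normc := (@Normc.normc R).
Implicit Types (g h phi : 'rV[R]_n -> R[i]) (x y z a : 'rV[R]_n).

Lemma cmeasurable_character y : cmeasurable (fun x : 'rV[R]_n => cis (- dotp x y)).
Proof.
apply: cmeasurable_cis; apply: (measurableT_comp (@oppr_measurable R setT)).
by apply: measurable_dotp2 => //; exact: measurable_cst.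
Qed.

Lemma cintegrable_character g y : cintegrable leb setT g ->
  cintegrable leb setT (fun x => cis (- dotp x y) * g x).
Proof.
move=> ig; apply: (@cintegrable_le _ _ _ _ _ (normc \o g)).
- by apply: cmeasurableM; [exact: cmeasurable_character|exact: (cintegrable_measurable ig)].
- exact: cintegrable_normc.
- by move=> x; rewrite Normc.normcM normc_cis mul1r.
Qed.

Lemma cmeasurable_fourier g : cmeasurable g -> cmeasurable (fourier g).
Proof.
move=> mg; apply: (@cmeasurable_cintegral2 _ _ _ _ _ leb
  (fun z : 'rV[R]_n * 'rV[R]_n => cis (- dotp z.2 z.1) * g z.2)).
apply: cmeasurableM.
  apply: cmeasurable_cis; apply: (measurableT_comp (@oppr_measurable R setT)).
  by apply: measurable_dotp2; [exact: measurable_snd|exact: measurable_fst].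
exact: (cmeasurable_comp mg measurable_snd).
Qed.

Lemma fourier_bounded g : cintegrable leb setT g ->
  exists2 B, 0 <= B & forall y, normc (fourier g y) <= B.
Proof.
move=> ig; exists (2 * \int[leb]_(x in setT) normc (g x)).
  by rewrite mulr_ge0//; apply: Rintegral_ge0 => x _; exact: normc_ge0.
move=> y; apply: normc_cintegral_le.
- exact: (cintegrable_measurable (cintegrable_character y ig)).
- exact: (cintegrable_normc ig).
- by move=> x; rewrite Normc.normcM normc_cis mul1r.
Qed.

Lemma fourierZ (c : R[i]) g y : cintegrable leb setT g ->
  fourier (fun x => c * g x) y = c * fourier g y.
Proof.
move=> ig; rewrite /fourier -cintegralMl; last exact: cintegrable_character.
by apply: eq_cintegral => x; rewrite mulrCA.
Qed.

Lemma fourierD g h y : cintegrable leb setT g -> cintegrable leb setT h ->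
  fourier (fun x => g x + h x) y = fourier g y + fourier h y.
Proof.
move=> ig ih; rewrite /fourier -cintegralD; try exact: cintegrable_character.
by apply: eq_cintegral => x; rewrite mulrDr.
Qed.

Lemma fourier_translate g a y : cintegrable leb setT g ->
  fourier (fun x => g (x + a)) y = cis (dotp a y) * fourier g y.
Proof.
move=> ig; have ic := cintegrable_character y ig.
rewrite /fourier -(cintegral_translate a ic) -cintegralMl.
  apply: eq_cintegral => x; rewrite mulrA -cisD dotpDl; congr (cis _ * _).
  by ring.
have := cintegrable_affine a (oner_neq0 R) ic; congr cintegrable.
by apply/funext => x; rewrite scale1r.
Qed.

Let norm_delta (k : 'I_n) : `|delta_mx ord0 k : 'rV[R]_n| <= 1.
Proof.
apply: norm_leP => // j; rewrite mxE.
by case: (_ && _); rewrite ?normr0 ?normr1.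
Qed.

(** The derivative i b of [cis (t * b)] at 0, along the steps 1 / (j + 1): the limit of the
    multiplier of a difference quotient. *)
Let cis_seq (b : R) :
  (fun j : nat => j.+1%:R * (cos (j.+1%:R^-1 * b) - 1)) @ \oo --> (0 : R) /\
  (fun j : nat => j.+1%:R * sin (j.+1%:R^-1 * b)) @ \oo --> b.
Proof.
have dm : is_derive (0 : R) (1 : R) (fun t : R => t * b) b.
  by apply: is_derive_eq; rewrite /GRing.scale/= mulr0 add0r mulr1.
split.
  have d : is_derive (0 : R) (1 : R) (cos \o (fun t : R => t * b)) (- sin (0 * b) * b).
    by apply: is_derive1_comp.
  have := is_derive_seq d; rewrite mul0r sin0 oppr0 mul0r.
  apply: cvg_trans; apply: near_eq_cvg; near=> j => /=.
  by rewrite add0r mul0r cos0 [_ *: _]mulr1.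
have d : is_derive (0 : R) (1 : R) (sin \o (fun t : R => t * b)) (cos (0 * b) * b).
  by apply: is_derive1_comp.
have := is_derive_seq d; rewrite mul0r cos0 mul1r.
apply: cvg_trans; apply: near_eq_cvg; near=> j => /=.
by rewrite add0r mul0r sin0 subr0 [_ *: _]mulr1.
Unshelve. all: by end_near. Qed.

(* No integration by parts: translating by h multiplies the transform by
   cis (h y_k), and the difference quotients converge dominatedly. *)
Lemma fourier_derive (k : 'I_n) g g' y : wdecay 1 g -> wdecay 1 g' ->
  (forall x, is_derive x (delta_mx ord0 k) (Re \o g) (Re (g' x))) ->
  (forall x, is_derive x (delta_mx ord0 k) (Im \o g) (Im (g' x))) ->
  fourier g' y = (0 +i* y ord0 k) * fourier g y.
Proof.
move=> wg wg' + +; pose e : 'rV[R]_n := delta_mx ord0 k; rewrite -/e => dR dI.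
have ig := wdecay_integrable (ltn0Sn 0) wg.
have [mg _] := wg; have [mg' [C C0 gC]] := wg'.
pose q (j : nat) x := (j.+1%:R)%:C * (g (x + j.+1%:R^-1 *: e) - g x).
have mshift a : cmeasurable (fun x => g (x + a)).
  have ms : measurable_fun setT (fun x => x + a).
    by apply: measurable_row_add => //; exact: measurable_cst.
  exact: (cmeasurable_comp mg ms).
have mq j : cmeasurable (q j).
  apply: cmeasurableM; first exact: cmeasurable_cst.
  apply: (cmeasurableD (mshift _) (h := fun x => - g x)).
  have -> : (fun x => - g x) = (fun x => (-1) * g x) by apply/funext => x; rewrite mulN1r.
  by apply: cmeasurableM => //; exact: cmeasurable_cst.
have Req j x : Re (q j x) = j.+1%:R * ((Re \o g) (x + j.+1%:R^-1 *: e) - (Re \o g) x).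
  by rewrite Re_mul/= mul0r subr0 Re_add; case: (g x).
have Imq j x : Im (q j x) = j.+1%:R * ((Im \o g) (x + j.+1%:R^-1 *: e) - (Im \o g) x).
  by rewrite Im_mul/= mul0r addr0 Im_add; case: (g x).
have j_gt0 (j : nat) : 0 < (j.+1%:R^-1 : R) by rewrite invr_gt0.
(* By the mean value theorem the quotient is a derivative at a point within distance 1 of x, so
   [weight_shift] bounds it at the cost of [4 ^+ n]. *)
have bound (f df : 'rV[R]_n -> R) : (forall x, is_derive x e f (df x)) ->
    (forall x, `|df x| <= normc (g' x)) -> forall j x,
    `|j.+1%:R * (f (x + j.+1%:R^-1 *: e) - f x)| <= C * 4 ^+ n * weight x.
  move=> fdf dfg j x; rewrite normrM ger0_norm//.
  rewrite mulrC -ler_pdivlMr//; apply: difference_bound => // t /andP[t0 t1].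
  apply: le_trans (dfg _) _; apply: le_trans (gC _) _.
  rewrite expr1 -mulrA ler_wpM2l//; apply: weight_shift.
  rewrite mx_normZ ger0_norm// -[leRHS]mulr1 ler_pM//.
    by apply: le_trans t1 _; rewrite invf_le1// ler1n.
  exact: norm_delta.
have [cR cI] : (fun j => Re (fourier (q j) y)) @ \oo --> Re (fourier g' y) /\
    (fun j => Im (fourier (q j) y)) @ \oo --> Im (fourier g' y).
  apply: (@cintegral_dominated_cvg _ _ _ _ _ _ (fun x => 2 * (C * 4 ^+ n) * weight x)).
  - by move=> j; apply: cmeasurableM => //; exact: cmeasurable_character.
  - by apply: cmeasurableM => //; exact: cmeasurable_character.
  - exact: (integrableZl measurableT _ (@integrable_weight R n)).
  - move=> x; rewrite Re_mul; under eq_fun do rewrite Re_mul Req Imq.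
    apply: cvgB; apply: cvgM; try exact: cvg_cst; exact: is_derive_seq.
  - move=> x; rewrite Im_mul; under eq_fun do rewrite Im_mul Req Imq.
    apply: cvgD; apply: cvgM; try exact: cvg_cst; exact: is_derive_seq.
  - move=> j x; rewrite Normc.normcM normc_cis mul1r.
    apply: le_trans (normc_le_ReIm _) _; rewrite Req Imq -mulrA mulr2n mulrDl !mul1r.
    apply: lerD; first by apply: (bound _ _ dR) => z; exact: Re_le_normc.
    by apply: (bound _ _ dI) => z; exact: Im_le_normc.
have E j : fourier (q j) y =
    (j.+1%:R * (cos (j.+1%:R^-1 * y ord0 k) - 1) +i*
     (j.+1%:R * sin (j.+1%:R^-1 * y ord0 k))) * fourier g y.
  have isg : cintegrable leb setT (fun x => g (x + j.+1%:R^-1 *: e)).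
    have := cintegrable_affine (j.+1%:R^-1 *: e) (oner_neq0 R) ig; congr cintegrable.
    by apply/funext => x; rewrite scale1r.
  have img := cintegrableMl (-1) ig.
  have -> : q j = fun x => (j.+1%:R)%:C * (g (x + j.+1%:R^-1 *: e) + (-1) * g x).
    by apply/funext => x; rewrite /q mulN1r.
  rewrite fourierZ; last exact: cintegrableD.
  rewrite fourierD// fourierZ// fourier_translate// dotpZl dotp_delta.
  rewrite -mulrDl mulrA; congr (_ * _).
  by apply: complex_eq => /=; rewrite !(mul0r, mulr0, subr0, addr0).
have [c0 s0] := cis_seq (y ord0 k).
have cR' : (fun j => Re (fourier (q j) y)) @ \oo -->
    Re ((0 +i* y ord0 k) * fourier g y).
  under eq_fun do rewrite E Re_mul; rewrite Re_mul.
  by apply: cvgB; apply: cvgM => //; exact: cvg_cst.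
have cI' : (fun j => Im (fourier (q j) y)) @ \oo -->
    Im ((0 +i* y ord0 k) * fourier g y).
  under eq_fun do rewrite E Im_mul; rewrite Im_mul.
  by apply: cvgD; apply: cvgM => //; exact: cvg_cst.
apply: complex_eq; first exact: (cvg_unique (@Rhausdorff R) cR cR').
exact: (cvg_unique (@Rhausdorff R) cI cI').
Qed.

Lemma fourier_cpartial (k : 'I_n) phi y : schwartz phi ->
  fourier (cpartial k phi) y = (0 +i* y ord0 k) * fourier phi y.
Proof.
move=> sphi; apply: fourier_derive.
- exact: schwartz_wdecay.
- exact/schwartz_wdecay/schwartz_cpartial.
- move=> x; apply: DeriveDef => //.
  by apply: diff_derivable; have [] := sphi.1 [::] x.
- move=> x; apply: DeriveDef => //.
  by apply: diff_derivable; have [] := sphi.1 [::] x.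
Qed.

(** The N-th power of y_i times the transform is, up to a power of i, the transform of an N-fold
    derivative, hence bounded; and the sup norm of a nonzero y is attained at one of its
    coordinates. *)
Lemma fourier_wdecay k phi : schwartz phi -> wdecay k (fourier phi).
Proof.
move=> sphi; split.
  by apply: cmeasurable_fourier; have [] := schwartz_wdecay 0 sphi.
have it N (i : 'I_n) : exists2 M, 0 <= M & forall y,
    `|y ord0 i| ^+ N * normc (fourier phi y) <= M.
  suff : forall psi, schwartz psi -> exists2 M, 0 <= M & forall y,
      `|y ord0 i| ^+ N * normc (fourier psi y) <= M by apply.
  elim: N => [|N IH] psi spsi.
    have [B B0 hB] := fourier_bounded (wdecay_integrable (ltn0Sn 0) (schwartz_wdecay 1 spsi)).
    by exists B => // y; rewrite mul1r.
  have [M M0 hM] := IH _ (schwartz_cpartial i spsi).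
  exists M => // y; have := hM y; rewrite fourier_cpartial// Normc.normcM.
  rewrite normc_ReIm/= expr0n/= add0r sqrtr_sqr mulrA -exprSr.
  by apply.
have [B B0 hB] := fourier_bounded (wdecay_integrable (ltn0Sn 0) (schwartz_wdecay 1 sphi)).
pose N := (n.*2 * k)%N.
have /choice[M hM] : forall i, exists M, 0 <= M /\ forall y,
    `|y ord0 i| ^+ N * normc (fourier phi y) <= M.
  by move=> i; have [M M0 hM] := it N i; exists M.
have S0 : 0 <= \sum_i M i by apply: sumr_ge0 => i _; exact: (hM i).1.
(* The innermost B is for y = 0, treated apart, where [0 ^+ N] is 1 if N is 0; for other y a single
   [M i] suffices. *)
exists (2 ^+ N * (B + (B + \sum_i M i))); first by rewrite mulr_ge0 ?exprn_ge0// !addr_ge0.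
move=> y; apply: weightX_bound; rewrite ?normc_ge0//.
have [->|y0] := eqVneq y 0.
  rewrite normr0 -/N; apply: (@le_trans _ _ B); last by rewrite lerDl.
  apply: le_trans (hB 0); rewrite ler_piMl ?normc_ge0//.
  by rewrite expr0n; case: eqP.
have [[i0 i] yE] : exists ij : 'I_1 * 'I_n, `|y| = `|y ij.1 ij.2|.
  by apply: mx_norm_neq0; rewrite -[mx_norm y]/(`|y|) normr_eq0.
rewrite yE /= (ord1 i0) -/N; apply: le_trans ((hM i).2 y) _.
rewrite (bigD1 i)//= addrCA lerDl addr_ge0//.
by apply: sumr_ge0 => j _; exact: (hM j).1.
Qed.

End fourier_transform.

(** * Gaussians and their Fourier transforms *)

Section gaussian.
Context {R : realType} {n : nat}.
Local Notation leb := (@lebesgue_row R n).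
Local Notation Re := (@complex.Re R).
Local Notation Im := (@complex.Im R).
Local Notation normc := (@Normc.normc R).
Implicit Types (x y z : 'rV[R]_n) (l : R).

Lemma realC_neq0 (a : R) : a != 0 -> a%:C != 0 :> R[i].
Proof. by apply: contraNN => /eqP[->]. Qed.

Definition gauss l z : R := expR (- (l * dotp z z)).

Lemma gauss_ge0 l z : 0 <= gauss l z.
Proof. exact: expR_ge0. Qed.

Lemma measurable_gauss l : measurable_fun setT (gauss l : 'rV[R]_n -> R).
Proof.
apply: (measurableT_comp (@measurable_expRMN R l)).
by apply: measurable_dotp2; exact: measurable_id.
Qed.

(** From (l r^2)^(N+1) / (N+1)! <= e^(l r^2) and r^N <= 1 + r^(2N+2), whose two terms serve r <= 1
    and r >= 1. *)
Lemma exprM_gauss_le N l (r : R) : 0 < l -> 0 <= r ->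
  r ^+ N * expR (- (l * r ^+ 2)) <= 1 + N.+1`!%:R / l ^+ N.+1.
Proof.
move=> l0 r0; have lr : 0 <= l * r ^+ 2 by rewrite mulr_ge0 ?exprn_ge0 ?(ltW l0).
have := expR_ge1Dxn N lr; set X := expR _ => hX.
have X1 : 1 <= X by rewrite -[X in X <= _]expR0 ler_expR.
rewrite expRN -/X ler_pdivrMr ?(lt_le_trans _ X1)//.
have h : r ^+ (2 * N.+1) <= N.+1`!%:R / l ^+ N.+1 * X.
  rewrite mulrAC ler_pdivlMr ?exprn_gt0// exprM -exprMn (mulrC _ l).
  rewrite -ler_pdivrMl ?ltr0n ?fact_gt0// [leLHS]mulrC.
  by apply: le_trans hX; rewrite lerDr.
rewrite mulrDl mul1r; apply: (@le_trans _ _ (1 + r ^+ (2 * N.+1))); last exact: lerD.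
have [r1|/ltW r1] := leP r 1.
  by apply: (@le_trans _ _ 1); [exact: exprn_ile1|rewrite lerDl exprn_ge0].
apply: (@le_trans _ _ (r ^+ (2 * N.+1))); last by rewrite lerDr.
by apply: ler_weXn2l => //; rewrite mul2n -addnn (leq_trans (leqnSn N))// leq_addr.
Qed.

Lemma gauss_wdecay k l : 0 < l -> wdecay k (fun z => (gauss l z)%:C).
Proof.
move=> l0; split; first by apply: cmeasurable_real; exact: measurable_gauss.
pose N := (n.*2 * k)%N.
exists (2 ^+ N * (1 + (1 + N.+1`!%:R / l ^+ N.+1))).
  by rewrite mulr_ge0 ?exprn_ge0// !addr_ge0// divr_ge0// exprn_ge0// ltW.
move=> z; rewrite normc_real ger0_norm ?gauss_ge0//.
apply: weightX_bound; rewrite ?gauss_ge0//.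
  rewrite /gauss -[X in _ <= X]expR0 ler_expR oppr_le0 mulr_ge0 ?(ltW l0)//.
  exact: dotp_ge0.
apply: le_trans (exprM_gauss_le N l0 (normr_ge0 z)).
rewrite ler_wpM2l ?exprn_ge0// /gauss ler_expR lerN2 ler_wpM2l ?(ltW l0)//.
rewrite -sqr_enorm; apply: lerXn2r; rewrite ?nnegrE ?enorm_ge0//.
exact: norm_le_enorm.
Qed.

(** A coordinate costs one order because |z_i| <= (1 + |z|)^(2n); the index i itself guarantees n >
    0. *)
Lemma coor_wdecay k (i : 'I_n) (g : 'rV[R]_n -> R[i]) : wdecay k.+1 g ->
  wdecay k (fun z => (z ord0 i)%:C * g z).
Proof.
move=> [mg [C C0 gC]]; split.
  apply: cmeasurableM => //; apply: cmeasurable_real.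
  exact: (@measurable_row_coor R n i).
exists C => // z; rewrite Normc.normcM normc_real.
apply: (@le_trans _ _ (`|z ord0 i| * (C * weight z ^+ k.+1))).
  by rewrite ler_wpM2l.
rewrite mulrCA ler_wpM2l// exprS mulrA ler_piMl ?exprn_ge0 ?weight_ge0//.
rewrite /weight; have p : 0 < 1 + `|z| by rewrite ltr_pwDl.
rewrite ler_pdivrMr ?exprn_gt0// mul1r.
apply: (le_trans (coor_le_norm z i)); apply: (@le_trans _ _ (1 + `|z|)).
  by rewrite lerDr.
rewrite -[leLHS]expr1; apply: ler_weXn2l; first by rewrite lerDl.
by rewrite double_gt0; exact: leq_ltn_trans (ltn_ord i).
Qed.

Lemma is_derive_line0 (f : 'rV[R]_n -> R) x v (d : R) :
  is_derive (0 : R) (1 : R) (fun s : R => f (x + s *: v)) d -> is_derive x v f d.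
Proof.
have E : (fun h : R => h^-1 *: (((fun s : R => f (x + s *: v)) \o shift 0) (h *: (1 : R)) - f (x + 0 *: v))) =
    (fun h : R => h^-1 *: ((f \o shift x) (h *: v) - f x)).
  apply/funext => h /=; rewrite scale0r [x + 0]addr0; congr (_ *: (f _ - _)).
  by rewrite /shift/= ?addr0 [h%:A]mulr1 addrC.
move=> [dfx dE]; split.
  by move: dfx; rewrite /derivable E.
by rewrite -dE /derive E.
Qed.

Let gauss_line l z (k : 'I_n) (s : R) :
  gauss l (z + s *: delta_mx ord0 k) =
  gauss l z * expR (- (l * (s * (2 * z ord0 k + s)))).
Proof.
rewrite /gauss -expRD; congr expR; rewrite !dotpDl dotpC (dotpC (s *: _)) !dotpDl.
by rewrite !dotpZl (dotpC z) dotpZl !dotp_delta !mxE !eqxx/=; ring.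
Qed.

Let is_derive_expline l (b : R) :
  is_derive (0 : R) (1 : R) (fun s : R => expR (- (l * (s * (2 * b + s))))) (- (2 * l * b)).
Proof.
have d : is_derive (0 : R) (1 : R) (fun s : R => - (l * (s * (2 * b + s)))) (- (2 * l * b)).
  by apply: is_derive_eq; rewrite /GRing.scale/=; ring.
have := @is_derive1_comp _ expR (fun s : R => - (l * (s * (2 * b + s)))) 0 _ _ (is_derive_expR _) d.
by rewrite mul0r mulr0 oppr0 expR0 mul1r.
Qed.

Lemma is_derive_gauss l z (k : 'I_n) :
  is_derive z (delta_mx ord0 k) (gauss l) (- (2 * l) * (z ord0 k * gauss l z)).
Proof.
apply: is_derive_line0.
have -> : (fun s : R => gauss l (z + s *: delta_mx ord0 k)) =
    (fun s => gauss l z * expR (- (l * (s * (2 * z ord0 k + s))))).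
  by apply/funext => s; exact: gauss_line.
have d := is_derive_expline l (z ord0 k).
by apply: is_derive_eq; rewrite /GRing.scale/=; ring.
Qed.

Lemma is_derive_coor_gauss l z (i k : 'I_n) :
  is_derive z (delta_mx ord0 k) (fun z => z ord0 i * gauss l z)
    ((i == k)%:R * gauss l z - (2 * l) * (z ord0 k * (z ord0 i * gauss l z))).
Proof.
apply: is_derive_line0.
have -> : (fun s : R => (z + s *: delta_mx ord0 k) ord0 i * gauss l (z + s *: delta_mx ord0 k)) =
    (fun s => (z ord0 i + s * (i == k)%:R) *
       (gauss l z * expR (- (l * (s * (2 * z ord0 k + s)))))).
  by apply/funext => s; rewrite gauss_line !mxE eqxx.
have d := is_derive_expline l (z ord0 k).
by apply: is_derive_eq; rewrite /GRing.scale/= ?(mul0r, mulr0, oppr0, expR0); ring.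
Qed.

Let gaussC l z : R[i] := (gauss l z)%:C.

(** [fourier_derive] read backwards: differentiation multiplies the Gaussian by -2 l z_k and its
    transform by i y_k. The second moments below come from differentiating z_i times the Gaussian in
    the same way. *)
Let fourier_coor_gauss0 l (k : 'I_n) y : 0 < l ->
  fourier (fun z => (z ord0 k)%:C * gaussC l z) y =
  (0 -i* (y ord0 k / (2 * l))) * fourier (gaussC l) y.
Proof.
move=> l0; have w1 := coor_wdecay k (gauss_wdecay 2 l0).
have := @fourier_derive _ _ k (gaussC l)
  (fun z => (- (2 * l))%:C * ((z ord0 k)%:C * gaussC l z)) y (gauss_wdecay 1 l0).
move=> /(_ _ _ _)/wrap[|x|x|].
- apply: (@wdecayMl _ _ _ `|- (2 * l)|) => //; first exact: cmeasurable_cst.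
  by move=> x; rewrite normc_real.
- rewrite !Re_mul/= !(mul0r, mulr0, subr0, addr0).
  exact: is_derive_gauss.
- rewrite !Im_mul !Re_mul/= !(mul0r, mulr0, subr0, addr0).
  exact: is_derive_cst.
rewrite fourierZ; last exact: (wdecay_integrable _ w1).
move=> E.
have l2 : (- (2 * l))%:C != 0 :> R[i].
  by apply: realC_neq0; rewrite oppr_eq0 mulf_neq0// gt_eqF.
apply: (mulfI l2); rewrite E mulrA; congr (_ * _).
by apply: complex_eq => /=; field; rewrite gt_eqF.
Qed.

Let fourier_coor2_gauss0 l (i k : 'I_n) y : 0 < l ->
  fourier (fun z => (z ord0 k)%:C * ((z ord0 i)%:C * gaussC l z)) y =
  ((i == k)%:R / (2 * l) - y ord0 i * y ord0 k / (4 * l ^+ 2))%:C * fourier (gaussC l) y.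
Proof.
move=> l0; have w2 := coor_wdecay k (coor_wdecay i (gauss_wdecay 3 l0)).
have w1 := coor_wdecay i (gauss_wdecay 2 l0).
have w0 := gauss_wdecay 1 l0.
have wa : wdecay 1 (fun z => (i == k)%:R%:C * gaussC l z).
  apply: (@wdecayMl _ _ _ `|(i == k)%:R : R|) => //; first exact: cmeasurable_cst.
  by move=> x; rewrite normc_real.
have wb : wdecay 1 (fun z => (- (2 * l))%:C * ((z ord0 k)%:C * ((z ord0 i)%:C * gaussC l z))).
  apply: (@wdecayMl _ _ _ `|- (2 * l)|) => //; first exact: cmeasurable_cst.
  by move=> x; rewrite normc_real.
have := @fourier_derive _ _ k (fun z => (z ord0 i)%:C * gaussC l z)
  (fun z => (i == k)%:R%:C * gaussC l z +
     (- (2 * l))%:C * ((z ord0 k)%:C * ((z ord0 i)%:C * gaussC l z))) y w1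
  (wdecayD wa wb).
move=> /(_ _ _)/wrap[x|x|].
- rewrite Re_add !Re_mul !Im_mul /= !(mul0r, mulr0, subr0, addr0).
  rewrite (_ : _ \o _ = fun z => z ord0 i * gauss l z).
    by rewrite mulNr; exact: is_derive_coor_gauss.
  by apply/funext => z; rewrite /comp Re_mul/= mul0r subr0.
- rewrite Im_add !Im_mul !Re_mul/= !(mul0r, mulr0, subr0, addr0).
  rewrite (_ : _ \o _ = cst 0); first exact: is_derive_cst.
  by apply/funext => z; rewrite /comp Im_mul/= mul0r mulr0 addr0.
have i0 := wdecay_integrable (ltn0Sn 0) w0.
have i2 := wdecay_integrable (ltn0Sn 0) w2.
rewrite fourierD; last 2 first.
- exact: (wdecay_integrable _ wa).
- exact: (wdecay_integrable _ wb).
rewrite !fourierZ// fourier_coor_gauss0//.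
set F := fourier (gaussC l) y; set F2 := fourier _ y; set c := (i == k)%:R%:C => E.
have l2 : (- (2 * l))%:C != 0 :> R[i].
  by apply: realC_neq0; rewrite oppr_eq0 mulf_neq0// gt_eqF.
apply: (mulfI l2); rewrite -(addKr (c * F) ((- (2 * l))%:C * F2)) E.
rewrite !mulrA -mulNr -mulrDl; congr (_ * _).
by apply: complex_eq => /=; field; rewrite gt_eqF.
Qed.

(* The transform of a Gaussian along the ray t |-> t y solves u' = - a t u. *)
Let ode_gauss (u : R -> R) (a : R) :
  (forall t, is_derive t (1 : R) u (- (a * t) * u t)) ->
  forall t, u t = u 0 * expR (- (a * t ^+ 2 / 2)).
Proof.
move=> du t.
pose v (s : R) := u s * expR (a / 2 * (s * s)).
have dv (s : R) : is_derive s (1 : R) v 0.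
  have d : is_derive s (1 : R) (fun s : R => a / 2 * (s * s)) (a * s).
    by apply: is_derive_eq; rewrite /GRing.scale/=; field.
  have de := @is_derive1_comp _ expR (fun s : R => a / 2 * (s * s)) s _ _ (is_derive_expR _) d.
  have de' : is_derive s (1 : R) (fun s : R => expR (a / 2 * (s * s)))
    (expR (a / 2 * (s * s)) * (a * s)) := de.
  have dus := du s.
  by apply: is_derive_eq; rewrite /GRing.scale/=; ring.
have E : v t = v 0 := is_derive_0_is_cst t 0 dv.
have := E; rewrite /v !mulr0 expR0 mulr1 => <-.
rewrite -mulrA -expRD (_ : _ + _ = 0) ?expR0 ?mulr1//.
by field.
Qed.

Lemma integral_gauss l : 0 < l ->
  \int[leb]_(z in setT) gauss l z = Num.sqrt (pi / l) ^+ n.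
Proof.
move=> l0; pose g (t : R) := expR (- (l * t ^+ 2)).
have sl0 : 0 < Num.sqrt l by rewrite sqrtr_gt0.
have gE : (\int[@lebesgue_measure R]_t (g t)%:E = (Num.sqrt (pi / l))%:E)%E.
  have := @ge0_integral_affine1 R (Num.sqrt l) 0 (fun t => (gauss_fun t)%:E) (lt0r_neq0 sl0).
  move=> /(_ _ _)/wrap[|t|]; [|by rewrite lee_fin gauss_fun_ge0|].
    by apply/measurable_EFinP; exact: measurable_gauss_fun.
  rewrite integralT_gauss gtr0_norm// -EFinM => E.
  rewrite sqrtrM ?pi_ge0// sqrtrV ?(ltW l0)// mulrC -E.
  apply: eq_integral => t _; rewrite /g /gauss_fun addr0 exprMn sqr_sqrtr//.
  exact: ltW.
have mg : measurable_fun setT (g : measurableTypeR R -> R).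
  apply: (measurableT_comp (@measurable_expR R)).
  apply: (measurableT_comp (@oppr_measurable R setT)).
  by apply: measurable_funM => //; exact: measurable_funX.
have := integral_row_prod n mg (fun t => expR_ge0 _) gE => E.
apply: EFin_inj; rewrite -E /Rintegral.
have -> : (\int[leb]_z (gauss l z)%:E =
    \int[leb]_x (\prod_(k < n) g (x ord0 k))%:E)%E.
  apply: eq_integral => z _; congr EFin; rewrite /g -expR_sum /gauss; congr expR.
  by rewrite /dotp mulr_sumr -sumrN; apply: eq_bigr => k _; rewrite expr2.
by rewrite E.
Qed.

Let gauss_cos l y t := \int[leb]_(z in setT) (gauss l z * cos (t * dotp z y)).
Let gauss_sin l y t := \int[leb]_(z in setT) (gauss l z * - sin (t * dotp z y)).

Let dotp_gauss l y z : R[i] := (dotp z y)%:C * gaussC l z.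

Let dotp_gaussE l y z :
  dotp_gauss l y z = \sum_k (y ord0 k)%:C * ((z ord0 k)%:C * gaussC l z).
Proof.
rewrite /dotp_gauss /dotp; under [RHS]eq_bigr do rewrite mulrA.
rewrite -mulr_suml; congr (_ * _).
apply: complex_eq; rewrite ?Re_sum ?Im_sum/=.
  by apply: eq_bigr => k _; rewrite mul0r subr0 mulrC.
by rewrite big1// => k _; rewrite mul0r mulr0 addr0.
Qed.

Let cintegrable_coor_gauss l (k : 'I_n) : 0 < l ->
  cintegrable leb setT (fun z => (z ord0 k)%:C * gaussC l z).
Proof. by move=> l0; exact: (wdecay_integrable (ltn0Sn 0) (coor_wdecay k (gauss_wdecay 2 l0))). Qed.

Let cintegrable_dotp_gauss l y : 0 < l -> cintegrable leb setT (dotp_gauss l y).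
Proof.
move=> l0; rewrite (_ : dotp_gauss l y = fun z => \sum_k (y ord0 k)%:C * ((z ord0 k)%:C * gaussC l z)).
  by apply: cintegrable_sum => k; apply: cintegrableMl; exact: cintegrable_coor_gauss.
by apply/funext => z; exact: dotp_gaussE.
Qed.

(** Differentiating the transform of a Gaussian along t |-> t y inserts the factor -i <z, y>. The
    moment formulas, summed against y, make the inserted integral a multiple of the transform: this
    is the source of the differential equation. *)
Let fourier_dotp_gauss l y t : 0 < l ->
  fourier (dotp_gauss l y) (t *: y) =
  (0 -i* (dotp y y / (2 * l) * t)) * fourier (gaussC l) (t *: y).
Proof.
move=> l0; rewrite {1}/fourier.
under eq_cintegral do rewrite dotp_gaussE mulr_sumr.
rewrite cintegral_sum => [|k]; last first.
  by apply: cintegrable_character; apply: cintegrableMl; exact: cintegrable_coor_gauss.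
transitivity (\sum_k ((y ord0 k)%:C * (0 -i* ((t *: y) ord0 k / (2 * l)))) * fourier (gaussC l) (t *: y)).
  apply: eq_bigr => k _; rewrite -mulrA -fourier_coor_gauss0// -fourierZ//.
  exact: cintegrable_coor_gauss.
rewrite -mulr_suml; congr (_ * _); apply: complex_eq; rewrite ?Re_sum ?Im_sum/=.
  by rewrite big1// => k _; rewrite mul0r mulr0 subr0.
rewrite /dotp mulr_suml mulr_suml -sumrN; apply: eq_bigr => k _.
by rewrite mul0r addr0 mxE; ring.
Qed.

(** Differentiation under the integral sign, for h = cos and h = - sin; |<z, y>| times the Gaussian
    dominates for all values of the parameter. *)
Let is_derive_gauss_trig (h h' : R -> R) l y t : 0 < l ->
  measurable_fun setT (h : measurableTypeR R -> R) ->
  (forall s, is_derive s (1 : R) h (h' s)) ->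
  (forall s, `|h s| <= 1) -> (forall s, `|h' s| <= 1) ->
  is_derive t (1 : R) (fun s : R => \int[leb]_(z in setT) (gauss l z * h (s * dotp z y)))
    (\int[leb]_(z in setT) (dotp z y * gauss l z * h' (t * dotp z y))).
Proof.
move=> l0 mh dh h1 h'1.
pose f (s : R) z := gauss l z * h (s * dotp z y).
have df s z : is_derive s (1 : R) (f ^~ z) (dotp z y * gauss l z * h' (s * dotp z y)).
  have dm : is_derive s (1 : R) (fun s : R => s * dotp z y) (dotp z y).
    by apply: is_derive_eq; rewrite /GRing.scale/= mulr0 add0r mulr1.
  have dc : is_derive s (1 : R) (fun s : R => h (s * dotp z y)) (h' (s * dotp z y) * dotp z y).
    by apply: (@is_derive1_comp _ h).
  by rewrite /f; apply: is_derive_eq; rewrite /GRing.scale/=; ring.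
have mf s : measurable_fun setT (f s).
  apply: measurable_funM; first exact: measurable_gauss.
  apply: (measurableT_comp mh); apply: measurable_funM; first exact: measurable_cst.
  by apply: measurable_dotp2; [exact: measurable_id|exact: measurable_cst].
have ig := wdecay_integrable (ltn0Sn 0) (gauss_wdecay 1 l0).
have intf s : leb.-integrable setT (EFin \o f s).
  apply: (le_integrable measurableT _ _ ig.1); first exact/measurable_EFinP.
  move=> z _ /=; rewrite lee_fin normrM ler_piMr//.
have intG := cintegrable_normc (cintegrable_dotp_gauss y l0).
have dE s z : partial1of2 f s z = dotp z y * gauss l z * h' (s * dotp z y).
  by rewrite partial1of2E; case: (df s z).
have tI : `]t - 1, t + 1[%classic t by rewrite /= in_itv/= ltrBlDr ltrDl ltr01.
have f1 (x : R) z : `]t - 1, t + 1[%classic x -> setT z -> derivable (f ^~ z) x 1.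
  by move=> _ _; case: (df x z).
have fb (x : R) z : `]t - 1, t + 1[%classic x -> setT z ->
    `|partial1of2 f x z| <= (normc \o dotp_gauss l y) z.
  move=> _ _; rewrite dE /comp Normc.normcM !normc_real !normrM ler_piMr//.
have G0 z : 0 <= (normc \o dotp_gauss l y) z by exact: normc_ge0.
split.
  have := @derivable_under_integral _ _ _ leb f _ measurableT _ _ _ tI (fun s _ => intf s) f1 _ G0 intG fb.
  exact.
have := @differentiation_under_integral _ _ _ leb f _ measurableT _ _ _ tI (fun s _ => intf s) f1 _ G0 intG fb.
rewrite derive1E => ->; apply: eq_Rintegral => z _; exact: dE.
Qed.

Let fourier_gaussE l y t :
  fourier (gaussC l) (t *: y) = gauss_cos l y t +i* gauss_sin l y t.
Proof.
apply: complex_eq; rewrite /fourier /cintegral /=; apply: eq_Rintegral => z _;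
  rewrite (dotpC z) dotpZl dotpC.
  by rewrite mulr0 subr0 cosN mulrC.
by rewrite mulr0 add0r sinN mulrC.
Qed.

Let fourier_dotp_gaussE l y t : 0 < l ->
  fourier (dotp_gauss l y) (t *: y) =
  (- \int[leb]_(z in setT) (dotp z y * gauss l z * - cos (t * dotp z y))) +i*
  \int[leb]_(z in setT) (dotp z y * gauss l z * - sin (t * dotp z y)).
Proof.
move=> l0; have ii := cintegrable_character (t *: y) (cintegrable_dotp_gauss y l0).
apply: complex_eq; rewrite /fourier /cintegral [LHS]/=.
  rewrite [RHS]/= -[LHS]opprK; congr (- _); rewrite -mulN1r -RintegralZl//; last exact: ii.1.
  apply: eq_Rintegral => z _; rewrite (dotpC z) dotpZl dotpC.
  by rewrite cosN; ring.
apply: eq_Rintegral => z _; rewrite (dotpC z) dotpZl dotpC.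
by rewrite sinN; ring.
Qed.

Lemma fourier_gauss l y : 0 < l ->
  fourier (fun z => (gauss l z)%:C) y =
  (Num.sqrt (pi / l) ^+ n * expR (- (dotp y y / (4 * l))))%:C.
Proof.
move=> l0; pose a := dotp y y / (2 * l).
have ES t := fourier_dotp_gauss y t l0.
have dc t : is_derive t (1 : R) (gauss_cos l y) (- (a * t) * gauss_cos l y t).
  have := @is_derive_gauss_trig cos (fun s => - sin s) l y t l0.
  move=> /(_ _ _ _ _)/wrap[|s|s|].
  - exact: continuous_measurable_fun (@continuous_cos R).
  - exact: cos_max.
  - by rewrite normrN; exact: sin_max.
  (* The imaginary parts of the two expressions for the transform of [dotp_gauss] rewrite the
     derivative as - a t u; for the sine the real parts do. *)
  have := ES t; rewrite fourier_dotp_gaussE// fourier_gaussE => -[_ ->].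
  by rewrite mul0r add0r.
have ds t : is_derive t (1 : R) (gauss_sin l y) (- (a * t) * gauss_sin l y t).
  have := @is_derive_gauss_trig (fun s => - sin s) (fun s => - cos s) l y t l0.
  move=> /(_ _ _ _ _)/wrap[|s|s|].
  - apply: (measurableT_comp (@oppr_measurable R setT)).
    exact: continuous_measurable_fun (@continuous_sin R).
  - by rewrite normrN; exact: sin_max.
  - by rewrite normrN; exact: cos_max.
  have := ES t; rewrite fourier_dotp_gaussE// fourier_gaussE => -[/eqP + _].
  by rewrite eqr_oppLR mul0r sub0r opprK => /eqP ->; rewrite mulNr.
have c0 : gauss_cos l y 0 = Num.sqrt (pi / l) ^+ n.
  rewrite -integral_gauss//; apply: eq_Rintegral => z _.
  by rewrite mul0r cos0 mulr1.
have s0 : gauss_sin l y 0 = 0.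
  rewrite /gauss_sin /Rintegral -[RHS]/(fine 0) -[in RHS](@integral0 _ _ R leb setT).
  by congr fine; apply: eq_integral => z _; rewrite mul0r sin0 oppr0 mulr0.
rewrite -[y in LHS]scale1r fourier_gaussE.
apply: complex_eq => /=; last by rewrite (ode_gauss ds) s0 mul0r.
rewrite (ode_gauss dc) c0; congr (_ * expR (- _)).
by rewrite /a expr1n; field; rewrite gt_eqF.
Qed.

Lemma fourier_coor_gauss l (j : 'I_n) y : 0 < l ->
  fourier (fun z => (z ord0 j)%:C * (gauss l z)%:C) y =
  (0 -i* (y ord0 j / (2 * l))) *
  (Num.sqrt (pi / l) ^+ n * expR (- (dotp y y / (4 * l))))%:C.
Proof. by move=> l0; rewrite fourier_coor_gauss0// fourier_gauss. Qed.

Lemma fourier_coor2_gauss l (i j : 'I_n) y : 0 < l ->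
  fourier (fun z => (z ord0 i)%:C * ((z ord0 j)%:C * (gauss l z)%:C)) y =
  ((j == i)%:R / (2 * l) - y ord0 j * y ord0 i / (4 * l ^+ 2))%:C *
  (Num.sqrt (pi / l) ^+ n * expR (- (dotp y y / (4 * l))))%:C.
Proof. by move=> l0; rewrite fourier_coor2_gauss0// fourier_gauss. Qed.

End gaussian.

(** * Fourier inversion by Gaussian regularization *)

Section inversion.
Context {R : realType} {n : nat}.
Local Notation leb := (@lebesgue_row R n).
Local Notation Re := (@complex.Re R).
Local Notation Im := (@complex.Im R).
Local Notation normc := (@Normc.normc R).
Implicit Types (g h phi f : 'rV[R]_n -> R[i]) (x y z w u : 'rV[R]_n).

Lemma dotpNl x y : dotp (- x) y = - dotp x y.
Proof. by rewrite /dotp -sumrN; apply: eq_bigr => k _; rewrite mxE mulNr. Qed.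

Lemma dotpNr x y : dotp x (- y) = - dotp x y.
Proof. by rewrite dotpC dotpNl dotpC. Qed.

Lemma dotpDr x y z : dotp x (y + z) = dotp x y + dotp x z.
Proof. by rewrite dotpC dotpDl !(dotpC x). Qed.

Lemma cmeasurable_character2 : cmeasurable
  (fun p : 'rV[R]_n * 'rV[R]_n => cis (- dotp p.1 p.2)).
Proof.
apply: cmeasurable_cis; apply: (measurableT_comp (@oppr_measurable R setT)).
by apply: measurable_dotp2; [exact: measurable_fst|exact: measurable_snd].
Qed.

Lemma fourier_swap g h : cintegrable leb setT g -> cintegrable leb setT h ->
  cintegral leb setT (fun x => fourier g x * h x) =
  cintegral leb setT (fun x => g x * fourier h x).
Proof.
move=> ig ih; have mg := cintegrable_measurable ig; have mh := cintegrable_measurable ih.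
pose G (p : 'rV[R]_n * 'rV[R]_n) := cis (- dotp p.1 p.2) * (h p.1 * g p.2).
have mG : cmeasurable G.
  apply: cmeasurableM; first exact: cmeasurable_character2.
  by apply: cmeasurableM;
    [exact: (cmeasurable_comp mh measurable_fst)|exact: (cmeasurable_comp mg measurable_snd)].
have iG : cintegrable (leb \x leb)%E setT G.
  apply: (cintegrable_prod mG (cintegrable_normc ih) (cintegrable_normc ig)) => x y.
  by rewrite !Normc.normcM normc_cis mul1r.
transitivity (cintegral leb setT (fun x => cintegral leb setT (fun y => G (x, y)))).
  apply: eq_cintegral => x; rewrite mulrC /fourier -cintegralMl.
    by apply: eq_cintegral => y; rewrite /G/= dotpC mulrCA.
  exact: cintegrable_character.
rewrite cintegral_fubini//; apply: eq_cintegral => y; rewrite /fourier -cintegralMl.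
  by apply: eq_cintegral => x; rewrite /G/= mulrA mulrC mulrA.
exact: cintegrable_character.
Qed.

Lemma fourier_modulate g w y :
  fourier (fun x => cis (dotp x w) * g x) y = fourier g (y - w).
Proof.
apply: eq_cintegral => x; rewrite mulrA -cisD; congr (cis _ * _).
by rewrite dotpDr dotpNr; ring.
Qed.

Lemma fourier_reflect g y : cintegrable leb setT g ->
  fourier (fun x => g (- x)) y = fourier g (- y).
Proof.
move=> ig; rewrite /fourier.
have := @cintegral_affine _ _ (-1) 0 (fun x => cis (- dotp x (- y)) * g x).
move=> /(_ _ _)/wrap[||E].
- by rewrite oppr_eq0 oner_eq0.
- exact: cintegrable_character.
rewrite normrN1 expr1n invr1 mul1r in E; rewrite -E.
apply: eq_cintegral => x; rewrite addr0 scaleN1r dotpNl dotpNr opprK.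
by [].
Qed.

Lemma fourier_invE phi x :
  fourier_inv phi x = ((2 * pi) ^- n)%:C * fourier phi (- x).
Proof.
congr (_ * _); apply: eq_cintegral => y; congr (cis _ * _).
by rewrite dotpNr opprK dotpC.
Qed.

Lemma cmeasurable_fourier_inv phi : cmeasurable phi -> cmeasurable (fourier_inv phi).
Proof.
move=> mp.
rewrite (_ : fourier_inv phi = fun x => ((2 * pi) ^- n)%:C * fourier phi (- x)).
  apply: cmeasurableM; first exact: cmeasurable_cst.
  have mN : measurable_fun setT (fun x : 'rV[R]_n => - x).
    have := measurable_row_affine (-1 : R) (0 : 'rV[R]_n).
    by congr measurable_fun; apply/funext => x; rewrite scaleN1r addr0.
  exact: (cmeasurable_comp (cmeasurable_fourier mp) mN).
by apply/funext => x; exact: fourier_invE.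
Qed.

Let delta (m : nat) : R := m.+1%:R^-1.
(** Since 4 eps = delta^2, the transform of the damping Gaussian is a multiple of e^(-|x|^2 /
    delta^2), the unit Gaussian dilated by delta. *)
Let eps m : R := delta m ^+ 2 / 4.
Let H phi m x : R[i] := (gauss (eps m) x)%:C * fourier_inv phi x.

Let delta_gt0 m : 0 < delta m. Proof. by rewrite invr_gt0. Qed.
Let eps_gt0 m : 0 < eps m. Proof. by rewrite divr_gt0// exprn_gt0. Qed.

Let cintegrable_gauss l : 0 < l -> cintegrable leb setT (fun z => (gauss l z)%:C).
Proof. by move=> l0; exact: (wdecay_integrable _ (gauss_wdecay 1 l0)). Qed.

(** A Gaussian average of phi about w at scale [delta m], that is, phi smoothed by an approximate
    identity: [fourier_swap] carries the transform over to the damping Gaussian, modulated by w,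
    where it is explicit. *)
Let fourier_H phi m w : cintegrable leb setT phi ->
  fourier (H phi m) w = (Num.sqrt pi ^- n)%:C *
    cintegral leb setT (fun u => phi (delta m *: u + w) * (gauss 1 u)%:C).
Proof.
move=> ip; have ig := cintegrable_gauss (eps_gt0 m).
have [B B0 fB] := fourier_bounded ip.
have iH : cintegrable leb setT (fun x => (gauss (eps m) x)%:C * fourier phi x).
  apply: (@cintegrable_le _ _ _ _ _ (fun x => B * gauss (eps m) x)).
  - apply: cmeasurableM; first exact: (cintegrable_measurable ig).
    by apply: cmeasurable_fourier; exact: cintegrable_measurable ip.
  - exact: (integrableZl measurableT _ ig.1).
  - move=> x; rewrite Normc.normcM normc_real ger0_norm ?gauss_ge0// mulrC.
    by rewrite ler_wpM2r ?gauss_ge0.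
have gaussN x : gauss (eps m) (- x) = gauss (eps m) x.
  by rewrite /gauss dotpNl dotpNr opprK.
have -> : H phi m = fun x => ((2 * pi) ^- n)%:C *
    ((gauss (eps m) (- x))%:C * fourier phi (- x)).
  by apply/funext => x; rewrite /H fourier_invE gaussN mulrCA.
have iHN : cintegrable leb setT (fun x => (gauss (eps m) (- x))%:C * fourier phi (- x)).
  have := @cintegrable_affine _ _ (-1) 0 _ _ iH; rewrite oppr_eq0 oner_eq0 => /(_ isT).
  by congr cintegrable; apply/funext => x; rewrite scaleN1r addr0.
rewrite fourierZ// (@fourier_reflect (fun x => (gauss (eps m) x)%:C * fourier phi x))//.
have ic : cintegrable leb setT (fun x => cis (dotp x w) * (gauss (eps m) x)%:C).
  have := cintegrable_character (- w) ig; congr cintegrable; apply/funext => x.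
  by congr (cis _ * _); rewrite dotpNr opprK.
have -> : fourier (fun x => (gauss (eps m) x)%:C * fourier phi x) (- w) =
    cintegral leb setT (fun x => fourier phi x * (cis (dotp x w) * (gauss (eps m) x)%:C)).
  apply: eq_cintegral => x; rewrite [RHS]mulrC -!mulrA; congr (cis _ * _).
  by rewrite dotpNr opprK.
rewrite fourier_swap//.
under eq_cintegral do rewrite fourier_modulate fourier_gauss//.
have iP : cintegrable leb setT (fun x => phi x *
    (Num.sqrt (pi / eps m) ^+ n * expR (- (dotp (x - w) (x - w) / (4 * eps m))))%:C).
  apply: (@cintegrable_le _ _ _ _ _
    (fun x => Num.sqrt (pi / eps m) ^+ n * normc (phi x))).
  - apply: cmeasurableM; first exact: cintegrable_measurable ip.
    apply: cmeasurable_real; apply: measurable_funM; first exact: measurable_cst.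
    apply: (measurableT_comp (@measurable_expR R)).
    apply: (measurableT_comp (@oppr_measurable R setT)).
    apply: measurable_funM; last exact: measurable_cst.
    have ms : measurable_fun setT (fun x => x - w).
      by apply: measurable_row_add; [exact: measurable_id|exact: measurable_cst].
    exact: (measurable_dotp2 ms ms).
  - exact: (integrableZl measurableT _ (cintegrable_normc ip)).
  - move=> x; rewrite Normc.normcM mulrC ler_wpM2r ?normc_ge0//.
    rewrite normc_real ger0_norm; last by rewrite mulr_ge0 ?exprn_ge0 ?sqrtr_ge0 ?expR_ge0.
    rewrite ler_piMr ?exprn_ge0 ?sqrtr_ge0//.
    rewrite -[X in _ <= X]expR0 ler_expR oppr_le0 divr_ge0 ?dotp_ge0//.
    by rewrite mulr_ge0// ltW.
have d0 := lt0r_neq0 (delta_gt0 m).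
have := cintegral_affine w d0 iP; set X := cintegral _ _ (fun x => phi x * _).
set S := Num.sqrt _ => E.
have iZ : cintegrable leb setT (fun u => phi (delta m *: u + w) * (gauss 1 u)%:C).
  have ipa := cintegrable_affine w d0 ip.
  apply: (cintegrable_le _ (cintegrable_normc ipa)) => [|u].
    by apply: cmeasurableM; [exact: (cintegrable_measurable ipa)|
      apply: cmeasurable_real; exact: measurable_gauss].
  rewrite /comp Normc.normcM normc_real ger0_norm ?gauss_ge0// ler_piMr ?normc_ge0//.
  by rewrite /gauss -[X in _ <= X]expR0 ler_expR oppr_le0 mul1r dotp_ge0.
set Z := cintegral leb setT (fun u => phi (delta m *: u + w) * (gauss 1 u)%:C).
have XE : X = (delta m ^+ n * S ^+ n)%:C * Z.
  rewrite [in RHS]rmorphM -[RHS]mulrA -[(S ^+ n)%:C * Z]cintegralMl//.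
  transitivity ((delta m ^+ n)%:C * ((`|delta m| ^- n)%:C * X)).
    rewrite mulrA -rmorphM gtr0_norm//.
    by rewrite divff ?expf_neq0// mul1r.
  rewrite -E; congr (_ * _); apply: eq_cintegral => u.
  rewrite [RHS]mulrCA rmorphM; congr (_ * (_ * _%:C)); rewrite /gauss mul1r; congr (expR (- _)).
  rewrite addrK dotpZl dotpC dotpZl /eps; field.
  exact: d0.
rewrite XE mulrA -rmorphM; congr (_%:C * _).
(* With this value (2 pi)^(-n) delta^n S^n is pi^(-n/2), the normalization of the unit Gaussian. *)
have SE : S = 2 * Num.sqrt pi / delta m.
  rewrite /S sqrtrM ?pi_ge0// sqrtrV ?(ltW (eps_gt0 m))//.
  have -> : eps m = (delta m / 2) ^+ 2 by rewrite /eps; field.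
  by rewrite sqrtr_sqr gtr0_norm ?divr_gt0//; field.
rewrite -exprMn -exprVn -exprMn -exprVn; congr (_ ^+ n); rewrite SE.
have sp0 : Num.sqrt (pi : R) != 0 by rewrite sqrtr_eq0 -ltNge pi_gt0.
have := @sqr_sqrtr R pi (pi_ge0 R); move: sp0; set r := Num.sqrt _ => r0 pE.
by rewrite -pE; field; rewrite r0 d0.
Qed.

Let H_cvg phi w : schwartz phi ->
  (fun m => Re (fourier (H phi m) w)) @ \oo --> Re (phi w) /\
  (fun m => Im (fourier (H phi m) w)) @ \oo --> Im (phi w).
Proof.
move=> sp; have ip := wdecay_integrable (ltn0Sn 0) (schwartz_wdecay 1 sp).
have [mp [C C0 hC]] := schwartz_wdecay 0 sp.
have ig := cintegrable_gauss (@ltr01 R).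
have dm : (fun m => delta m) @ \oo --> (0 : R) by exact: (@cvg_harmonic R).
have dcvg u : (fun m => delta m *: u + w) @ \oo --> w.
  rewrite -[w in X in _ --> X](add0r w) -[0 : 'rV[R]_n](scale0r u).
  apply: cvgD; last exact: cvg_cst.
  by apply: cvgZ; [exact: dm|exact: cvg_cst].
have [cR cI] : (fun m => Re (cintegral leb setT (fun u => phi (delta m *: u + w) * (gauss 1 u)%:C)))
      @ \oo --> Re (cintegral leb setT (fun u => phi w * (gauss 1 u)%:C)) /\
    (fun m => Im (cintegral leb setT (fun u => phi (delta m *: u + w) * (gauss 1 u)%:C)))
      @ \oo --> Im (cintegral leb setT (fun u => phi w * (gauss 1 u)%:C)).
  apply: (@cintegral_dominated_cvg _ _ _ _ _ _ (fun x => C * gauss 1 x)).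
  - move=> m; apply: cmeasurableM.
      exact: (cintegrable_measurable (cintegrable_affine w (lt0r_neq0 (delta_gt0 m)) ip)).
    by apply: cmeasurable_real; exact: measurable_gauss.
  - apply: cmeasurableM; first exact: cmeasurable_cst.
    by apply: cmeasurable_real; exact: measurable_gauss.
  - exact: (integrableZl measurableT _ ig.1).
  - move=> u; rewrite Re_mul mulr0; under eq_fun do rewrite Re_mul mulr0.
    apply: cvgB; last exact: cvg_cst; apply: cvgM; last exact: cvg_cst.
    have /differentiable_continuous cphi := (sp.1 [::] w).1.
    exact: (cvg_comp _ _ (dcvg u) cphi).
  - move=> u; rewrite Im_mul mulr0; under eq_fun do rewrite Im_mul mulr0.
    apply: cvgD; first exact: cvg_cst; apply: cvgM; last exact: cvg_cst.
    have /differentiable_continuous cphi := (sp.1 [::] w).2.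
    exact: (cvg_comp _ _ (dcvg u) cphi).
  - move=> m u; rewrite Normc.normcM normc_real ger0_norm ?gauss_ge0//.
    by rewrite ler_wpM2r ?gauss_ge0//; have := hC (delta m *: u + w); rewrite expr0 mulr1.
have sp0 : Num.sqrt (pi : R) != 0 by rewrite sqrtr_eq0 -ltNge pi_gt0.
have LE : cintegral leb setT (fun u => phi w * (gauss 1 u)%:C) =
    (Num.sqrt pi ^+ n)%:C * phi w.
  rewrite cintegralMl// mulrC; congr (_ * _).
  apply: complex_eq => /=; first by rewrite integral_gauss// invr1 mulr1.
  rewrite /Rintegral -[RHS]/(fine 0) -[in RHS](@integral0 _ _ R leb setT).
  by congr fine; apply: eq_integral.
have -> : phi w = (Num.sqrt pi ^- n)%:C * ((Num.sqrt pi ^+ n)%:C * phi w).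
  by rewrite mulrA -rmorphM mulVf ?mul1r// expf_neq0.
rewrite -LE; split.
  under eq_fun do rewrite fourier_H// Re_mul mul0r; rewrite Re_mul mul0r.
  by apply: cvgB; [apply: cvgM; [exact: cvg_cst|exact: cR]|exact: cvg_cst].
under eq_fun do rewrite fourier_H// Im_mul mul0r; rewrite Im_mul mul0r.
by apply: cvgD; [apply: cvgM; [exact: cvg_cst|exact: cI]|exact: cvg_cst].
Qed.

(** The form paired with a test function is the one that [is_fraclap] calls for. [fourier_swap]
    moves the transform from f to [H phi m]; as m grows, [H phi m] tends to the inverse transform of
    phi and its transform tends to phi, so both sides pass to the limit. *)
Lemma fourier_inversion f phi : schwartz f -> schwartz phi ->
  cintegral leb setT (fun x => f x * phi x) =
  cintegral leb setT (fun y => fourier f y * fourier_inv phi y).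
Proof.
move=> sf sp; have iF := wdecay_integrable (ltn0Sn 0) (schwartz_wdecay 1 sf).
have ip := wdecay_integrable (ltn0Sn 0) (schwartz_wdecay 1 sp).
have mp := cintegrable_measurable ip; have mf := cintegrable_measurable iF.
have iFf := wdecay_integrable (ltn0Sn 0) (fourier_wdecay 1 sf).
have [B B0 pB] := fourier_bounded ip.
pose B' := (2 * pi) ^- n * B.
have invB x : normc (fourier_inv phi x) <= B'.
  rewrite fourier_invE Normc.normcM normc_real ger0_norm ?ler_wpM2l//.
    by rewrite invr_ge0 exprn_ge0// mulr_ge0// pi_ge0.
  by rewrite invr_ge0 exprn_ge0// mulr_ge0// pi_ge0.
have minv := cmeasurable_fourier_inv mp.
have gauss1 m x : gauss (eps m) x <= 1.
  by rewrite /gauss -[X in _ <= X]expR0 ler_expR oppr_le0 mulr_ge0 ?dotp_ge0 ?(ltW (eps_gt0 m)).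
have HB m x : normc (H phi m x) <= B' * gauss (eps m) x.
  by rewrite Normc.normcM normc_real ger0_norm ?gauss_ge0// mulrC ler_wpM2r ?gauss_ge0.
have mH m : cmeasurable (H phi m).
  by apply: cmeasurableM => //; apply: cmeasurable_real; exact: measurable_gauss.
have iH m : cintegrable leb setT (H phi m).
  apply: (cintegrable_le (mH m) _ (HB m)).
  exact: (integrableZl measurableT _ (cintegrable_gauss (eps_gt0 m)).1).
have B'0 : 0 <= B' by apply: le_trans (invB 0); exact: normc_ge0.
have [rR rI] : (fun m => Re (cintegral leb setT (fun x => fourier f x * H phi m x)))
      @ \oo --> Re (cintegral leb setT (fun x => fourier f x * fourier_inv phi x)) /\
    (fun m => Im (cintegral leb setT (fun x => fourier f x * H phi m x)))
      @ \oo --> Im (cintegral leb setT (fun x => fourier f x * fourier_inv phi x)).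
  have gcvg x : (fun m => gauss (eps m) x) @ \oo --> (1 : R).
    have e0 : (fun m => - (eps m * dotp x x)) @ \oo --> (0 : R).
      rewrite -[X in _ --> X]oppr0 -(mul0r (dotp x x)) -(mul0r (4^-1 : R)) -(mul0r (0 : R)).
      apply: cvgN; apply: cvgM; last exact: cvg_cst.
      apply: cvgM; last exact: cvg_cst.
      by rewrite /delta; apply: cvgM; exact: (@cvg_harmonic R).
    have := cvg_comp _ _ e0 (@continuous_expR R 0); rewrite expR0; exact.
  have HR x : (fun m => Re (H phi m x)) @ \oo --> Re (fourier_inv phi x).
    have -> : (fun m => Re (H phi m x)) = (fun m => gauss (eps m) x * Re (fourier_inv phi x)).
      by apply/funext => m; rewrite Re_mul mul0r subr0.
    rewrite -[X in _ --> X]mul1r; apply: cvgM; [exact: gcvg|exact: cvg_cst].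
  have HI x : (fun m => Im (H phi m x)) @ \oo --> Im (fourier_inv phi x).
    have -> : (fun m => Im (H phi m x)) = (fun m => gauss (eps m) x * Im (fourier_inv phi x)).
      by apply/funext => m; rewrite Im_mul mul0r addr0.
    rewrite -[X in _ --> X]mul1r; apply: cvgM; [exact: gcvg|exact: cvg_cst].
  apply: (@cintegral_dominated_cvg _ _ _ _ _ _ (fun x => B' * normc (fourier f x))).
  - by move=> m; apply: cmeasurableM => //; exact: cmeasurable_fourier.
  - by apply: cmeasurableM => //; exact: cmeasurable_fourier.
  - exact: (integrableZl measurableT _ (cintegrable_normc iFf)).
  - move=> x; rewrite Re_mul; under eq_fun do rewrite Re_mul.
    by apply: cvgB; (apply: cvgM; first exact: cvg_cst); [exact: HR|exact: HI].
  - move=> x; rewrite Im_mul; under eq_fun do rewrite Im_mul.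
    by apply: cvgD; (apply: cvgM; first exact: cvg_cst); [exact: HI|exact: HR].
  - move=> m x; rewrite Normc.normcM mulrC ler_wpM2r ?normc_ge0//.
    by apply: le_trans (HB m x) _; rewrite ler_piMr.
(* A bound uniform in m and w, required for domination by f: Gaussian averages of phi are controlled
   by the supremum of phi. *)
have [C C0 HC] : exists2 C, 0 <= C & forall m w, normc (fourier (H phi m) w) <= C.
  have [_ [D D0 hD]] := schwartz_wdecay 0 sp.
  have ig := cintegrable_gauss (@ltr01 R).
  have iD := integrableZl measurableT D ig.1.
  exists (Num.sqrt pi ^- n * (2 * \int[leb]_(x in setT) (D * gauss 1 x))).
    rewrite mulr_ge0 ?invr_ge0 ?exprn_ge0 ?sqrtr_ge0// mulr_ge0//.
    by apply: Rintegral_ge0 => x _; rewrite mulr_ge0 ?gauss_ge0.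
  move=> m w; rewrite fourier_H// Normc.normcM normc_real ger0_norm; last first.
    by rewrite invr_ge0 exprn_ge0 ?sqrtr_ge0.
  rewrite ler_wpM2l ?invr_ge0 ?exprn_ge0 ?sqrtr_ge0//.
  apply: normc_cintegral_le => //.
    apply: cmeasurableM.
      exact: (cintegrable_measurable (cintegrable_affine w (lt0r_neq0 (delta_gt0 m)) ip)).
    by apply: cmeasurable_real; exact: measurable_gauss.
  move=> u; rewrite Normc.normcM normc_real ger0_norm ?gauss_ge0//.
  by rewrite ler_wpM2r ?gauss_ge0//; have := hD (delta m *: u + w); rewrite expr0 mulr1.
have [lR lI] : (fun m => Re (cintegral leb setT (fun x => f x * fourier (H phi m) x)))
      @ \oo --> Re (cintegral leb setT (fun x => f x * phi x)) /\
    (fun m => Im (cintegral leb setT (fun x => f x * fourier (H phi m) x)))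
      @ \oo --> Im (cintegral leb setT (fun x => f x * phi x)).
  apply: (@cintegral_dominated_cvg _ _ _ _ _ _ (fun x => C * normc (f x))).
  - move=> m; apply: cmeasurableM => //; apply: cmeasurable_fourier; exact: mH.
  - exact: cmeasurableM.
  - exact: (integrableZl measurableT _ (cintegrable_normc iF)).
  - move=> x; rewrite Re_mul; under eq_fun do rewrite Re_mul.
    by have [hR hI] := H_cvg x sp; apply: cvgB; (apply: cvgM; first exact: cvg_cst).
  - move=> x; rewrite Im_mul; under eq_fun do rewrite Im_mul.
    by have [hR hI] := H_cvg x sp; apply: cvgD; (apply: cvgM; first exact: cvg_cst).
  - by move=> m x; rewrite Normc.normcM mulrC ler_wpM2r ?normc_ge0.
have E m := fourier_swap iF (iH m).
apply: complex_eq.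
  apply: (cvg_unique (@Rhausdorff R) lR).
  by have -> : (fun m => Re (cintegral leb setT (fun x => f x * fourier (H phi m) x))) =
    (fun m => Re (cintegral leb setT (fun x => fourier f x * H phi m x)))
    by apply/funext => m; rewrite E.
apply: (cvg_unique (@Rhausdorff R) lI).
by have -> : (fun m => Im (cintegral leb setT (fun x => f x * fourier (H phi m) x))) =
    (fun m => Im (cintegral leb setT (fun x => fourier f x * H phi m x)))
    by apply/funext => m; rewrite E.
Qed.

End inversion.

(** * Distributions given by functions of controlled growth *)

Section weighted_growth.
Context {R : realType} {n : nat}.
Local Notation leb := (@lebesgue_row R n).
Local Notation normc := (@Normc.normc R).
Implicit Types (g h phi A : 'rV[R]_n -> R[i]) (x y z : 'rV[R]_n).

(* [weight ^+ 2] is (1 + |x|)^(-4n) for the sup norm: a convenient fixed order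
   of growth, dominated by the decay of Schwartz functions. *)
Definition wgrow g := cmeasurable g /\
  cintegrable leb setT (fun x => (weight x ^+ 2)%:C * g x).

Let cmeasurable_weight2 : cmeasurable (fun x : 'rV[R]_n => (weight x ^+ 2)%:C).
Proof. by apply: cmeasurable_real; apply: measurable_funX; exact: measurable_weight. Qed.

Lemma wgrow_le g (b : 'rV[R]_n -> R) : cmeasurable g ->
  leb.-integrable setT (EFin \o b) -> (forall x, normc (g x) <= b x) -> wgrow g.
Proof.
move=> mg ib gb; split => //; apply: (cintegrable_le _ ib).
  by apply: cmeasurableM.
move=> x; rewrite Normc.normcM normc_real ger0_norm ?exprn_ge0 ?weight_ge0//.
apply: le_trans (gb x); rewrite ler_piMl ?normc_ge0//.
by rewrite exprn_ile1 ?weight_ge0 ?weight_le1.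
Qed.

Lemma wgrowD g h : wgrow g -> wgrow h -> wgrow (fun x => g x + h x).
Proof.
move=> [mg ig] [mh ih]; split; first exact: cmeasurableD.
have := cintegrableD ig ih; congr cintegrable; apply/funext => x.
by rewrite mulrDr.
Qed.

Lemma wgrowMl (c : R[i]) g : wgrow g -> wgrow (fun x => c * g x).
Proof.
move=> [mg ig]; split; first by apply: cmeasurableM => //; exact: cmeasurable_cst.
have := cintegrableMl c ig; congr cintegrable; apply/funext => x.
by rewrite mulrCA.
Qed.

Lemma wgrow_sum I (r : seq I) (F : I -> 'rV[R]_n -> R[i]) :
  (forall i, wgrow (F i)) -> wgrow (fun x => \sum_(i <- r) F i x).
Proof.
move=> wF; split; first by apply: cmeasurable_sum => i; exact: (wF i).1.
have := cintegrable_sum r (fun i => (wF i).2); congr cintegrable; apply/funext => x.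
by rewrite mulr_sumr.
Qed.

(** The sup norm is at most the Euclidean one, so the weight squared dominates the Euclidean (1 +
    |x|)^(-4n). *)
Lemma wgrow_tempered_fun g : wgrow g -> tempered_fun g.
Proof.
move=> [mg ig]; exists (n.*2 * 2)%N.
apply: (cintegrable_le _ (cintegrable_normc ig)) => [|x].
  apply: cmeasurableM => //; apply: cmeasurable_real.
  rewrite (_ : (fun x => _) = fun x : 'rV[R]_n => (1 + enorm x) `^ (- (n.*2 * 2)%N%:R)).
    apply: (measurableT_comp (@measurable_powR R _)).
    by apply: measurable_funD; [exact: measurable_cst|exact: measurable_enorm].
  apply/funext => x; rewrite powRN powR_mulrn//.
  by rewrite addr_ge0// enorm_ge0.
rewrite /comp !Normc.normcM !normc_real ler_wpM2r ?normc_ge0//.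
rewrite !ger0_norm ?exprn_ge0 ?weight_ge0 ?invr_ge0 ?exprn_ge0 ?addr_ge0 ?enorm_ge0//.
rewrite /weight exprVn -exprM lef_pV2 ?posrE ?exprn_gt0 ?ltr_pwDl ?enorm_ge0//.
apply: lerXn2r; rewrite ?nnegrE ?addr_ge0 ?enorm_ge0//.
by rewrite lerD2l norm_le_enorm.
Qed.

Lemma wgrow_wdecay g h : wgrow g -> wdecay 2 h -> cintegrable leb setT (fun x => g x * h x).
Proof.
move=> [mg ig] [mh [C C0 hC]].
apply: (cintegrable_le _ (integrableZl measurableT C (cintegrable_normc ig))) => [|x].
  exact: cmeasurableM.
rewrite /= !Normc.normcM normc_real ger0_norm ?exprn_ge0 ?weight_ge0//.
by rewrite mulrC mulrA ler_wpM2r ?normc_ge0.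
Qed.

(** The class [wdecay 2] contains the Schwartz functions and is stable under sums and multiples, so
    linearity and continuity of u are read off the integral against A. *)
Lemma tempered_wgrow (u : @dist R n) A : wgrow A ->
  (forall h, wdecay 2 h -> u h = dist_of A h) -> tempered u.
Proof.
move=> wA uA; split.
- move=> phi psi sphi spsi; have w1 := schwartz_wdecay 2 sphi; have w2 := schwartz_wdecay 2 spsi.
  rewrite !uA//; last exact: wdecayD.
  rewrite /dist_of -cintegralD; [|exact: wgrow_wdecay..].
  by apply: eq_cintegral => x; rewrite mulrDr.
- move=> c phi sphi; have w1 := schwartz_wdecay 2 sphi.
  rewrite !uA//; last first.
    apply: (@wdecayMl _ _ _ (normc c)) => //; exact: cmeasurable_cst.
  rewrite /dist_of -cintegralMl; last exact: wgrow_wdecay.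
  by apply: eq_cintegral => x; rewrite mulrCA.
have [mA iA] := wA.
pose N := (n.*2 * 2)%N; pose Q := \int[leb]_(x in setT) normc ((weight x ^+ 2)%:C * A x).
(* N = 4n is the order of [weight ^+ 2]. The bound M enters [weightX_bound] twice, whence the inner
   2; the outer 2 is that of [normc_cintegral_le]. *)
exists N, (2 * (2 ^+ N * 2 * Q)) => phi M sphi bphi.
have w1 := schwartz_wdecay 2 sphi; rewrite uA//.
have M1 x : normc (phi x) <= M by have := bphi 0%N [::] x isT isT; rewrite expr0 mul1r.
have M2 x : `|x| ^+ N * normc (phi x) <= M.
  apply: le_trans (bphi N [::] x (leqnn N) isT); rewrite ler_wpM2r ?normc_ge0//.
  by apply: lerXn2r; rewrite ?nnegrE ?enorm_ge0// norm_le_enorm.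
have h x : normc (phi x) <= 2 ^+ N * (M + M) * weight x ^+ 2.
  by apply: weightX_bound; rewrite ?normc_ge0.
have iN := integrableZl measurableT (2 ^+ N * (M + M)) (cintegrable_normc iA).
apply: (@le_trans _ _ (2 * \int[leb]_(x in setT) (2 ^+ N * (M + M) * normc ((weight x ^+ 2)%:C * A x)))).
  apply: normc_cintegral_le => //.
    by apply: cmeasurableM => //; have [] := w1.
  move=> x; rewrite !Normc.normcM normc_real ger0_norm ?exprn_ge0 ?weight_ge0//.
  by rewrite mulrC mulrA ler_wpM2r ?normc_ge0.
rewrite RintegralZl//; last exact: (cintegrable_normc iA).
by rewrite le_eqVlt -/Q; apply/orP; left; apply/eqP; ring.
Qed.

Lemma tempered_dist_of A : wgrow A -> tempered (dist_of A).
Proof. by move=> wA; apply: (tempered_wgrow wA). Qed.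

(** The transform by duality, for A that may fail to be integrable. Both A and its transform are
    required to be functions, because [is_mult] multiplies functions by symbols. *)
Definition has_fourier A g := [/\ wgrow A, wgrow g &
  forall phi, schwartz phi -> dist_of A (fourier phi) = dist_of g phi].

Lemma dist_ofD g h phi : wgrow g -> wgrow h -> wdecay 2 phi ->
  dist_of (fun x => g x + h x) phi = dist_of g phi + dist_of h phi.
Proof.
move=> wg wh wp; rewrite /dist_of -cintegralD; [|exact: wgrow_wdecay..].
by apply: eq_cintegral => x; rewrite mulrDl.
Qed.

Lemma dist_ofMl (c : R[i]) g phi : wgrow g -> wdecay 2 phi ->
  dist_of (fun x => c * g x) phi = c * dist_of g phi.
Proof.
move=> wg wp; rewrite /dist_of -cintegralMl; last exact: wgrow_wdecay.
by apply: eq_cintegral => x; rewrite mulrA.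
Qed.

Lemma has_fourierD A B g h : has_fourier A g -> has_fourier B h ->
  has_fourier (fun x => A x + B x) (fun x => g x + h x).
Proof.
move=> [wA wg Ag] [wB wh Bh]; split; [exact: wgrowD|exact: wgrowD|] => phi sphi.
by rewrite !dist_ofD ?Ag ?Bh//; [exact: schwartz_wdecay|exact: fourier_wdecay].
Qed.

Lemma has_fourierMl (c : R[i]) A g : has_fourier A g ->
  has_fourier (fun x => c * A x) (fun x => c * g x).
Proof.
move=> [wA wg Ag]; split; [exact: wgrowMl|exact: wgrowMl|] => phi sphi.
by rewrite !dist_ofMl ?Ag//; [exact: schwartz_wdecay|exact: fourier_wdecay].
Qed.

Lemma has_fourier_sum I (r : seq I) (A g : I -> 'rV[R]_n -> R[i]) :
  (forall i, has_fourier (A i) (g i)) ->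
  has_fourier (fun x => \sum_(i <- r) A i x) (fun x => \sum_(i <- r) g i x).
Proof.
move=> Ag; have wA i : wgrow (A i) by case: (Ag i).
have wg i : wgrow (g i) by case: (Ag i).
split; [exact: wgrow_sum|exact: wgrow_sum|] => phi sphi; rewrite /dist_of.
under eq_cintegral do rewrite mulr_suml; under [RHS]eq_cintegral do rewrite mulr_suml.
rewrite !cintegral_sum; last 2 first.
- by move=> i; apply: wgrow_wdecay => //; exact: schwartz_wdecay.
- by move=> i; apply: wgrow_wdecay => //; exact: fourier_wdecay.
by apply: eq_bigr => i _; case: (Ag i) => _ _ /(_ _ sphi).
Qed.

Lemma wdecay_translate f x : wdecay 1 f -> wdecay 1 (fun z => f (x + z)).
Proof.
move=> [mf [C C0 fC]]; split.
  apply: (cmeasurable_comp mf).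
  by apply: measurable_row_add; [exact: measurable_cst|exact: measurable_id].
exists (C / weight x); first by rewrite divr_ge0 ?weight_ge0.
move=> z; apply: le_trans (fC _) _; rewrite -mulrA ler_wpM2l// !expr1.
by rewrite ler_pdivlMl ?weight_gt0// weightM_le.
Qed.

End weighted_growth.

(** * Convolution with superpositions of kernels *)

Section superposition.
Context {R : realType} {m : nat} d (L : measurableType d).
Local Notation n := m.+1.
Variable lam : {sigma_finite_measure set L -> \bar R}.
Local Notation leb := (@lebesgue_row R n).
Local Notation normc := (@Normc.normc R).
Implicit Types (k q : L * 'rV[R]_n -> R[i]) (K M f g h phi : 'rV[R]_n -> R[i])
  (x y z : 'rV[R]_n) (a b : R).

(** K is a mixture of the kernels k(l, .), with sizes controlled by |z|^(a-n), locally integrable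
    for a > 0. The bound on the integral of the moduli is what Tonelli requires. The origin is set
    apart, as homogeneous kernels are singular there. *)
Definition superposition k K a := [/\ cmeasurable k, cmeasurable K,
  forall z, z != 0 -> cintegral lam setT (fun l => k (l, z)) = K z &
  exists2 C, 0 <= C &
    (forall z, normc (K z) <= C * enorm z `^ (a - n%:R)) /\
    (forall z, z != 0 ->
      (\int[lam]_l (normc (k (l, z)))%:E <= (C * enorm z `^ (a - n%:R))%:E)%E)].

Lemma superposition_integrable k K a h : 0 < a <= n%:R -> superposition k K a ->
  wdecay 1 h -> cintegrable leb setT (fun z => K z * h z).
Proof.
move=> /andP[a0 an] [mk mK _ [C C0 [KC _]]] [mh [B B0 hB]].
have i1 := integrableZl measurableT (C * B) (integrable_enorm_powR a0 an).
apply: (cintegrable_le _ i1) => [|z]; first exact: cmeasurableM.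
rewrite /= Normc.normcM; have := hB z; rewrite expr1 => hBz.
apply: (@le_trans _ _ (C * enorm z `^ (a - n%:R) * (B * weight z))).
  by apply: ler_pM; rewrite ?normc_ge0.
by rewrite mulrACA.
Qed.

Lemma superposition_swap k K a h : 0 < a <= n%:R ->
  superposition k K a -> wdecay 1 h ->
  cintegral leb setT (fun z => K z * h z) =
  cintegral lam setT (fun l => cintegral leb setT (fun z => k (l, z) * h z)).
Proof.
move=> an sk wh; have [mk mK kK [C C0 [KC kC]]] := sk; have [mh [B B0 hB]] := wh.
have mkz z : cmeasurable (fun l => k (l, z)).
  apply: (cmeasurable_comp mk).
  by apply/measurable_fun_pairP; split; [exact: measurable_id|exact: measurable_cst].
have mnkz z : measurable_fun setT (fun l => (normc (k (l, z)))%:E).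
  by apply/measurable_EFinP; exact: (measurable_normc (mkz z)).
have mG : cmeasurable (fun p : 'rV[R]_n * L => k (p.2, p.1) * h p.1).
  apply: cmeasurableM; last exact: (cmeasurable_comp mh measurable_fst).
  apply: (cmeasurable_comp mk).
  by apply/measurable_fun_pairP; split; [exact: measurable_snd|exact: measurable_fst].
have iG : cintegrable (leb \x lam)%E setT (fun p : 'rV[R]_n * L => k (p.2, p.1) * h p.1).
  have /andP[a0 an'] := an.
  have i1 := integrableZl measurableT (C * B) (integrable_enorm_powR a0 an').
  apply: (cintegrable_prod_iter mG i1).
  exists [set (0 : 'rV[R]_n)]; split.
  - exact: measurable_row_zero.
  - exact: lebesgue_row_zero.
  move=> z /eqP z0 /=.
  have -> : (\int[lam]_l (normc (k (l, z) * h z))%:E =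
      (normc (h z))%:E * \int[lam]_l (normc (k (l, z)))%:E)%E.
    rewrite -ge0_integralZl_EFin//.
    - by apply: eq_integral => l _; rewrite Normc.normcM mulrC EFinM.
    - by move=> l _; rewrite lee_fin normc_ge0.
    - exact: normc_ge0.
  apply: (@le_trans _ _ ((normc (h z))%:E * (C * enorm z `^ (a - n%:R))%:E)%E).
    by apply: lee_wpmul2l; [rewrite lee_fin normc_ge0|exact: kC].
  rewrite -EFinM lee_fin [leRHS]mulrACA [leLHS]mulrC.
  by apply: ler_wpM2l; [rewrite mulr_ge0 ?powR_ge0|have := hB z; rewrite expr1].
rewrite -(cintegral_fubini iG) /=.
apply: eq_cintegral_neq0 => //.
- exact: cmeasurableM.
- exact: (@cmeasurable_cintegral2 _ _ _ _ _ lam _ mG).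
move=> z z0; rewrite -kK// mulrC -cintegralMl.
  by apply: eq_cintegral => l; rewrite mulrC.
have ib : lam.-integrable setT (EFin \o (fun l => normc (k (l, z)))).
  apply/integrableP; split; first exact: mnkz.
  under eq_integral do rewrite /= ger0_norm ?normc_ge0//.
  by apply: le_lt_trans (kC z z0) _; rewrite ltry.
exact: (cintegrable_le (mkz z) ib).
Qed.

(** A correlation rather than a convolution, because a beam samples f at x + t xi. The symbol is
    therefore the transform of K at -y. *)
Definition conv K f x : R[i] := cintegral leb setT (fun z => K z * f (x + z)).

Let cmeasurable_translate2 f : cmeasurable f ->
  cmeasurable (fun p : 'rV[R]_n * 'rV[R]_n => f (p.1 + p.2)).
Proof.
move=> mf; apply: (cmeasurable_comp mf).
by apply: measurable_row_add; [exact: measurable_fst|exact: measurable_snd].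
Qed.

(** Of the two orders of g, one is traded by [weightM_le] for decay in z and the other remains for
    integrability in x. *)
Let correlation_bound f g : wdecay 1 f -> wdecay 2 g ->
  exists2 B, 0 <= B & forall x z, normc (f (x + z) * g x) <= B * weight x * weight z.
Proof.
move=> [mf [B B0 fB]] [mg [D D0 gD]]; exists (B * D); first exact: mulr_ge0.
move=> x z; rewrite Normc.normcM.
apply: (@le_trans _ _ (B * weight (x + z) * (D * weight x ^+ 2))).
  by apply: ler_pM; rewrite ?normc_ge0//; have := fB (x + z); rewrite expr1.
rewrite [leLHS]mulrACA -!mulrA ler_wpM2l// ler_wpM2l// expr2.
by rewrite mulrCA ler_wpM2l ?weight_ge0// mulrC weightM_le.
Qed.

Let correlation_wdecay f g : wdecay 1 f -> wdecay 2 g ->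
  wdecay 1 (fun z => cintegral leb setT (fun x => f (x + z) * g x)).
Proof.
move=> wf wg; have [mf _] := wf; have [mg _] := wg.
have [B B0 fgB] := correlation_bound wf wg; split.
  apply: (@cmeasurable_cintegral2 _ _ _ _ _ leb
    (fun p : 'rV[R]_n * 'rV[R]_n => f (p.2 + p.1) * g p.2)).
  apply: cmeasurableM; last exact: (cmeasurable_comp mg measurable_snd).
  apply: (cmeasurable_comp mf).
  by apply: measurable_row_add; [exact: measurable_snd|exact: measurable_fst].
have iW := @integrable_weight R n.
exists (2 * (B * \int[leb]_(x in setT) weight x)).
  rewrite !mulr_ge0//; apply: Rintegral_ge0 => x _; exact: weight_ge0.
move=> z; rewrite expr1.
have -> : 2 * (B * \int[leb]_(x in setT) weight x) * weight z =
    2 * \int[leb]_(x in setT) (B * weight z * weight x).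
  by rewrite RintegralZl//; ring.
apply: normc_cintegral_le.
- apply: cmeasurableM => //; apply: (cmeasurable_comp mf).
  by apply: measurable_row_add; [exact: measurable_id|exact: measurable_cst].
- exact: (integrableZl measurableT _ iW).
- by move=> x; rewrite mulrAC; exact: fgB.
Qed.

Lemma conv_swap k K a f g : 0 < a <= n%:R -> superposition k K a ->
  wdecay 1 f -> wdecay 2 g ->
  cintegrable leb setT (fun x => conv K f x * g x) /\
  cintegral leb setT (fun x => conv K f x * g x) =
  cintegral leb setT (fun z => K z * cintegral leb setT (fun x => f (x + z) * g x)).
Proof.
move=> an sk wf wg; have [mk mK kK [C C0 [KC kC]]] := sk.
have [mf _] := wf; have [mg _] := wg.
have [B B0 fgB] := correlation_bound wf wg.
pose G (p : 'rV[R]_n * 'rV[R]_n) := K p.2 * (f (p.1 + p.2) * g p.1).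
have mG : cmeasurable G.
  apply: cmeasurableM; first exact: (cmeasurable_comp mK measurable_snd).
  apply: cmeasurableM; last exact: (cmeasurable_comp mg measurable_fst).
  exact: cmeasurable_translate2.
have iG : cintegrable (leb \x leb)%E setT G.
  have /andP[a0 an'] := an.
  have i1 := integrableZl measurableT C (integrable_enorm_powR a0 an').
  have i2 := integrableZl measurableT B (@integrable_weight R n).
  apply: (cintegrable_prod mG i2 i1) => x z; rewrite /G /= Normc.normcM.
  apply: (@le_trans _ _ (C * enorm z `^ (a - n%:R) * (B * weight x * weight z))).
    by apply: ler_pM; rewrite ?normc_ge0.
  by rewrite le_eqVlt; apply/orP; left; apply/eqP; ring.
have E x : conv K f x * g x = cintegral leb setT (fun z => G (x, z)).
  rewrite mulrC /conv -cintegralMl.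
    by apply: eq_cintegral => z; rewrite /G/= mulrC -mulrA.
  exact: (superposition_integrable an sk (wdecay_translate x wf)).
split.
  by have := cintegrable_cintegral2 iG; congr cintegrable; apply/funext => x; rewrite E.
under eq_cintegral do rewrite E; rewrite cintegral_fubini//.
apply: eq_cintegral => z; rewrite /G/= cintegralMl//.
have i2 := integrableZl measurableT (B * weight z) (@integrable_weight R n).
apply: (cintegrable_le _ i2) => [|x]; last by rewrite /= mulrAC; exact: fgB.
apply: cmeasurableM => //; apply: (cmeasurable_comp mf).
by apply: measurable_row_add; [exact: measurable_id|exact: measurable_cst].
Qed.

(** Pairing with [fourier phi] brings out the transform of g0 = F f phi at -z. As K need not have a
    convergent transform, it is split over l, the transform is moved onto each k(l, .), and the
    pieces q(l, .) are reassembled into M. *)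
Lemma has_fourier_conv k K q M a b f : 0 < a <= n%:R -> 0 < b <= n%:R ->
  superposition k K a -> superposition q M b ->
  (forall l, cintegrable leb setT (fun z => k (l, z))) ->
  (forall l y, fourier (fun z => k (l, z)) (- y) = q (l, y)) ->
  schwartz f -> has_fourier (conv K f) (fun y => M y * fourier f y).
Proof.
move=> ha hb sk sq ik qE sf; have [mk mK _ _] := sk; have [mq mM _ _] := sq.
have wf := schwartz_wdecay 1 sf; have [mf _] := wf.
have if_ := wdecay_integrable (ltn0Sn 0) wf.
split.
- split.
    apply: (@cmeasurable_cintegral2 _ _ _ _ _ leb (fun p : 'rV[R]_n * 'rV[R]_n => K p.2 * f (p.1 + p.2))).
    apply: cmeasurableM; first exact: (cmeasurable_comp mK measurable_snd).
    exact: cmeasurable_translate2.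
  (* The squared weight is itself an admissible g in [conv_swap], whose integrability half is then
     the growth condition. *)
  have ww : wdecay 2 (fun x : 'rV[R]_n => (weight x ^+ 2)%:C).
    split; first by apply: cmeasurable_real; apply: measurable_funX; exact: measurable_weight.
    by exists 1 => // x; rewrite mul1r normc_real ger0_norm ?exprn_ge0 ?weight_ge0.
  have [+ _] := conv_swap ha sk wf ww; congr cintegrable.
  by apply/funext => x; rewrite mulrC.
- have iM := superposition_integrable hb sq (fourier_wdecay 1 sf).
  apply: (wgrow_le _ (cintegrable_normc iM)) => //.
  by apply: cmeasurableM => //; exact: cmeasurable_fourier.
move=> phi sp; have ip := wdecay_integrable (ltn0Sn 0) (schwartz_wdecay 1 sp).
rewrite /dist_of (conv_swap ha sk wf (fourier_wdecay 2 sp)).2.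
pose g0 y := fourier f y * phi y.
have wg0 : wdecay 1 g0 := wdecayM (fourier_wdecay 0 sf) (schwartz_wdecay 1 sp).
have ig0 := wdecay_integrable (ltn0Sn 0) wg0.
have hE z : cintegral leb setT (fun x => f (x + z) * fourier phi x) = fourier g0 (- z).
  rewrite -fourier_swap//; last first.
    have := cintegrable_affine z (oner_neq0 R) if_; congr cintegrable.
    by apply/funext => x; rewrite scale1r.
  apply: eq_cintegral => y; rewrite fourier_translate// -mulrA; congr (cis _ * _).
  by rewrite dotpNr opprK dotpC.
under eq_cintegral do rewrite hE.
have wh : wdecay 1 (fun z => fourier g0 (- z)).
  have := correlation_wdecay wf (fourier_wdecay 2 sp).
  by congr wdecay; apply/funext => z; exact: hE.
rewrite (superposition_swap ha sk wh).
under [RHS]eq_cintegral do rewrite -mulrA.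
rewrite (superposition_swap hb sq wg0).
apply: eq_cintegral => l.
have ig0N : cintegrable leb setT (fun y => g0 (- y)).
  have := @cintegrable_affine _ _ (-1) 0 _ _ ig0; rewrite oppr_eq0 oner_eq0 => /(_ isT).
  by congr cintegrable; apply/funext => x; rewrite scaleN1r addr0.
transitivity (cintegral leb setT (fun y => fourier (fun z => k (l, z)) y * g0 (- y))).
  rewrite (fourier_swap (ik l) ig0N); apply: eq_cintegral => z.
  by rewrite (fourier_reflect _ ig0).
have iF : cintegrable leb setT (fun y => fourier (fun z => k (l, z)) y * g0 (- y)).
  have [B B0 hB] := fourier_bounded (ik l).
  have iB := integrableZl measurableT B (cintegrable_normc ig0N).
  apply: (cintegrable_le _ iB) => [|y].
    apply: cmeasurableM; last exact: (cintegrable_measurable ig0N).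
    by apply: cmeasurable_fourier; exact: (cintegrable_measurable (ik l)).
  by rewrite /= Normc.normcM ler_wpM2r ?normc_ge0.
have := @cintegral_affine _ _ (-1) 0 _ _ iF; rewrite oppr_eq0 oner_eq0 => /(_ isT).
rewrite normrN1 expr1n invr1 mul1r => <-; apply: eq_cintegral => y.
by rewrite scaleN1r addr0 opprK qE.
Qed.

End superposition.

(** * Powers of the norm as superpositions of Gaussians *)

Section power_kernels.
Context {R : realType} {m : nat}.
Local Notation n := m.+1.
Local Notation leb := (@lebesgue_row R n).
Local Notation mu := (@lebesgue_measure R).
Local Notation L := (measurableTypeR R).
Local Notation normc := (@Normc.normc R).
Implicit Types (f g h : 'rV[R]_n -> R[i]) (x y z : 'rV[R]_n) (a b l : R).

Lemma cintegral_scale (c : R[i]) (w : L -> R) (W : R) : measurable_fun setT w ->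
  (forall l, 0 <= w l) -> (\int[mu]_l (w l)%:E = W%:E)%E ->
  cintegral mu setT (fun l => c * (w l)%:C) = c * W%:C.
Proof.
move=> mw w0 wW.
have iw : cintegrable mu setT (fun l => (w l)%:C).
  have i1 : mu.-integrable setT (EFin \o w).
    apply/integrableP; split; first exact/measurable_EFinP.
    under eq_integral do rewrite /= ger0_norm//.
    by rewrite wW ltry.
  apply: (cintegrable_le (cmeasurable_real mw) i1) => l.
  by rewrite normc_real ger0_norm.
rewrite cintegralMl//; congr (_ * _); apply: complex_eq => /=.
  by rewrite /Rintegral wW.
rewrite /Rintegral -[RHS]/(fine 0) -[in RHS](@integral0 _ _ R mu setT).
by congr fine; apply: eq_integral.
Qed.

Lemma superposition_scale (w : L * 'rV[R]_n -> R) (W : 'rV[R]_n -> R)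
    (c : 'rV[R]_n -> R[i]) (C a : R) :
  measurable_fun setT w -> measurable_fun setT W -> cmeasurable c ->
  (forall p, 0 <= w p) -> (forall z, 0 <= W z) ->
  (forall z, z != 0 -> (\int[mu]_l (w (l, z))%:E = (W z)%:E)%E) ->
  0 <= C -> (forall z, normc (c z) * W z <= C * enorm z `^ (a - n%:R)) ->
  superposition mu (fun p => c p.2 * (w p)%:C) (fun z => c z * (W z)%:C) a.
Proof.
move=> mw mW mc w0 W0 wW C0 cW.
have mwz z : measurable_fun setT (fun l : L => w (l, z)).
  apply: (measurableT_comp mw).
  by apply/measurable_fun_pairP; split; [exact: measurable_id|exact: measurable_cst].
split.
- apply: cmeasurableM; first exact: (cmeasurable_comp mc measurable_snd).
  exact: cmeasurable_real.
- by apply: cmeasurableM => //; exact: cmeasurable_real.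
- by move=> z z0 /=; apply: cintegral_scale => //; exact: wW.
exists C => //; split=> [z|z z0].
  by rewrite Normc.normcM normc_real ger0_norm.
have -> : (\int[mu]_l (normc (c z * (w (l, z))%:C))%:E =
    (normc (c z))%:E * \int[mu]_l (w (l, z))%:E)%E.
  rewrite -ge0_integralZl_EFin//.
  - by apply: eq_integral => l _; rewrite Normc.normcM normc_real ger0_norm// EFinM.
  - by move=> l _; rewrite lee_fin.
  - by apply/measurable_EFinP; exact: mwz.
  - exact: normc_ge0.
by rewrite wW// -EFinM lee_fin.
Qed.

Lemma superpositionD (k k' : L * 'rV[R]_n -> R[i]) (K K' : 'rV[R]_n -> R[i]) a :
  superposition mu k K a -> superposition mu k' K' a ->
  superposition mu (fun p => k p + k' p) (fun z => K z + K' z) a.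
Proof.
move=> [mk mK kK [C C0 [KC kC]]] [mk' mK' kK' [C' C'0 [KC' kC']]].
have slice (u : L * 'rV[R]_n -> R[i]) z : cmeasurable u -> cmeasurable (fun l : L => u (l, z)).
  move=> mu'; apply: (cmeasurable_comp mu').
  by apply/measurable_fun_pairP; split; [exact: measurable_id|exact: measurable_cst].
have mnorm (u : L * 'rV[R]_n -> R[i]) z : cmeasurable u ->
    measurable_fun setT (fun l : L => (normc (u (l, z)))%:E).
  by move=> mu'; apply/measurable_EFinP; exact: (measurable_normc (slice u z mu')).
have int (u : L * 'rV[R]_n -> R[i]) z (B : R) : cmeasurable u ->
    (\int[mu]_l (normc (u (l, z)))%:E <= B%:E)%E -> cintegrable mu setT (fun l => u (l, z)).
  move=> mu' uB; have i1 : mu.-integrable setT (EFin \o (fun l => normc (u (l, z)))).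
    apply/integrableP; split; first exact: mnorm.
    under eq_integral do rewrite /= ger0_norm ?normc_ge0//.
    by apply: le_lt_trans uB _; rewrite ltry.
  exact: (cintegrable_le (slice u z mu') i1).
split.
- exact: cmeasurableD.
- exact: cmeasurableD.
- move=> z z0; rewrite cintegralD ?kK ?kK'//.
    exact: (int _ _ _ mk (kC z z0)).
  exact: (int _ _ _ mk' (kC' z z0)).
exists (C + C'); first exact: addr_ge0.
split=> [z|z z0]; first by rewrite (le_trans (le_normcD _ _))// mulrDl lerD.
apply: (@le_trans _ _ (\int[mu]_l ((normc (k (l, z)))%:E + (normc (k' (l, z)))%:E))%E).
  apply: ge0_le_integral => //.
  - by move=> l _; rewrite lee_fin normc_ge0.
  - exact: (mnorm (fun p => k p + k' p) z (cmeasurableD mk mk')).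
  - by apply: emeasurable_funD; exact: mnorm.
  - by move=> l _; rewrite -EFinD lee_fin le_normcD.
rewrite ge0_integralD//.
- by rewrite mulrDl EFinD leeD ?kC ?kC'.
- by move=> l _; rewrite lee_fin normc_ge0.
- exact: mnorm.
- by move=> l _; rewrite lee_fin normc_ge0.
- exact: mnorm.
Qed.

Lemma powR_dotp z b : dotp z z `^ b = enorm z `^ (2 * b).
Proof. by rewrite powRrM -sqr_enorm powR_mulrn ?enorm_ge0. Qed.

Lemma powR_dotp4 z b : (dotp z z / 4) `^ b = 2 `^ (- (2 * b)) * enorm z `^ (2 * b).
Proof.
rewrite mulrC powRM ?invr_ge0 ?dotp_ge0// powR_dotp; congr (_ * _).
rewrite powRN powRrM powR_mulrn// -[LHS]invrK; congr (_^-1).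
rewrite -powRN -[4^-1 in LHS]powR_inv1// -powRrM mulN1r opprK.
by congr (_ `^ _); rewrite expr2; ring.
Qed.

Let wk a (p : L * 'rV[R]_n) : R :=
  (0 < p.1)%R%:R * (p.1 `^ (a - 1) * expR (- (dotp p.2 p.2 * p.1))).
Let wq b (p : L * 'rV[R]_n) : R :=
  (0 < p.1)%R%:R * (p.1 `^ (- b - 1) * expR (- (dotp p.2 p.2 / 4 / p.1))).

Let measurable_dotp_snd :
  measurable_fun setT (fun p : L * 'rV[R]_n => dotp p.2 p.2).
Proof. by apply: measurable_dotp2; exact: measurable_snd. Qed.

Let measurable_wk a : measurable_fun setT (wk a).
Proof.
apply: measurable_funM; first exact: (measurableT_comp (measurable_gt 0) measurable_fst).
apply: measurable_funM; first exact: (measurableT_comp (@measurable_powR R _) measurable_fst).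
apply: (measurableT_comp (@measurable_expR R)).
apply: (measurableT_comp (@oppr_measurable R setT)).
by apply: measurable_funM; [exact: measurable_dotp_snd|exact: measurable_fst].
Qed.

Let measurable_wq b : measurable_fun setT (wq b).
Proof.
rewrite (_ : wq b = fun p => (0 < p.1)%R%:R *
    (p.1 `^ (- b - 1) * expR (- (dotp p.2 p.2 / 4 * p.1 `^ (- 1))))).
  apply: measurable_funM; first exact: (measurableT_comp (measurable_gt 0) measurable_fst).
  apply: measurable_funM; first exact: (measurableT_comp (@measurable_powR R _) measurable_fst).
  apply: (measurableT_comp (@measurable_expR R)).
  apply: (measurableT_comp (@oppr_measurable R setT)).
  apply: measurable_funM.
    by apply: measurable_funM; [exact: measurable_dotp_snd|exact: measurable_cst].
  exact: (measurableT_comp (@measurable_powR R _) measurable_fst).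
apply/funext => -[l z]; rewrite /wq/=; have [l0|_] := ltP 0 l; last by rewrite !mul0r.
by rewrite powR_inv1// ltW.
Qed.

(* The kernels p(z) |z|^(-2a) are superpositions over l > 0 of the Gaussians
   l^(a-1) p(z) e^(-l |z|^2), whose transforms c(y) l^(-b-1) e^(-|y|^2 / (4 l))
   integrate to c(y) Gamma b (|y|^2 / 4)^(-b): hence the powers of 2. *)
Let superposition_k a a' (c : 'rV[R]_n -> R[i]) (C : R) : 0 < a -> 0 <= C ->
  cmeasurable c -> (forall z, normc (c z) <= C * enorm z `^ (2 * a + a' - n%:R)) ->
  superposition mu (fun p => c p.2 * (wk a p)%:C)
    (fun z => c z * (Gamma a * enorm z `^ (- (2 * a)))%:C) a'.
Proof.
move=> a0 C0 mc cC.
apply: (@superposition_scale (wk a) _ c (C * Gamma a)) => //.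
- apply: measurable_funM; first exact: measurable_cst.
  by apply: (measurableT_comp (@measurable_powR R _)); exact: measurable_enorm.
- by move=> p; rewrite /wk !mulr_ge0 ?powR_ge0 ?expR_ge0.
- by move=> z; rewrite mulr_ge0 ?powR_ge0 ?(ltW (Gamma_gt0 a0)).
- move=> z z0; rewrite -mulrN -powR_dotp.
  have r0 : 0 < dotp z z by rewrite -sqr_enorm exprn_gt0// enorm_gt0.
  by rewrite -(integral_Gamma a0 r0); apply: eq_integral.
- by rewrite mulr_ge0 ?(ltW (Gamma_gt0 a0)).
(* At the origin the negative power is 0 by convention, and the bound is trivial. *)
move=> z; have [->|z0] := eqVneq z 0.
  have -> : enorm (0 : 'rV[R]_n) = 0 by apply/eqP; rewrite enorm_eq0.
  rewrite [X in Gamma a * X]powR0 ?mulr0; last by rewrite oppr_eq0 mulf_neq0// gt_eqF.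
  by rewrite !mulr_ge0 ?powR_ge0 ?(ltW (Gamma_gt0 a0)).
apply: (@le_trans _ _ (C * enorm z `^ (2 * a + a' - n%:R) * (Gamma a * enorm z `^ (- (2 * a))))).
  by rewrite ler_wpM2r// mulr_ge0 ?powR_ge0 ?(ltW (Gamma_gt0 a0)).
rewrite mulrACA ler_wpM2l ?mulr_ge0 ?(ltW (Gamma_gt0 a0))//.
rewrite -powRD_gt0 ?enorm_gt0//.
by rewrite le_eqVlt; apply/orP; left; apply/eqP; congr (_ `^ _); ring.
Qed.

Let superposition_q b s' (c : 'rV[R]_n -> R[i]) (C : R) : 0 < b -> 0 <= C ->
  cmeasurable c -> (forall z, normc (c z) <= C * enorm z `^ (2 * b - s')) ->
  superposition mu (fun p => c p.2 * (wq b p)%:C)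
    (fun z => c z * (Gamma b * (2 `^ (2 * b) * enorm z `^ (- (2 * b))))%:C) (n%:R - s').
Proof.
move=> b0 C0 mc cC.
apply: (@superposition_scale (wq b) _ c (C * (Gamma b * 2 `^ (2 * b)))) => //.
- apply: measurable_funM; first exact: measurable_cst.
  apply: measurable_funM; first exact: measurable_cst.
  by apply: (measurableT_comp (@measurable_powR R _)); exact: measurable_enorm.
- by move=> p; rewrite /wq !mulr_ge0 ?powR_ge0 ?expR_ge0.
- by move=> z; rewrite !mulr_ge0 ?powR_ge0 ?(ltW (Gamma_gt0 b0)).
- move=> z z0; have := @powR_dotp4 z (- b); rewrite mulrN opprK => <-.
  have r0 : 0 < dotp z z / 4 by rewrite divr_gt0// -sqr_enorm exprn_gt0// enorm_gt0.
  by rewrite -(integral_Gamma_inv b0 r0); apply: eq_integral.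
- by rewrite !mulr_ge0 ?powR_ge0 ?(ltW (Gamma_gt0 b0)).
move=> z; have [->|z0] := eqVneq z 0.
  have -> : enorm (0 : 'rV[R]_n) = 0 by apply/eqP; rewrite enorm_eq0.
  rewrite [X in _ * (_ * (_ * X))]powR0 ?mulr0; last by rewrite oppr_eq0 mulf_neq0// gt_eqF.
  by rewrite !mulr_ge0 ?powR_ge0 ?(ltW (Gamma_gt0 b0)).
apply: (@le_trans _ _ (C * enorm z `^ (2 * b - s') *
    (Gamma b * (2 `^ (2 * b) * enorm z `^ (- (2 * b)))))).
  by rewrite ler_wpM2r// !mulr_ge0 ?powR_ge0 ?(ltW (Gamma_gt0 b0)).
rewrite [X in _ * X]mulrA mulrACA ler_wpM2l ?mulr_ge0 ?powR_ge0 ?(ltW (Gamma_gt0 b0))//.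
rewrite -powRD_gt0 ?enorm_gt0//.
by rewrite le_eqVlt; apply/orP; left; apply/eqP; congr (_ `^ _); ring.
Qed.

Lemma power_kernel_integrable (s a C : R) (p : 'rV[R]_n -> R) f x :
  0 < s -> 2 * s < n%:R -> 0 < a -> 0 <= C -> measurable_fun setT p ->
  (forall z, `|p z| <= C * enorm z `^ (2 * a + 2 * s - n%:R)) -> wdecay 1 f ->
  cintegrable leb setT
    (fun z => (p z)%:C * (Gamma a * enorm z `^ (- (2 * a)))%:C * f (x + z)).
Proof.
move=> s0 sn a0 C0 mp pC wf.
apply: (superposition_integrable _ (@superposition_k a (2 * s) (fun z => (p z)%:C) C a0 C0 _ _)).
- by rewrite mulr_gt0//= ltW.
- exact: cmeasurable_real.
- by move=> z; rewrite normc_real.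
- exact: wdecay_translate.
Qed.

Let wk_gt0 a (p : 'rV[R]_n -> R) l z : 0 < l ->
  (p z)%:C * (wk a (l, z))%:C = (l `^ (a - 1))%:C * ((p z)%:C * (gauss l z)%:C) :> R[i].
Proof. by move=> l0; rewrite /wk/= l0 mul1r /gauss [l * _]mulrC rmorphM mulrCA. Qed.

(** There are two terms because transforms of second moments of a Gaussian carry two powers of 1/l.
    The superposition weight l^(a-1) completes an exponent [- b - a] to [- b - 1], the one of
    [integral_Gamma_inv]. *)
Lemma has_fourier_power (s a b1 b2 C C1 C2 : R) (p : 'rV[R]_n -> R)
    (c1 c2 : 'rV[R]_n -> R[i]) f :
  0 < s -> 2 * s < n%:R -> 0 < a -> 0 < b1 -> 0 < b2 ->
  0 <= C -> 0 <= C1 -> 0 <= C2 ->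
  measurable_fun setT p -> cmeasurable c1 -> cmeasurable c2 ->
  (forall z, `|p z| <= C * enorm z `^ (2 * a + 2 * s - n%:R)) ->
  (forall y, normc (c1 y) <= C1 * enorm y `^ (2 * b1 - 2 * s)) ->
  (forall y, normc (c2 y) <= C2 * enorm y `^ (2 * b2 - 2 * s)) ->
  (forall l, 0 < l -> cintegrable leb setT (fun z => (p z)%:C * (gauss l z)%:C)) ->
  (forall l y, 0 < l -> fourier (fun z => (p z)%:C * (gauss l z)%:C) (- y) =
    (c1 y * (l `^ (- b1 - a))%:C + c2 y * (l `^ (- b2 - a))%:C) *
    (expR (- (dotp y y / (4 * l))))%:C) ->
  schwartz f ->
  has_fourier (conv (fun z => (p z)%:C * (Gamma a * enorm z `^ (- (2 * a)))%:C) f)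
    (fun y => (c1 y * (Gamma b1 * (2 `^ (2 * b1) * enorm y `^ (- (2 * b1))))%:C +
               c2 y * (Gamma b2 * (2 `^ (2 * b2) * enorm y `^ (- (2 * b2))))%:C) *
      fourier f y).
Proof.
move=> s0 sn a0 b10 b20 C0 C10 C20 mp mc1 mc2 pC c1C c2C ip pE sf.
have sk := @superposition_k a (2 * s) (fun z => (p z)%:C) C a0 C0 (cmeasurable_real mp).
have sq := superpositionD (@superposition_q b1 (2 * s) c1 C1 b10 C10 mc1 c1C)
  (@superposition_q b2 (2 * s) c2 C2 b20 C20 mc2 c2C).
apply: (has_fourier_conv _ _ (sk _) sq) => //.
- by rewrite mulr_gt0//= ltW.
- by rewrite subr_gt0 sn/= gerBl mulr_ge0// ltW.
- by move=> z; rewrite normc_real.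
- move=> l /=; have [l0|l0] := ltP 0 l.
    have := cintegrableMl (l `^ (a - 1))%:C (ip l l0); congr cintegrable.
    by apply/funext => z; rewrite wk_gt0.
  have := @cintegrable_cst0 _ _ _ leb; congr cintegrable.
  by apply/funext => z; rewrite /wk/= ltNge l0 mul0r mulr0.
move=> l y /=; have [l0|l0] := ltP 0 l.
  transitivity (fourier (fun z => (l `^ (a - 1))%:C * ((p z)%:C * (gauss l z)%:C)) (- y)).
    by apply: eq_cintegral => z; rewrite wk_gt0.
  rewrite fourierZ; last exact: ip.
  have wqE b : wq b (l, y) = l `^ (a - 1) * l `^ (- b - a) * expR (- (dotp y y / (4 * l))).
    rewrite /wq/= l0 mul1r -powRD_gt0// invfM mulrA; congr (_ `^ _ * _).
    by ring.
  by rewrite pE// !wqE !rmorphM; ring.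
rewrite /wq/= ltNge l0 !mul0r !mulr0 addr0 -[RHS](@cintegral_cst0 R _ _ leb).
by apply: eq_cintegral => z; rewrite /wk/= ltNge l0 mul0r !mulr0.
Qed.

End power_kernels.

(** * Real scalars in possibly divergent integrals *)

Section real_scaling.
Context {R : realType} d (T : measurableType d).
Variable mu : {measure set T -> \bar R}.

Let Rintegral_nonintegrable (D : set T) (f : T -> R) : measurable D ->
  measurable_fun D f -> ~ mu.-integrable D (EFin \o f) ->
  \int[mu]_(x in D) f x = 0.
Proof.
move=> mD mf nf; rewrite /Rintegral integralE.
have mp : measurable_fun D ((EFin \o f)^\+)%E by apply: measurable_funepos; exact/measurable_EFinP.
have mn : measurable_fun D ((EFin \o f)^\-)%E by apply: measurable_funeneg; exact/measurable_EFinP.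
have p0 : (0 <= \int[mu]_(x in D) (EFin \o f)^\+ x)%E by apply: integral_ge0 => x _; exact: funepos_ge0.
have n0 : (0 <= \int[mu]_(x in D) (EFin \o f)^\- x)%E by apply: integral_ge0 => x _; exact: funeneg_ge0.
move: p0 n0; case Ep : (\int[mu]_(x in D) (EFin \o f)^\+ x)%E => [u||] //;
  case En : (\int[mu]_(x in D) (EFin \o f)^\- x)%E => [v||] //.
move=> _ _; exfalso; apply: nf; apply/integrableP; split; first exact/measurable_EFinP.
have -> : (\int[mu]_(x in D) `|(EFin \o f) x| =
    \int[mu]_(x in D) ((EFin \o f)^\+ x + (EFin \o f)^\- x))%E.
  by apply: eq_integral => x _; rewrite -[RHS]/(((EFin \o f)^\+ \+ (EFin \o f)^\-)%E x) -fune_abse.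
by rewrite ge0_integralD// Ep En -EFinD ltry.
Qed.

(* Real scalars come out of any integral of a measurable function: a divergent
   one is [fine] of an infinity, that is 0. *)
Let RintegralZl_measurable (D : set T) (c : R) (f : T -> R) : measurable D ->
  measurable_fun D f -> \int[mu]_(x in D) (c * f x) = c * \int[mu]_(x in D) f x.
Proof.
move=> mD mf; have [fi|nfi] := pselect (mu.-integrable D (EFin \o f)).
  exact: RintegralZl.
have [->|c0] := eqVneq c 0.
  rewrite mul0r /Rintegral -[RHS]/(fine 0) -[in RHS](@integral0 _ _ R mu D).
  by congr fine; apply: eq_integral => x _; rewrite mul0r.
rewrite !Rintegral_nonintegrable ?mulr0//; first exact: measurable_funM.
move=> cfi; apply: nfi; have := integrableZl mD c^-1 cfi.
by congr (integrable _ _ _); apply/funext => x /=; rewrite -EFinM mulKf.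
Qed.

(** Serves to move the factor xi_i inside the beam integral, for every xi and without discussing
    convergence. *)
Lemma cintegralMl_real (D : set T) (c : R) (g : T -> R[i]) : measurable D ->
  cmeasurable g -> cintegral mu D (fun x => c%:C * g x) = c%:C * cintegral mu D g.
Proof.
move=> mD [mr mi]; rewrite /cintegral; apply: complex_eq; rewrite ?Re_mul ?Im_mul/= mul0r ?subr0 ?addr0.
  rewrite -RintegralZl_measurable//; last exact: measurable_funTS.
  by apply: eq_Rintegral => x _; rewrite Re_mul/= mul0r subr0.
rewrite -RintegralZl_measurable//; last exact: measurable_funTS.
by apply: eq_Rintegral => x _; rewrite Im_mul/= mul0r addr0.
Qed.

End real_scaling.

(** * The averages as convolutions, and their transforms *)

Section averages.
Context {R : realType} {m : nat}.
Local Notation n := m.+1.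
Local Notation leb := (@lebesgue_row R n).
Local Notation mu := (@lebesgue_measure R).
Local Notation normc := (@Normc.normc R).
Variables (s : R) (f : 'I_n -> 'rV[R]_n -> R[i]).
Hypotheses (n2 : (2 <= n)%N) (s0 : 0 < s) (s1 : s < 1).
Hypothesis sf : forall j, schwartz (f j).
Implicit Types (x y z xi : 'rV[R]_n) (i j : 'I_n) (l t : R).

(** Makes both orders positive: 2s for kernels of size |z|^(2s-n), and n - 2s for transforms of size
    |y|^(-2s). *)
Let sn : 2 * s < n%:R.
Proof.
apply: (@lt_le_trans _ _ 2); first by rewrite gtr_pMr.
by rewrite ler_nat.
Qed.

(** Half exponents: a homogeneous polynomial of degree 0, 1 or 2 times |z| to the power -2 [a0], -2
    [a1] or -2 [a2] has degree 2s - n. The last two are the Gamma arguments in the numerators of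
    [c10] and [c11]. *)
Let a0 : R := (n%:R - 2 * s) / 2.
Let a1 : R := (n%:R + 1 - 2 * s) / 2.
Let a2 : R := (n%:R + 2 - 2 * s) / 2.
Let a0_gt0 : 0 < a0. Proof. by rewrite divr_gt0// subr_gt0. Qed.
Let a1_gt0 : 0 < a1. Proof. by rewrite divr_gt0//; have := sn; lra. Qed.
Let a2_gt0 : 0 < a2. Proof. by rewrite divr_gt0//; have := sn; lra. Qed.

Let P : R := pi `^ (n%:R / 2).
Let P_gt0 : 0 < P. Proof. by rewrite powR_gt0// pi_gt0. Qed.

Let sqrt_pi_div l : 0 < l ->
  Num.sqrt (pi / l) ^+ n = P * l `^ (- (n%:R / 2)).
Proof.
move=> l0; have pl : 0 <= pi / l by rewrite divr_ge0 ?pi_ge0// ltW.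
rewrite -powR12_sqrt// -powR_mulrn ?powR_ge0// -powRrM.
rewrite powRM ?pi_ge0 ?invr_ge0 ?(ltW l0)// -[l^-1]powR_inv1 ?(ltW l0)// -powRrM.
by congr (_ `^ _ * _ `^ _); rewrite /P; field.
Qed.

(** Up to a constant, the Riesz potential kernel; the factor 1 stands for the polynomial p of
    [has_fourier_power]. The Gamma factors of [K1] and [K2] will cancel the numerators of [c10] and
    [c11]. *)
Let K0 z : R[i] := (1 : R)%:C * (Gamma a0 * enorm z `^ (- (2 * a0)))%:C.
Let K1 j z : R[i] := (z ord0 j)%:C * (Gamma a1 * enorm z `^ (- (2 * a1)))%:C.
Let K2 i j z : R[i] :=
  (z ord0 i * z ord0 j)%:C * (Gamma a2 * enorm z `^ (- (2 * a2)))%:C.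

Let bound1 j z : `|z ord0 j| <= 1 * enorm z `^ (2 * a1 + 2 * s - n%:R).
Proof.
have -> : 2 * a1 + 2 * s - n%:R = 1 by rewrite /a1; field.
by rewrite powRr1 ?enorm_ge0// mul1r coor_le_enorm.
Qed.

Let bound2 i j z : `|z ord0 i * z ord0 j| <= 1 * enorm z `^ (2 * a2 + 2 * s - n%:R).
Proof.
have -> : 2 * a2 + 2 * s - n%:R = 2 by rewrite /a2; field.
rewrite mul1r powR_mulrn ?enorm_ge0// normrM expr2.
by apply: ler_pM => //; exact: coor_le_enorm.
Qed.

Let mcoor j : measurable_fun setT (fun z : 'rV[R]_n => z ord0 j).
Proof. exact: (@measurable_row_coor R n j). Qed.

(** The cancellations of constants, with Gamma values and powers made nonzero variables: p is the
    power of pi, g the Gamma value on the frequency side and t is 2^(2s). In the next two, c is the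
    Gamma factor of the kernel. *)
Let constant0 (p g t e : R) : p != 0 -> g != 0 -> t != 0 ->
  (p * g * t)^-1 * (p * (g * (t * e))) = e.
Proof. by move=> p0 g0 t0; field; rewrite p0 g0 t0. Qed.

Let constant1 (c p g t y e : R) : c != 0 -> p != 0 -> g != 0 -> t != 0 ->
  (- c / (t * p * g) / c)%:C * (0 +i* (p * y / 2)) * (g * (t * 2) * e)%:C =
  0 -i* (y * e) :> R[i].
Proof.
move=> c0 p0 g0 t0; apply: complex_eq => /=; first by ring.
by field; rewrite c0 p0 g0 t0.
Qed.

Let constant2 (c p g t d y e e' : R) : c != 0 -> p != 0 -> g != 0 -> t != 0 ->
  - c / (t / 2 * p * g) / c *
    (d / 2 * p * (g * (t * e)) - y * p / 4 * (s * g * (t * 4 * e'))) =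
  2 * s * y * e' - d * e.
Proof. by move=> c0 p0 g0 t0; field; rewrite c0 p0 g0 t0. Qed.

Let has_fourier0 j : has_fourier (conv K0 (f j)) (fun y =>
  (P * (Gamma s * (2 `^ (2 * s) * enorm y `^ (- (2 * s)))))%:C * fourier (f j) y).
Proof.
(* One term suffices, so the second is 0 with an arbitrary exponent 1. The first exponent is s
   because s + a0 = n/2. *)
have := @has_fourier_power _ _ s a0 s 1 1 P 0 (fun=> 1) (fun=> P%:C) (fun=> 0) (f j)
  s0 sn a0_gt0 s0 ltr01 ler01 (ltW P_gt0) (lexx 0).
move=> /(_ _ _ _ _ _ _ _ _ _)/wrap[||| z| y| y| l l0| l y l0| |].
- exact: measurable_cst.
- exact: cmeasurable_cst.
- exact: cmeasurable_cst.
- have -> : 2 * a0 + 2 * s - n%:R = 0 by rewrite /a0; field.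
  by rewrite powRr0 normr1 mulr1.
- by rewrite subrr powRr0 mulr1 normc_real ger0_norm// ltW.
- by rewrite mul0r Normc.normc0.
- have := wdecay_integrable (ltn0Sn 0) (@gauss_wdecay R n 1 l l0); congr cintegrable.
  by apply/funext => z; rewrite mul1r.
- transitivity (fourier (fun z : 'rV[R]_n => (gauss l z)%:C) (- y)).
    by apply: eq_cintegral => z; rewrite mul1r.
  rewrite fourier_gauss// sqrt_pi_div// dotpNl dotpNr opprK mul0r addr0 !rmorphM.
  by congr (_ * _%:C * _); congr (_ `^ _); rewrite /a0; field.
- exact: sf.
congr has_fourier; apply/funext => y.
by rewrite mul0r addr0 !rmorphM.
Qed.

Let has_fourier1 j : has_fourier (conv (K1 j) (f j)) (fun y =>
  (0 +i* (P * y ord0 j / 2)) *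
  (Gamma (s + 2^-1) * (2 `^ (2 * (s + 2^-1)) * enorm y `^ (- (2 * (s + 2^-1)))))%:C *
  fourier (f j) y).
Proof.
have b0 : 0 < s + 2^-1 by rewrite addr_gt0.
(* s + 1/2 + a1 = n/2 + 1 is the power of 1/l in the transform of z_j times a Gaussian; evaluation
   at -y turns its factor -i into +i. *)
have := @has_fourier_power _ _ s a1 (s + 2^-1) 1 1 (P / 2) 0 (fun z => z ord0 j)
  (fun y => 0 +i* (P * y ord0 j / 2)) (fun=> 0) (f j)
  s0 sn a1_gt0 b0 ltr01 ler01 _ (lexx 0).
move=> /(_ _ _ _ _ _ _ _ _ _ _)/wrap[|||| z| y| y| l l0| l y l0| |].
- by rewrite divr_ge0// ltW.
- exact: mcoor.
- split; first exact: measurable_cst.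
  by apply: measurable_funM; [apply: measurable_funM => //; exact: measurable_cst|exact: measurable_cst].
- exact: cmeasurable_cst.
- exact: bound1.
- have -> : 2 * (s + 2^-1) - 2 * s = 1 by field.
  rewrite powRr1 ?enorm_ge0// normc_ReIm/= expr0n/= add0r sqrtr_sqr mulrAC normrM.
  by rewrite ger0_norm ?divr_ge0 ?(ltW P_gt0)// ler_wpM2l ?divr_ge0 ?(ltW P_gt0)// coor_le_enorm.
- by rewrite mul0r Normc.normc0.
- exact: (wdecay_integrable (ltn0Sn 0) (coor_wdecay j (@gauss_wdecay R n 2 l l0))).
- rewrite fourier_coor_gauss// sqrt_pi_div// dotpNl dotpNr opprK mul0r addr0 !rmorphM mxE.
  have -> : l `^ (- (s + 2^-1) - a1) = l `^ (- (n%:R / 2)) * l^-1.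
    rewrite -[in RHS](powR_inv1 (ltW l0)) -powRD_gt0//.
    by congr (_ `^ _); rewrite /a1; field.
  rewrite rmorphM !mulrA; congr (_ * _).
  by apply: complex_eq => /=; field; rewrite gt_eqF.
- exact: sf.
congr has_fourier; apply/funext => y.
by rewrite mul0r addr0.
Qed.

Let has_fourier2 i j : has_fourier (conv (K2 i j) (f j)) (fun y =>
  (((i == j)%:R / 2 * P * (Gamma s * (2 `^ (2 * s) * enorm y `^ (- (2 * s))))) -
   (y ord0 i * y ord0 j * P / 4 *
     (Gamma (s + 1) * (2 `^ (2 * (s + 1)) * enorm y `^ (- (2 * (s + 1)))))))%:C *
  fourier (f j) y).
Proof.
have b0 : 0 < s + 1 by rewrite addr_gt0.
(* s + a2 = n/2 + 1 and s + 1 + a2 = n/2 + 2 are the powers of 1/l in the two terms. *)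
have := @has_fourier_power _ _ s a2 s (s + 1) 1 ((i == j)%:R / 2 * P) (P / 4)
  (fun z => z ord0 i * z ord0 j)
  (fun=> ((i == j)%:R / 2 * P)%:C) (fun y => (- (y ord0 i * y ord0 j * P / 4))%:C) (f j)
  s0 sn a2_gt0 s0 b0 ler01.
have pgE l : (fun z : 'rV[R]_n => (z ord0 i * z ord0 j)%:C * (gauss l z)%:C) =
    (fun z => (z ord0 i)%:C * ((z ord0 j)%:C * (gauss l z)%:C)).
  by apply/funext => z; rewrite rmorphM mulrA.
move=> /(_ _ _ _ _ _ _ _ _ _ _ _)/wrap[|||||z|y|y|l l0|l y l0||].
- by rewrite !mulr_ge0// ltW.
- by rewrite divr_ge0// ltW.
- by apply: measurable_funM; exact: mcoor.
- exact: cmeasurable_cst.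
- apply: cmeasurable_real; apply: (measurableT_comp (@oppr_measurable R setT)).
  apply: measurable_funM; last exact: measurable_cst.
  by apply: measurable_funM; [apply: measurable_funM; exact: mcoor|exact: measurable_cst].
- exact: bound2.
- by rewrite subrr powRr0 mulr1 normc_real ger0_norm// !mulr_ge0// ltW.
- have -> : 2 * (s + 1) - 2 * s = 2 by ring.
  rewrite powR_mulrn ?enorm_ge0// normc_real normrN -mulrA mulrC normrM.
  rewrite ger0_norm ?divr_ge0 ?(ltW P_gt0)// ler_wpM2l ?divr_ge0 ?(ltW P_gt0)//.
  by rewrite normrM expr2; apply: ler_pM => //; exact: coor_le_enorm.
- rewrite pgE.
  exact: (wdecay_integrable (ltn0Sn 0) (coor_wdecay i (coor_wdecay j (@gauss_wdecay R n 3 l l0)))).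
- rewrite pgE fourier_coor2_gauss// sqrt_pi_div// dotpNl dotpNr opprK !mxE.
  have -> : l `^ (- s - a2) = l `^ (- (n%:R / 2)) * l^-1.
    rewrite -[in RHS](powR_inv1 (ltW l0)) -powRD_gt0//.
    by congr (_ `^ _); rewrite /a2; field.
  have -> : l `^ (- (s + 1) - a2) = l `^ (- (n%:R / 2)) * l^-2.
    rewrite -powR_mulrn ?(ltW l0)// -powRN -powRD_gt0//.
    by congr (_ `^ _); rewrite /a2; field.
  rewrite eq_sym -!rmorphM -rmorphD -!rmorphM; congr (_%:C); rewrite /=.
  by field; rewrite gt_eqF.
- exact: sf.
congr has_fourier; apply/funext => y.
by rewrite -!rmorphM -rmorphD mulNr.
Qed.

(** The function I is (-Delta)^(-s) f_j. It helps to write R_i A^0, and it is what the bracket of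
    the inversion formula reduces to; only its transform matters. *)
Lemma has_fourier_riesz_potential j : exists I, has_fourier I
  (fun y => (enorm y `^ (- (2 * s)))%:C * fourier (f j) y).
Proof.
exists (fun x => ((P * Gamma s * 2 `^ (2 * s))^-1)%:C * conv K0 (f j) x).
have := has_fourierMl ((P * Gamma s * 2 `^ (2 * s))^-1)%:C (has_fourier0 j).
congr has_fourier; apply/funext => y; rewrite mulrA -rmorphM; congr (_%:C * _).
by apply: constant0; rewrite gt_eqF ?P_gt0 ?Gamma_gt0 ?powR_gt0//.
Qed.

Let integrable1 j x : cintegrable leb setT (fun z => K1 j z * f j (x + z)).
Proof.
exact: (power_kernel_integrable x s0 sn a1_gt0 ler01 (mcoor j) (bound1 j) (schwartz_wdecay 1 (sf j))).
Qed.

Let integrable2 i j x : cintegrable leb setT (fun z => K2 i j z * f j (x + z)).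
Proof.
apply: (power_kernel_integrable x s0 sn a2_gt0 ler01 _ (bound2 i j) (schwartz_wdecay 1 (sf j))).
by apply: measurable_funM; exact: mcoor.
Qed.

Let cmeasurable_line j x xi : cmeasurable (fun t : measurableTypeR R => f j (x + t *: xi)).
Proof.
have [mf _] := schwartz_wdecay 0 (sf j).
apply: (cmeasurable_comp mf); apply: measurable_row_add; first exact: measurable_cst.
by apply: measurable_row_scale; [exact: measurable_id|exact: measurable_cst].
Qed.

Let average0E x : average0 s f x =
  \sum_j (c10 s (n := n) / Gamma a1)%:C * conv (K1 j) (f j) x.
Proof.
pose G z := \sum_j (Gamma a1)^-1%:C * (K1 j z * f j (x + z)).
have iG : cintegrable leb setT G.
  by apply: cintegrable_sum => j; apply: cintegrableMl; exact: integrable1.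
have G0 := Gamma_gt0 a1_gt0.
rewrite /average0 /beam (cintegral_polar iG) => [|xi t Sxi t0].
  rewrite cintegral_sum => [|j]; last by apply: cintegrableMl; exact: integrable1.
  rewrite mulr_sumr; apply: eq_bigr => j _.
  by rewrite cintegralMl// mulrA -rmorphM.
rewrite !mulr_sumr; apply: eq_bigr => j _.
rewrite /K1 !mxE enormZ Sxi mulr1 gtr0_norm//.
(* In the exponent of t, m comes from the Jacobian, 1 from z_j = t xi_j and the rest from |z|^(-2
   a1). *)
have -> : t `^ (2 * s - 1) = t ^+ m * (t * t `^ (- (2 * a1))).
  rewrite -powR_mulrn ?(ltW t0)// -[X in _ * (X * _)](powRr1 (ltW t0)) -!powRD_gt0//.
  by congr (_ `^ _); rewrite /a1 -natr1; field.
by rewrite !rmorphM fmorphV; field; rewrite realC_neq0 ?gt_eqF.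
Qed.

Let average1E i x : average1 s f i x =
  \sum_j (c11 s (n := n) / Gamma a2)%:C * conv (K2 i j) (f j) x.
Proof.
pose G z := \sum_j (Gamma a2)^-1%:C * (K2 i j z * f j (x + z)).
have iG : cintegrable leb setT G.
  by apply: cintegrable_sum => j; apply: cintegrableMl; exact: integrable2.
have G0 := Gamma_gt0 a2_gt0.
have bE : (fun xi => (xi ord0 i)%:C * beam s f x xi) = (fun xi =>
    cintegral mu `]0, +oo[ (fun t => (xi ord0 i)%:C * ((t `^ (2 * s - 1))%:C *
      \sum_(j < n) f j (x + t *: xi) * (xi ord0 j)%:C))).
  apply/funext => xi; rewrite cintegralMl_real//.
  apply: cmeasurableM; first by apply: cmeasurable_real; exact: measurable_powR.
  apply: cmeasurable_sum => j; apply: cmeasurableM; first exact: cmeasurable_line.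
  exact: cmeasurable_cst.
rewrite /average1 bE (cintegral_polar iG) => [|xi t Sxi t0].
  rewrite cintegral_sum => [|j]; last by apply: cintegrableMl; exact: integrable2.
  rewrite mulr_sumr; apply: eq_bigr => j _.
  by rewrite cintegralMl// mulrA -rmorphM.
rewrite !mulr_sumr; apply: eq_bigr => j _.
rewrite /K2 !mxE enormZ Sxi mulr1 gtr0_norm//.
(* Here z_i z_j gives t^2 and the kernel t^(-2 a2), besides the Jacobian t^m. *)
have -> : t `^ (2 * s - 1) = t ^+ m * (t * t * t `^ (- (2 * a2))).
  rewrite -expr2.
  rewrite -!powR_mulrn ?(ltW t0)// -!powRD_gt0//.
  by congr (_ `^ _); rewrite /a2 -natr1; field.
by rewrite !rmorphM fmorphV; field; rewrite realC_neq0 ?gt_eqF.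
Qed.

Lemma has_fourier_average0 : has_fourier (average0 s f) (fun y =>
  \sum_j (0 -i* (y ord0 j * enorm y `^ (- (2 * s + 1)))) * fourier (f j) y).
Proof.
have -> : average0 s f = (fun x => \sum_j (c10 s (n := n) / Gamma a1)%:C * conv (K1 j) (f j) x).
  by apply/funext => x; exact: average0E.
apply: has_fourier_sum => j.
have := has_fourierMl (c10 s (n := n) / Gamma a1)%:C (has_fourier1 j).
congr has_fourier; apply/funext => y; rewrite !mulrA; congr (_ * _).
have -> : 2 * (s + 2^-1) = 2 * s + 1 by field.
have G1 : Gamma a1 != 0 by rewrite gt_eqF// Gamma_gt0.
have G2 : Gamma (s + 2^-1) != 0 by rewrite gt_eqF// Gamma_gt0// addr_gt0.
rewrite /c10 -/a1 -/P powRD_gt0// powRr1//.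
have p0 : 2 `^ (2 * s) != 0 :> R by rewrite gt_eqF// powR_gt0.
have P0 := lt0r_neq0 P_gt0.
exact: constant1.
Qed.

Lemma has_fourier_average1 i : has_fourier (average1 s f i) (fun y =>
  \sum_j (2 * s * (y ord0 i * y ord0 j) * enorm y `^ (- (2 * s + 2))
          - (i == j)%:R * enorm y `^ (- (2 * s)))%:C * fourier (f j) y).
Proof.
have -> : average1 s f i = (fun x => \sum_j (c11 s (n := n) / Gamma a2)%:C * conv (K2 i j) (f j) x).
  by apply/funext => x; exact: average1E.
apply: has_fourier_sum => j.
have := has_fourierMl (c11 s (n := n) / Gamma a2)%:C (has_fourier2 i j).
congr has_fourier; apply/funext => y; rewrite mulrA -rmorphM; congr (_%:C * _).
have -> : 2 * (s + 1) = 2 * s + 2 by field.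
have G1 : Gamma a2 != 0 by rewrite gt_eqF// Gamma_gt0.
have G2 : Gamma s != 0 by rewrite gt_eqF// Gamma_gt0.
have p0 : 2 `^ (2 * s) != 0 :> R by rewrite gt_eqF// powR_gt0.
have P0 := lt0r_neq0 P_gt0.
have p1 : 2 `^ (2 * s - 1) = 2 `^ (2 * s) / 2 :> R.
  by rewrite powRD_gt0// powRN powRr1.
have p2 : 2 `^ (2 * s + 2) = 2 `^ (2 * s) * 4 :> R.
  by rewrite powRD_gt0// powR_mulrn// expr2; congr (_ * _); ring.
rewrite /c11 -/a2 -/P GammaS// p1 p2.
exact: constant2.
Qed.

End averages.

(** * The inversion formula *)

Section fractional_laplacian.
Context {R : realType} {m : nat}.
Local Notation n := m.+1.
Local Notation leb := (@lebesgue_row R n).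

Lemma beam_inversion (s : R) (f : 'I_n -> 'rV[R]_n -> R[i]) (i : 'I_n) :
  (2 <= n)%N -> 0 < s -> s < 1 -> (forall j, schwartz (f j)) ->
  [/\ tempered_fun (average0 s f),
      tempered_fun (average1 s f i) &
      exists2 RA : @dist R n,
        is_riesz i (dist_of (average0 s f)) RA &
        is_fraclap s
          (fun phi => (- (2 * s))%:C * RA phi - dist_of (average1 s f i) phi)
          (dist_of (f i))].
Proof.
move=> n2 s0 s1 sf.
have H0 := has_fourier_average0 n2 s0 s1 sf.
have H1 := has_fourier_average1 n2 s0 s1 sf i.
have [I HI] := has_fourier_riesz_potential n2 s0 s1 sf i.
have [w0 wg0 FA0] := H0; have [w1 _ _] := H1; have [wI wgI FI] := HI.
split; [exact: wgrow_tempered_fun|exact: wgrow_tempered_fun|].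
pose B x := (- (2 * s)^-1)%:C * (average1 s f i x + I x).
have [wB wgB FB] : has_fourier B _ := has_fourierMl (- (2 * s)^-1)%:C (has_fourierD H1 HI).
have s2 : 2 * s != 0 by rewrite mulf_neq0// gt_eqF.
(* The symbol of R_i A^0 is - y_i y_j |y|^(-2s-2), hence R_i A^0 is a combination
   of A^(1,i) and of the Riesz potential I of f_i. *)
exists (dist_of B).
  split; [exact: tempered_dist_of|exact: tempered_dist_of|].
  have gE : (fun y : 'rV[R]_n => (0 -i* (y ord0 i / enorm y)) *
      \sum_j (0 -i* (y ord0 j * enorm y `^ (- (2 * s + 1)))) * fourier (f j) y) =
    (fun y => (- (2 * s)^-1)%:C *
      (\sum_j (2 * s * (y ord0 i * y ord0 j) * enorm y `^ (- (2 * s + 2))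
          - (i == j)%:R * enorm y `^ (- (2 * s)))%:C * fourier (f j) y +
       (enorm y `^ (- (2 * s)))%:C * fourier (f i) y)).
    apply/funext => y.
    have -> : (enorm y `^ (- (2 * s)))%:C * fourier (f i) y =
        \sum_j ((i == j)%:R * enorm y `^ (- (2 * s)))%:C * fourier (f j) y.
      rewrite (bigD1 i)//= eqxx mul1r big1 ?addr0// => j ji.
      by rewrite eq_sym (negbTE ji) !mul0r.
    rewrite -big_split/= !mulr_sumr; apply: eq_bigr => j _.
    rewrite -mulrDl !mulrA; congr (_ * _).
    (* At y = 0 the coordinates vanish and the two terms in [i == j] cancel, whatever the
       conventional values of the powers. *)
    have [->|y0] := eqVneq y 0.
      by apply: complex_eq => /=; rewrite !mxE; ring.
    have e0 : 0 < enorm y by rewrite enorm_gt0.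
    have -> : enorm y `^ (- (2 * s + 1)) = enorm y * enorm y `^ (- (2 * s + 2)).
      rewrite -[X in _ = X * _](powRr1 (ltW e0)) -powRD_gt0//; congr (_ `^ _); ring.
    by apply: complex_eq => /=; field; rewrite ?gt_eqF.
  exists (fun y : 'rV[R]_n => \sum_j (0 -i* (y ord0 j * enorm y `^ (- (2 * s + 1)))) * fourier (f j) y).
  split; [exact: wgrow_tempered_fun|exact: FA0| |].
    by rewrite gE; exact: wgrow_tempered_fun.
  by rewrite gE; exact: FB.
pose u : @dist R n := fun phi => (- (2 * s))%:C * dist_of B phi - dist_of (average1 s f i) phi.
(* Applying -2s to B and subtracting A^(1,i) leaves I. Stating it on [wdecay 2] covers Schwartz
   functions and their transforms alike. *)
have uI h : wdecay 2 h -> u h = dist_of I h.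
  move=> wh; rewrite /u dist_ofMl//; last exact: wgrowD.
  rewrite dist_ofD// mulrA -rmorphM mulrNN mulfV// mul1r.
  by rewrite addrAC subrr add0r.
split; first exact: (tempered_wgrow wI uI).
pose g y := (enorm y `^ (- (2 * s)))%:C * fourier (f i) y.
have iF := wdecay_integrable (ltn0Sn 0) (fourier_wdecay 1 (sf i)).
have [mf _] := schwartz_wdecay 0 (sf i).
have [mg _] := wgI.
have mpg : cmeasurable (fun y => (enorm y `^ (2 * s))%:C * g y).
  apply: cmeasurableM; last exact: mg.
  apply: cmeasurable_real; apply: (measurableT_comp (@measurable_powR R _)).
  exact: measurable_enorm.
have e0 : enorm (0 : 'rV[R]_n) = 0 by apply/eqP; rewrite enorm_eq0.
have pgE y : y != 0 -> (enorm y `^ (2 * s))%:C * g y = fourier (f i) y.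
  move=> y0; rewrite /g mulrA -rmorphM -powRD_gt0 ?enorm_gt0// subrr powRr0.
  by rewrite mul1r.
(* The product |y|^(2s) |y|^(-2s) F f_i is F f_i off the origin and 0 at the origin; the inversion
   formula sees it only almost everywhere. *)
exists (dist_of (fun y => (enorm y `^ (2 * s))%:C * g y)).
  exists g; split => //; first exact: wgrow_tempered_fun.
  - by move=> phi sphi; have := uI _ (fourier_wdecay 2 sphi); rewrite FI//; apply.
  apply: wgrow_tempered_fun; apply: (wgrow_le mpg (cintegrable_normc iF)) => y.
  have [->|y0] := eqVneq y 0; last by rewrite pgE.
  by rewrite /g mulrA -rmorphM e0 powR0 ?mul0r// Normc.normc0 normc_ge0.
move=> phi sphi; rewrite /fourier_inv_dist /dist_of fourier_inversion//.
have [mphi _] := schwartz_wdecay 0 sphi.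
apply: eq_cintegral_neq0 => //.
- by apply: cmeasurableM; [exact: cmeasurable_fourier|exact: cmeasurable_fourier_inv].
- by apply: cmeasurableM => //; exact: cmeasurable_fourier_inv.
by move=> y y0; rewrite pgE.
Qed.

End fractional_laplacian.

Theorem theorem4p8 (R : realType) (n : nat) (s : R)
    (f : 'I_n -> 'rV[R]_n -> R[i])
    (hn : (2 <= n)%N) (hs : 0 < s < 1) (hs2 : s != 2^-1)
    (hf : forall j : 'I_n, schwartz (f j)) (i : 'I_n) :
  [/\ tempered_fun (average0 s f),
      tempered_fun (average1 s f i) &
      exists2 RA : @dist R n,
        is_riesz i (dist_of (average0 s f)) RA &
        is_fraclap s
          (fun phi => (- (2 * s))%:C * RA phi - dist_of (average1 s f i) phi)
          (dist_of (f i))].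
Proof.
case/andP: hs => s0 s1; case: n f hn hf i => [//|m] f n2 sf i.
exact: beam_inversion.
Qed.
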